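(* Let $N\ge2$, $\alpha\in(0,1)$, $\beta>-1$ and $0<p\le1$. For $k>0$ let $u_k$ be the unique positive weak solution of $$\partial_tu+(-\Delta)^\alpha u+t^\beta u^p=0\ \text{ in }Q_\infty,\qquad u(0,\cdot)=k\delta_0\ \text{ in }\mathbb{R}^N.$$ Then $$\lim_{k\to\infty}u_k=\infty\quad\text{in }Q_\infty,$$ locally uniformly in $Q_\infty$.
   Context: Notation: $Q_\infty=(0,\infty)\times\mathbb{R}^N$, $Q_T=(0,T)\times\mathbb{R}^N$; $\delta_0$ is the Dirac mass at the origin. The fractional Laplacian (acting in $x$) is $(-\Delta)^\alpha u(t,x)=\lim_{\epsilon\to0^+}(-\Delta)^\alpha_\epsilon u(t,x)$, with $(-\Delta)^\alpha_\epsilon u(t,x)=\int_{\{|x-z|>\epsilon\}}\frac{u(t,x)-u(t,z)}{|z-x|^{N+2\alpha}}\,dz$. Weak solution with initial data $k\delta_0$: a function $u\ge0$ such that for every $T>0$, $u\in L^1(Q_T)$, $t^\beta u^p\in L^1(Q_T)$ and $$\int_{Q_T}\big(u[-\partial_t\xi+(-\Delta)^\alpha\xi]+t^\beta u^p\xi\big)\,dx\,dt=k\,\xi(0,0)-\int_{\mathbb{R}^N}\xi(T,x)u(T,x)\,dx\quad\forall\,\xi\in\mathbb{Y}_{\alpha,T},$$ where $\mathbb{Y}_{\alpha,T}$ is the space of $\xi:[0,T]\times\mathbb{R}^N\to\mathbb{R}$ such that (1) $\|\xi\|_{L^1(Q_T)}+\|\xi\|_{L^\infty(Q_T)}+\|\partial_t\xi\|_{L^\infty(Q_T)}+\|(-\Delta)^\alpha\xi\|_{L^\infty(Q_T)}<+\infty$,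 and (2) for $t\in(0,T)$ there exist $M,\epsilon_0>0$ with $\|(-\Delta)^\alpha_\epsilon\xi(t,\cdot)\|_{L^\infty(\mathbb{R}^N)}\le M$ for all $\epsilon\in(0,\epsilon_0]$. For $0<p<1+\frac{2\alpha(1+\beta)}{N}$ and each $k>0$ such a solution $u_k$ exists and is unique. *)

(* Defs.v *)
From HB Require Import structures.
From mathcomp Require Import all_boot all_order all_algebra.
From mathcomp Require Import all_classical all_reals all_analysis.
Import Order.TTheory GRing.Theory Num.Theory.
Import numFieldNormedType.Exports.

Set Implicit Arguments.
Unset Strict Implicit.
Unset Printing Implicit Defensive.

Local Open Scope classical_set_scope.
Local Open Scope ring_scope.

(* R^n is 'rV[R]_n.  Its library topology is the usual one, but its library   *)
(* norm is the sup norm, hence enorm below; the sigma-algebra and the Lebesgue *)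
(* measure are not in the library and are constructed here.                   *)

Section measurable_rV.
Context {R : realType} (n : nat).

Let coords : 'I_n -> 'rV[R]_n -> R := fun i x => x 0 i.

Let rV_set0 : g_sigma_preimage coords set0.
Proof. exact: sigma_algebra0. Qed.

Let rV_setC A : g_sigma_preimage coords A -> g_sigma_preimage coords (~` A).
Proof. exact: sigma_algebraC. Qed.

Let rV_bigcup (F : (set 'rV[R]_n)^nat) :
  (forall i, g_sigma_preimage coords (F i)) ->
  g_sigma_preimage coords (\bigcup_i (F i)).
Proof. exact: sigma_algebra_bigcup. Qed.

(* The sigma-algebra generated by the coordinates, i.e. the Borel sets.       *)
HB.instance Definition _ := @isMeasurable.Build default_measure_display
  'rV[R]_n (g_sigma_preimage coords) rV_set0 rV_setC rV_bigcup.

Lemma measurable_coord (i : 'I_n) :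
  measurable_fun [set: 'rV[R]_n] (fun x : 'rV[R]_n => x 0 i).
Proof.
move=> _ Y mY; rewrite setTI; apply: sub_sigma_algebra => /=.
rewrite -bigcup_seq/=; exists i => /=; first by rewrite mem_index_enum.
by exists Y => //; rewrite setTI.
Qed.

Lemma measurable_fun_rVP d (T : measurableType d) (f : T -> 'rV[R]_n) :
  (forall i, measurable_fun [set: T] (fun t => f t 0 i)) ->
  measurable_fun [set: T] f.
Proof.
move=> mf _ A mA; rewrite setTI.
suff: g_sigma_preimage (fun i t => f t 0 i) `<=` measurable.
  apply; rewrite (g_sigma_preimage_comp coords f).
  by exists A => //; rewrite setTI.
apply: smallest_sub; first exact: sigma_algebra_measurable.
rewrite -bigcup_seq; apply: bigcup_sub => i _ _ [B mB <-].
exact: mf.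
Qed.

End measurable_rV.

Section lebesgue_measure_rV.
Context {R : realType}.

Definition rV_cons n (z : R * 'rV[R]_n) : 'rV[R]_n.+1 :=
  \row_i (if unlift ord0 i is Some j then z.2 0 j else z.1).

Definition rV_uncons n (x : 'rV[R]_n.+1) : R * 'rV[R]_n :=
  (x 0 ord0, \row_j x 0 (lift ord0 j)).

Lemma rV_consK n : cancel (@rV_cons n) (@rV_uncons n).
Proof.
move=> [t x]; congr pair; first by rewrite mxE unlift_none.
by apply/rowP => j; rewrite !mxE liftK.
Qed.

Lemma rV_unconsK n : cancel (@rV_uncons n) (@rV_cons n).
Proof.
move=> x; apply/rowP => i; rewrite mxE.
by case: unliftP => [j|] -> //=; rewrite mxE.
Qed.

Lemma measurable_rV_cons n : measurable_fun [set: R * 'rV[R]_n] (@rV_cons n).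
Proof.
apply: measurable_fun_rVP => i.
rewrite (_ : (fun z : R * 'rV[R]_n => rV_cons z 0 i) =
  fun z => if unlift ord0 i is Some j then z.2 0 j else z.1); last first.
  by apply/funext => z; rewrite mxE.
case: unlift => [j|]; last exact: measurable_fst.
exact: (measurableT_comp (measurable_coord j) measurable_snd).
Qed.

Lemma measurable_rV_uncons n : measurable_fun [set: 'rV[R]_n.+1] (@rV_uncons n).
Proof.
apply: measurable_fun_pair; first exact: measurable_coord.
apply: measurable_fun_rVP => i.
rewrite (_ : (fun x : 'rV[R]_n.+1 => (rV_uncons x).2 0 i) =
  fun x => x 0 (lift ord0 i)); first exact: measurable_coord.
by apply/funext => x; rewrite mxE.
Qed.

Section step.
Context (n : nat) (mu : {sigma_finite_measure set 'rV[R]_n -> \bar R}).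

Definition lebesgue_rV_step : set 'rV[R]_n.+1 -> \bar R :=
  pushforward ((@lebesgue_measure R) \x mu)%E (@rV_cons n).

Let mpre A : measurable A -> measurable (@rV_cons n @^-1` A).
Proof. by move=> mA; rewrite -[X in measurable X]setTI; exact: measurable_rV_cons. Qed.

Let lebesgue_rV_step0 : lebesgue_rV_step set0 = 0%E.
Proof. by rewrite /lebesgue_rV_step /pushforward preimage_set0 measure0. Qed.

Let lebesgue_rV_step_ge0 A : (0 <= lebesgue_rV_step A)%E.
Proof. by rewrite /lebesgue_rV_step /pushforward measure_ge0. Qed.

Let lebesgue_rV_step_sigma_additive : semi_sigma_additive lebesgue_rV_step.
Proof.
move=> F mF tF mUF; rewrite /lebesgue_rV_step /pushforward preimage_bigcup.
apply: measure_semi_sigma_additive.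
- by move=> i; exact: mpre.
- apply/trivIsetP => /= i j _ _ ij; rewrite -preimage_setI.
  by move/trivIsetP : tF => /(_ _ _ _ _ ij) ->//; rewrite preimage_set0.
- by rewrite -preimage_bigcup; exact: mpre.
Qed.

HB.instance Definition _ := isMeasure.Build _ _ _ lebesgue_rV_step
  lebesgue_rV_step0 lebesgue_rV_step_ge0 lebesgue_rV_step_sigma_additive.

Let lebesgue_rV_step_sigma_finite : sigma_finite [set: _] lebesgue_rV_step.
Proof.
have /sigma_finiteP[F [TF ndF Foo]] := sigma_finiteT (@lebesgue_measure R).
have /sigma_finiteP[G [TG ndG Goo]] := sigma_finiteT mu.
exists (fun k => @rV_uncons n @^-1` (F k `*` G k)).
  rewrite -preimage_bigcup (_ : \bigcup_k _ = setT) ?preimage_setT//.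
  apply/seteqP; split => // -[t x] _.
  have [i _ Fit] : (\bigcup_i F i) t by rewrite -TF.
  have [j _ Gjx] : (\bigcup_j G j) x by rewrite -TG.
  exists (maxn i j) => //; split => /=.
    by move: Fit; exact/subsetPset/ndF/leq_maxl.
  by move: Gjx; exact/subsetPset/ndG/leq_maxr.
move=> k; have [mF Fk] := Foo k; have [mG Gk] := Goo k; split.
  by rewrite -[X in measurable X]setTI; apply: measurable_rV_uncons => //;
    exact: measurableX.
rewrite /lebesgue_rV_step /pushforward (_ : _ @^-1` _ = F k `*` G k).
  by rewrite product_measure1E// lte_mul_pinfty// ge0_fin_numE.
rewrite -comp_preimage (_ : _ \o _ = id) ?preimage_id//.
by apply/funext => z /=; exact: rV_consK.
Qed.

HB.instance Definition _ := @Measure_isSigmaFinite.Build _ _ _ lebesgue_rV_step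
  lebesgue_rV_step_sigma_finite.

End step.

Fixpoint lebesgue_rV n : {sigma_finite_measure set 'rV[R]_n -> \bar R} :=
  if n is n'.+1 then lebesgue_rV_step (lebesgue_rV n') else \d_(0 : 'rV[R]_0).

Lemma lebesgue_rV_box n (A : 'I_n -> set R) :
  (forall i, measurable (A i)) ->
  lebesgue_rV n [set x | forall i, A i (x 0 i)] =
  (\prod_(i < n) lebesgue_measure (A i))%E.
Proof.
elim: n A => [|n ih] A mA.
  by rewrite big_ord0 /= diracE mem_set// => -[].
rewrite big_ord_recl /= /lebesgue_rV_step /pushforward.
rewrite (_ : _ @^-1` _ = A ord0 `*`
    [set x : 'rV[R]_n | forall i, A (lift ord0 i) (x 0 i)]); last first.
  apply/seteqP; split => [[t x] /= h|[t x] /= [h0 h1] i].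
    split; first by have := h ord0; rewrite mxE unlift_none.
    by move=> i; have := h (lift ord0 i); rewrite mxE liftK.
  by rewrite mxE; case: unliftP => [j|] -> /=.
have mB : measurable [set x : 'rV[R]_n | forall i, A (lift ord0 i) (x 0 i)].
  rewrite (_ : mkset _ = \big[setI/setT]_(i < n)
      ((fun x : 'rV[R]_n => x 0 i) @^-1` A (lift ord0 i))).
    apply: bigsetI_measurable => i _.
    by rewrite -[X in measurable X]setTI; exact: measurable_coord.
  apply/seteqP; split => x /=.
    by move=> h; rewrite -bigcap_seq => i _; exact: h.
  by rewrite -bigcap_seq => h i; apply: (h i); rewrite /= mem_index_enum.
rewrite -ih; last by move=> i; exact: mA.
exact: (product_measure1E (@lebesgue_measure R) (lebesgue_rV n) (mA ord0) mB).
Qed.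

End lebesgue_measure_rV.

Section fractional_heat.
Context {R : realType} {N : nat}.
Implicit Types (alpha beta p k T t eps : R) (x : 'rV[R]_N).

Definition enorm x : R := Num.sqrt (\sum_(i < N) x 0 i ^+ 2).

Definition lebesgue_tx : {measure set (measurableTypeR R * 'rV[R]_N) -> \bar R} :=
  ((@lebesgue_measure R) \x (lebesgue_rV N))%E.

Definition Qinfty : set (R * 'rV[R]_N) := [set z | 0 < z.1].
Definition Qset T : set (R * 'rV[R]_N) := [set z | 0 < z.1 < T].

(* Extended-real valued: a divergent or undefined integral takes an infinite  *)
(* value (library convention: +oo - +oo = -oo), never a junk finite one.      *)
Definition frac_lap_eps alpha eps (v : 'rV[R]_N -> R) x : \bar R :=
  (\int[lebesgue_rV N]_(z in [set z | (eps < enorm (x - z))%R])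
     ((v x - v z) / enorm (z - x) `^ (N%:R + 2 * alpha))%R%:E)%E.

Definition has_frac_lap alpha (v : 'rV[R]_N -> R) x : Prop :=
  exists l : R, frac_lap_eps alpha eps v x @[eps --> 0^'+] --> l%:E.

Definition frac_lap alpha (v : 'rV[R]_N -> R) x : R :=
  fine (lim (frac_lap_eps alpha eps v x @[eps --> 0^'+])).

Definition frac_lap_tx alpha (xi : R * 'rV[R]_N -> R) (z : R * 'rV[R]_N) : R :=
  frac_lap alpha (fun y => xi (z.1, y)) z.2.

Definition dt (xi : R * 'rV[R]_N -> R) (z : R * 'rV[R]_N) : R :=
  derive1 (fun s => xi (s, z.2)) z.1.

Definition LnormQ T (q : \bar R) (f : R * 'rV[R]_N -> R) : \bar R :=
  ('N[lebesgue_tx]_q [(EFin \o f) \_ (Qset T)])%E.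

(* The space Y_{alpha,T}.  Norms are essential norms, but the time derivative *)
(* and the fractional Laplacian exist at every point of Q_T, and the functions *)
(* are continuous in time up to t = 0 and t = T: pointwise values xi(0,0) and  *)
(* xi(T,x) enter the weak formulation, so they must not be alterable on a null *)
(* set.                                                                       *)
Record test_space alpha T (xi : R * 'rV[R]_N -> R) : Prop := {
  test_measurable : measurable_fun (Qset T) xi ;
  test_continuous_time : forall x, {within `[0, T], continuous (fun t => xi (t, x))} ;
  test_derivable : forall t x, 0 < t < T -> derivable (fun s => xi (s, x)) t 1 ;
  test_frac_lap : forall t x, 0 < t < T ->
    has_frac_lap alpha (fun y => xi (t, y)) x ;
  test_norms : (LnormQ T 1 xi + LnormQ T +oo xi + LnormQ T +oo (dt xi)
    + LnormQ T +oo (frac_lap_tx alpha xi) < +oo)%E ;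
  test_frac_lap_eps : forall t, 0 < t < T -> exists M eps0 : R,
    [/\ 0 < M, 0 < eps0 & forall eps, 0 < eps <= eps0 ->
      ('N[lebesgue_rV N]_+oo [frac_lap_eps alpha eps (fun y => xi (t, y))]
        <= M%:E)%E]
}.

(* Weak solution of  d_t u + (-Delta)^alpha u + t^beta u^p = 0  in Q_infty,    *)
(* u(0,.) = k delta_0.  The identity is stated in \bar R, so that it forces    *)
(* xi(T,.) u(T,.) to be integrable.                                           *)
Record weak_solution alpha beta p k (u : R * 'rV[R]_N -> R) : Prop := {
  weak_ge0 : forall z, Qinfty z -> 0 <= u z ;
  weak_L1 : forall T, 0 < T -> lebesgue_tx.-integrable (Qset T) (EFin \o u) ;
  weak_absorption_L1 : forall T, 0 < T -> lebesgue_tx.-integrable (Qset T)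
    (fun z => (z.1 `^ beta * u z `^ p)%R%:E) ;
  weak_identity : forall T xi, 0 < T -> test_space alpha T xi ->
    (\int[lebesgue_tx]_(z in Qset T)
       (u z * (- dt xi z + frac_lap_tx alpha xi z)
        + z.1 `^ beta * u z `^ p * xi z)%R%:E =
     (k * xi (0, 0))%R%:E
       - \int[lebesgue_rV N]_x (xi (T, x) * u (T, x))%R%:E)%E
}.

(* lim_{k -> oo} u_k = oo locally uniformly in D.  Since weak solutions are    *)
(* determined up to null sets, uniformity on compact sets is understood almost *)
(* everywhere, as for convergence in L^oo_loc.                                *)
Definition cvg_pinfty_locally_uniformly (D : set (R * 'rV[R]_N))
    (u : R -> R * 'rV[R]_N -> R) : Prop :=
  forall K : set (R * 'rV[R]_N), compact K -> K `<=` D ->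
  forall A : R, \forall k \near +oo,
    {ae lebesgue_tx, forall z, K z -> A <= u k z}.

End fractional_heat.

(* Main.v *)
(* For fixed T we bound u_k from below on Q_T by a function w_k that grows
   linearly in k, by duality.  Cut off the kernel |y|^(-N-2alpha) at |y| = e: the
   resulting operator is nu - J with J positivity preserving, so the backward
   equation -dt zeta + (nu - J) zeta = f(t) g(x), zeta(T) = 0, has the explicit
   subsolutions sum_(i < m) a_(i+1)(t) (J^i g)(x), where a_0 = f and
   a_(i+1)' = nu a_(i+1) - a_i, a_(i+1)(T) = 0.  Multiplied by a weight H(t) that
   pays for the absorption (u^p <= u + 1 as p <= 1) they are test functions for
   u_k.  A Gaussian b satisfies J b >= mu b and bounds the kernel from below, so
   (J^i g)(0) >= c i mu^(i-1) int g b, which bounds zeta(0,0) from below.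
   Letting m -> oo, then removing the two cut-offs, yields
   int_(Q_T) (u_k - w_k) f g >= 0 for all f, g >= 0, with
   w_k(t,x) = k C t exp(-C' t) b(x) - C'' and C > 0, C', C'' independent of k.
   Indicators of Borel sets are limits of smooth cutoffs in the cone of such
   products, whence u_k >= w_k almost everywhere in Q_T. *)
Require Import Defs.
From mathcomp Require Import all_boot all_order all_algebra.
From mathcomp Require Import all_classical all_reals all_analysis.
From mathcomp Require Import measurable_realfun ess_sup_inf ring lra.
Import Order.TTheory GRing.Theory Num.Theory.
Import numFieldNormedType.Exports.

Set Implicit Arguments.
Unset Strict Implicit.
Unset Printing Implicit Defensive.

Local Open Scope classical_set_scope.
Local Open Scope ring_scope.

(** * Invariance of Lebesgue measure under translation and reflection *)

Section lebesgue_invariance.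
Context {R : realType}.
Notation leb := (@lebesgue_measure R).

(** No comparison principle for weak solutions is used: the only tool is the defining identity, so
    everything rests on explicit members of the test space. The exact backward solution is not
    explicit, but with an integrable kernel the generator is bounded, and truncating its exponential
    series leaves finite sums of products c(t) G(x), on which the time derivative and the fractional
    Laplacian act factor by factor. The price is the error of the kernel change, controlled by
    second differences of the iterates. These grow like nu^i, where nu may blow up as e -> 0; yet
    the time profiles satisfy sum nu^i a_(i+1) <= int f, so the error is at most int f times
    [near_mass e] times a constant of g. The rate of the lower bound is free of e too: nu - mu
    equals [decay_rate], built from the Levy integral of min(1, |y|^2) and the kernel capped at
    radius 1. Hence e, m and the time shift del may depend on u_k, while the constants of w_k do not
    see them. The constant C'' is the cost of the additive 1 in the bound of u^p, which does not
    grow with k. *)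

(** The pushforward of Lebesgue measure agrees with it on half-open intervals, and these determine
    the measure. *)
Lemma lebesgue_measure_preserved (T : R -> R) :
  measurable_fun [set: R] T ->
  (forall a b : R, leb (T @^-1` `]a, b]) = leb `]a, b]) ->
  forall F : R -> \bar R, measurable_fun [set: R] F -> (forall x, 0 <= F x)%E ->
  (\int[leb]_x F (T x) = \int[leb]_x F x)%E.
Proof.
move=> mT TE F mF F0.
have mT' : measurable_fun [set: measurableTypeR R]
  (T : measurableTypeR R -> measurableTypeR R) by [].
rewrite -[LHS]/(\int[leb]_(x in T @^-1` setT) (F \o T) x)%E.
rewrite -(ge0_integral_pushforward mT' leb)//.
apply: eq_measure_integral => A mA _.
suff E : leb A = pushforward leb (T : measurableTypeR R -> measurableTypeR R) A by exact: (esym E).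
unshelve eapply (lebesgue_measure_unique (R := R) _ mA).
  2: exact: mT'.
move=> X [-[a b] _ <-].
by rewrite /= /pushforward TE.
Qed.

Lemma integral_lebesgue_shift (a : R) (F : R -> \bar R) :
  measurable_fun [set: R] F -> (forall x, 0 <= F x)%E ->
  (\int[leb]_x F (a + x)%R = \int[leb]_x F x)%E.
Proof.
apply: lebesgue_measure_preserved; first exact: measurable_funD.
move=> u v; rewrite (_ : _ @^-1` _ = `]u - a, v - a]%classic); last first.
  by apply/seteqP; split=> x /=; rewrite !in_itv/= => /andP[? ?]; apply/andP; split; lra.
rewrite !lebesgue_measure_itv/= !lte_fin ltrD2r; case: ifP => // _.
by rewrite -!EFinB; congr EFin; ring.
Qed.

Lemma integral_lebesgue_opp (F : R -> \bar R) :
  measurable_fun [set: R] F -> (forall x, 0 <= F x)%E ->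
  (\int[leb]_x F (- x)%R = \int[leb]_x F x)%E.
Proof.
apply: lebesgue_measure_preserved; first exact: measurable_funN.
move=> u v; rewrite (_ : _ @^-1` _ = `[- v, - u[%classic); last first.
  by apply/seteqP; split=> x /=; rewrite !in_itv/= => /andP[? ?]; apply/andP; split; lra.
rewrite !lebesgue_measure_itv/= !lte_fin ltrN2; case: ifP => // _.
by rewrite -!EFinB; congr EFin; ring.
Qed.

Lemma measurable_rVD n : measurable_fun [set: 'rV[R]_n * 'rV[R]_n]
  (fun z => z.1 + z.2).
Proof.
apply: measurable_fun_rVP => i.
rewrite (_ : (fun z : 'rV[R]_n * 'rV[R]_n => (z.1 + z.2) 0 i) =
  (fun z => z.1 0 i + z.2 0 i)); last by apply/funext => z; rewrite mxE.
apply: measurable_funD.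
  exact: (measurableT_comp (measurable_coord i) measurable_fst).
exact: (measurableT_comp (measurable_coord i) measurable_snd).
Qed.

Lemma measurable_rVN n : measurable_fun [set: 'rV[R]_n] -%R.
Proof.
apply: measurable_fun_rVP => i.
rewrite (_ : (fun z : 'rV[R]_n => (- z) 0 i) = (fun z => - z 0 i));
  last by apply/funext => z; rewrite mxE.
by apply: measurable_funN; exact: measurable_coord.
Qed.

Lemma measurable_rVaddl n (a : 'rV[R]_n) : measurable_fun [set: 'rV[R]_n] (+%R a).
Proof.
rewrite (_ : +%R a = (fun z : 'rV[R]_n * 'rV[R]_n => z.1 + z.2) \o pair a)//.
apply: measurableT_comp; first exact: measurable_rVD.
exact: measurable_pair1.
Qed.

Let measurable_rV_consT n :
  measurable_fun [set: measurableTypeR R * 'rV[R]_n] (@rV_cons R n) :=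
  @measurable_rV_cons R n.

Lemma integral_rV_cons n (F : 'rV[R]_n.+1 -> \bar R) :
  measurable_fun [set: 'rV[R]_n.+1] F -> (forall x, 0 <= F x)%E ->
  (\int[lebesgue_rV n.+1]_x F x =
   \int[leb]_t \int[lebesgue_rV n]_x F (rV_cons (t, x)))%E.
Proof.
move=> mF F0.
have F0' : {in [set: 'rV[R]_n.+1], forall y, (0 <= F y)%E} by move=> y _; exact: F0.
have E := ge0_integral_pushforward (@measurable_rV_consT n)
  (leb \x lebesgue_rV n)%E measurableT mF F0'.
transitivity (\int[leb \x lebesgue_rV n]_z (F \o @rV_cons R n) z)%E; first exact: E.
apply: (fubini_tonelli1 (m1 := leb) (m2 := lebesgue_rV n) (F \o @rV_cons R n)).
  exact: measurableT_comp mF (@measurable_rV_consT n).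
by move=> z; exact: F0.
Qed.


(** [lebesgue_rV] is built one coordinate at a time, so Tonelli splits off the first coordinate and
    induction on the dimension handles the rest. *)
Lemma integral_rV_shift n (a : 'rV[R]_n) (F : 'rV[R]_n -> \bar R) :
  measurable_fun [set: 'rV[R]_n] F -> (forall x, 0 <= F x)%E ->
  (\int[lebesgue_rV n]_x F (a + x)%R = \int[lebesgue_rV n]_x F x)%E.
Proof.
elim: n a F => [|n ih] a F mF F0.
  by apply: eq_integral => x _; congr F; apply/rowP => -[].
have mFa : measurable_fun setT (fun x : 'rV[R]_n.+1 => F (a + x)).
  exact: measurableT_comp mF (measurable_rVaddl a).
have mFc : measurable_fun [set: measurableTypeR R * 'rV[R]_n] (F \o @rV_cons R n).
  exact: measurableT_comp mF (@measurable_rV_consT n).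
have mG : measurable_fun [set: measurableTypeR R]
    (fun t => \int[lebesgue_rV n]_x F (rV_cons (t, x)))%E.
  apply: (measurable_fun_fubini_tonelli_F (m2 := lebesgue_rV n) _ mFc).
  by move=> z; exact: F0.
apply: (etrans (integral_rV_cons mFa (fun x => F0 _))).
apply: (etrans _ (esym (integral_rV_cons mF F0))).
rewrite -(integral_lebesgue_shift (a 0%R ord0)
  (F := fun t => \int[lebesgue_rV n]_x F (rV_cons (t, x)))%E); last 2 first.
- exact: mG.
- by move=> t; apply: integral_ge0 => x _; exact: F0.
apply: eq_integral => t _.
rewrite -(ih (\row_j a 0 (lift ord0 j)) (fun x => F (rV_cons ((a 0 ord0 + t)%R, x))))//.
  apply: eq_integral => x _; congr F; apply/rowP => i.
  by rewrite !mxE; case: unliftP => [j|] -> /=; rewrite ?mxE.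
exact: (measurableT_comp mFc (measurable_pair1 _)).
Qed.

Lemma integral_rV_opp n (F : 'rV[R]_n -> \bar R) :
  measurable_fun [set: 'rV[R]_n] F -> (forall x, 0 <= F x)%E ->
  (\int[lebesgue_rV n]_x F (- x)%R = \int[lebesgue_rV n]_x F x)%E.
Proof.
elim: n F => [|n ih] F mF F0.
  by apply: eq_integral => x _; congr F; apply/rowP => -[].
have mFa : measurable_fun setT (fun x : 'rV[R]_n.+1 => F (- x)).
  exact: measurableT_comp mF (@measurable_rVN n.+1).
have mFc : measurable_fun [set: measurableTypeR R * 'rV[R]_n] (F \o @rV_cons R n).
  exact: measurableT_comp mF (@measurable_rV_consT n).
have mG : measurable_fun [set: measurableTypeR R]
    (fun t => \int[lebesgue_rV n]_x F (rV_cons (t, x)))%E.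
  apply: (measurable_fun_fubini_tonelli_F (m2 := lebesgue_rV n) _ mFc).
  by move=> z; exact: F0.
apply: (etrans (integral_rV_cons mFa (fun x => F0 _))).
apply: (etrans _ (esym (integral_rV_cons mF F0))).
rewrite -(integral_lebesgue_opp
  (F := fun t => \int[lebesgue_rV n]_x F (rV_cons (t, x)))%E); last 2 first.
- exact: mG.
- by move=> t; apply: integral_ge0 => x _; exact: F0.
apply: eq_integral => t _.
rewrite -(ih (fun x => F (rV_cons ((- t)%R, x))))//.
  apply: eq_integral => x _; congr F; apply/rowP => i.
  by rewrite !mxE; case: unliftP => [j _|_] /=; rewrite ?mxE.
exact: (measurableT_comp mFc (measurable_pair1 _)).
Qed.

End lebesgue_invariance.

(** * Signed integrals, the Euclidean norm and cubes *)

Section real_integrals.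
Context {R : realType} (n : nat).
Notation mu := (@lebesgue_rV R n).
Implicit Types f : 'rV[R]_n -> R.

Lemma lebesgue_rV_shift_integral (a : 'rV[R]_n) (F : 'rV[R]_n -> \bar R) :
  measurable_fun [set: 'rV[R]_n] F ->
  (\int[mu]_x F (a + x)%R = \int[mu]_x F x)%E.
Proof.
move=> mF; rewrite integralE [RHS]integralE.
have -> : (fun x => F (a + x)) = F \o (+%R a) by [].
rewrite funepos_comp funeneg_comp.
by congr (adde _ (oppe _)); apply: integral_rV_shift;
  rewrite //; [exact: measurable_funepos|exact: measurable_funeneg].
Qed.

Lemma lebesgue_rV_opp_integral (F : 'rV[R]_n -> \bar R) :
  measurable_fun [set: 'rV[R]_n] F ->
  (\int[mu]_x F (- x)%R = \int[mu]_x F x)%E.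
Proof.
move=> mF; rewrite integralE [RHS]integralE.
have -> : (fun x => F (- x)) = F \o -%R by [].
rewrite funepos_comp funeneg_comp.
by congr (adde _ (oppe _)); apply: integral_rV_opp;
  rewrite //; [exact: measurable_funepos|exact: measurable_funeneg].
Qed.

Lemma measurable_comp_shift d (T : measurableType d) (a : 'rV[R]_n) (F : 'rV[R]_n -> T) :
  measurable_fun [set: 'rV[R]_n] F -> measurable_fun setT (fun x : 'rV[R]_n => F (a + x)).
Proof. by move=> mF; exact: measurableT_comp mF (measurable_rVaddl a). Qed.

Lemma measurable_comp_opp d (T : measurableType d) (F : 'rV[R]_n -> T) :
  measurable_fun [set: 'rV[R]_n] F -> measurable_fun setT (fun x : 'rV[R]_n => F (- x)).
Proof. by move=> mF; exact: measurableT_comp mF (@measurable_rVN R n). Qed.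

Lemma measurable_enorm : measurable_fun [set: 'rV[R]_n] (@enorm R n).
Proof.
apply: (measurableT_comp (f := @Num.sqrt R)).
  by apply: continuous_measurable_fun; exact: sqrt_continuous.
apply: measurable_sum => i; apply: measurable_funX; exact: measurable_coord.
Qed.

Lemma enorm_ge0 (x : 'rV[R]_n) : 0 <= enorm x.
Proof. exact: sqrtr_ge0. Qed.

Lemma sqr_enorm (x : 'rV[R]_n) : enorm x ^+ 2 = \sum_(i < n) x 0 i ^+ 2.
Proof. by rewrite sqr_sqrtr// sumr_ge0// => i _; exact: sqr_ge0. Qed.

Lemma enormN (x : 'rV[R]_n) : enorm (- x) = enorm x.
Proof. by congr Num.sqrt; apply: eq_bigr => i _; rewrite mxE sqrrN. Qed.

Lemma coord_le_enorm (x : 'rV[R]_n) i : `|x 0 i| <= enorm x.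
Proof.
rewrite -ler_sqr ?nnegrE ?enorm_ge0// sqr_enorm real_normK ?num_real//.
by rewrite (bigD1 i)//= lerDl sumr_ge0// => j _; exact: sqr_ge0.
Qed.

Definition box (r : R) : set 'rV[R]_n := [set x | forall i, `]- r, r[%classic (x 0 i)].

Lemma measurable_box (r : R) : measurable (box r).
Proof.
rewrite (_ : box r = \big[setI/setT]_(i < n)
      ((fun x : 'rV[R]_n => x 0 i) @^-1` `]- r, r[)).
  apply: bigsetI_measurable => i _.
  by rewrite -[X in measurable X]setTI; exact: measurable_coord.
apply/seteqP; split => x /=.
  by move=> h; rewrite -bigcap_seq => i _; exact: h.
by rewrite -bigcap_seq => h i; apply: (h i); rewrite /= mem_index_enum.
Qed.

Lemma lebesgue_rV_box_cube (r : R) : 0 <= r -> mu (box r) = ((2 * r) ^+ n)%:E.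
Proof.
move=> r0; rewrite /box (lebesgue_rV_box (A := fun=> `]- r, r[%classic))//.
rewrite (eq_bigr (fun=> (2 * r)%:E)).
  by rewrite prodEFin prodr_const card_ord.
move=> i _; rewrite lebesgue_measure_itv/= lte_fin; case: ltP => rr.
  by rewrite -EFinB; congr EFin; ring.
by congr EFin; lra.
Qed.

Lemma enorm_lt_box (x : 'rV[R]_n) r : enorm x < r -> box r x.
Proof.
move=> xr i /=; rewrite in_itv/= -ltr_norml.
exact: le_lt_trans (coord_le_enorm x i) xr.
Qed.

End real_integrals.

(** * Integrability of min(1, |y|^2) |y|^(-N-2alpha) by dyadic shells *)

Section kernel_integrability.
Context {R : realType} (N : nat) (alpha : R).
Hypothesis halpha : 0 < alpha < 1.
Notation mu := (@lebesgue_rV R N).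
Notation s := (N%:R + 2 * alpha).

Lemma dyadic_ge1 (r : R) : 1 <= r -> exists j, 2 ^+ j <= r < 2 ^+ j.+1.
Proof.
move=> r1.
have Pex : exists j, r < 2 ^+ j.+1.
  exists (Num.bound r); apply: (@upper_nthrootP R r); exact: leqnSn.
case: (ex_minnP Pex) => j jP jmin; exists j; rewrite jP andbT.
case: j jP jmin => [|j] jP jmin; first by rewrite expr0.
by rewrite leNgt; apply/negP => /jmin; rewrite ltnn.
Qed.

Lemma dyadic_lt1 (r : R) : 0 < r < 1 -> exists j, 2^-1 ^+ j.+1 <= r < 2^-1 ^+ j.
Proof.
case/andP => r0 r1.
have ri1 : 1 <= r^-1 by rewrite ltW// invf_gt1.
have [j /andP[h1 h2]] := dyadic_ge1 ri1.
(* Inversion moves the closed end of the shell to the other side, so a power of two belongs to the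
   neighbouring index. *)
have [e|ne] := eqVneq (2 ^+ j) r^-1.
  case: j e h1 h2 => [|j] e h1 h2; first by move: r1; rewrite -[r]invrK -e expr0 invr1 ltxx.
  exists j; rewrite -[r]invrK -e exprVn lexx /= exprVn ltf_pV2 ?posrE ?exprn_gt0//.
  by rewrite exprS ltr_pMl ?exprn_gt0// ltr1n.
exists j; rewrite !exprVn; apply/andP; split.
  by rewrite -[r]invrK lef_pV2 ?posrE ?exprn_gt0 ?invr_gt0// ltW.
by rewrite -[r in r < _]invrK ltf_pV2 ?posrE ?exprn_gt0 ?invr_gt0// lt_neqAle ne.
Qed.

Let s0 : 0 < s.
Proof. by case/andP: halpha => a0 _; rewrite ltr_wpDl ?mulr_gt0. Qed.

Let B : R := 2 `^ s.
Let B0 : 0 < B. Proof. exact: powR_gt0. Qed.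

Let powR2_lt (x y : R) : x < y -> 2 `^ x < 2 `^ y.
Proof. by move=> xy; rewrite /powR pnatr_eq0/= ltr_expR ltr_pM2r// ln_gt0// ltr1n. Qed.

Let powR2X j : (2 ^+ j) `^ s = B ^+ j.
Proof. by rewrite -(powR_mulrn _ (ler0n _ 2)) -powRrM mulrC powRrM powR_mulrn ?powR_ge0. Qed.

Let powRV x : 0 <= x -> x^-1 `^ s = (x `^ s)^-1.
Proof. by move=> x0; rewrite -(@powR_inv1 _ x)// powRAC powR_inv1 ?powR_ge0. Qed.

(** [c j] bounds the weight on 2^j <= |y| < 2^(j+1), where the minimum is 1; [d j] bounds it on
    2^-(j+1) <= |y| < 2^-j, where |y|^2 <= 4^-j and |y|^-s <= B^(j+1). *)
Let c j : R := B^-1 ^+ j.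
Let d j : R := 4^-1 ^+ j * B ^+ j.+1.

(** Its integrability is the Levy condition on the fractional kernel: second differences of a
    bounded function with bounded second derivatives are of order min(1, |y|^2). *)
Definition levy_weight (y : 'rV[R]_N) : R := Num.min 1 (enorm y ^+ 2) * enorm y `^ (- s).

Lemma levy_weight_ge0 y : 0 <= levy_weight y.
Proof. by rewrite mulr_ge0 ?powR_ge0// le_min ler01 sqr_ge0. Qed.

Lemma measurable_levy_weight : measurable_fun [set: 'rV[R]_N] levy_weight.
Proof.
apply: measurable_funM.
  apply: measurable_minr => //; apply: measurable_funX; exact: measurable_enorm.
exact: measurableT_comp (measurable_powR _) (@measurable_enorm R N).
Qed.

Let F j (y : 'rV[R]_N) : R :=
  c j * \1_(box (2 ^+ j.+1)) y + d j * \1_(box (2^-1 ^+ j)) y.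

Let F_ge0 j y : 0 <= F j y.
Proof.
rewrite addr_ge0// mulr_ge0//; first by rewrite exprn_ge0// invr_ge0 ltW.
by rewrite mulr_ge0// exprn_ge0// ltW.
Qed.

Let weight_le_F y : exists j, levy_weight y <= F j y.
Proof.
have := enorm_ge0 y; rewrite le_eqVlt => /predU1P[y0|y0].
  (* A nonzero power of 0 is 0 by convention, so the weight vanishes at the origin. *)
  exists 0; rewrite /levy_weight -y0 powR0 ?mulr0 ?F_ge0//.
  by rewrite oppr_eq0 gt_eqF.
have [y1|y1] := leP 1 (enorm y).
  have [j /andP[h1 h2]] := dyadic_ge1 y1; exists j.
  rewrite /F /levy_weight indicE mem_set ?mulr1; last exact: enorm_lt_box.
  apply: (@le_trans _ _ (c j)); last first.
    by rewrite lerDl mulr_ge0// mulr_ge0// exprn_ge0// ltW.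
  rewrite -[leRHS]mul1r ler_pM ?powR_ge0//.
  - by rewrite le_min ler01 sqr_ge0.
  - by rewrite ge_min lexx.
  - rewrite powRN /c exprVn lef_pV2 ?posrE ?exprn_gt0 ?powR_gt0//.
    by rewrite -powR2X ge0_ler_powR ?nnegrE ?exprn_ge0// ltW.
have [j /andP[h1 h2]] := @dyadic_lt1 (enorm y) (introT andP (conj y0 y1)); exists j.
rewrite /F /levy_weight [X in _ + _ * X]indicE mem_set ?mulr1; last exact: enorm_lt_box.
apply: (@le_trans _ _ (d j)); last first.
  by rewrite lerDr mulr_ge0// exprn_ge0// invr_ge0 ltW.
rewrite /d ler_pM ?powR_ge0//.
- by rewrite le_min ler01 sqr_ge0.
- rewrite ge_min; apply/orP; right.
  rewrite (_ : 4^-1 = 2^-1 ^+ 2 :> R); last by rewrite exprVn -natrX.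
  by rewrite exprAC lerXn2r ?nnegrE ?exprn_ge0 ?enorm_ge0// ltW.
- rewrite powRN -[leRHS]invrK lef_pV2 ?posrE ?invr_gt0 ?exprn_gt0 ?powR_gt0//.
  rewrite -powR2X -powRV ?exprn_ge0// -exprVn.
  by rewrite ge0_ler_powR ?nnegrE ?exprn_ge0 ?enorm_ge0// ltW.
Qed.

Let mF j : measurable_fun [set: 'rV[R]_N] (F j).
Proof.
by apply: measurable_funD; apply: measurable_funM => //;
  apply: measurable_indic; exact: measurable_box.
Qed.

Let intF j : (\int[mu]_y (F j y)%:E =
  (4 ^+ N * (2 ^+ N / B) ^+ j + B * 2 ^+ N * (B / (4 * 2 ^+ N)) ^+ j)%:E)%E.
Proof.
have c0 : 0 <= c j by rewrite exprn_ge0// invr_ge0 ltW.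
have d0 : 0 <= d j by rewrite mulr_ge0// exprn_ge0// ltW.
have iB r : 0 <= r -> (\int[mu]_x (\1_(box r) x)%:E = ((2 * r) ^+ N)%:E)%E.
  move=> r0; rewrite integral_indic//; last exact: measurable_box.
  by rewrite -[RHS]lebesgue_rV_box_cube//; congr (mu _); rewrite setIT.
have mb (r : R) : measurable_fun [set: 'rV[R]_N] (EFin \o \1_(box r)).
  by apply/measurable_EFinP/measurable_indic; exact: measurable_box.
under eq_integral do rewrite EFinD !EFinM.
rewrite ge0_integralD//; last 4 first.
- by move=> y _; rewrite -EFinM lee_fin mulr_ge0.
- by apply: emeasurable_funM => //; exact: mb.
- by move=> y _; rewrite -EFinM lee_fin mulr_ge0.
- by apply: emeasurable_funM => //; exact: mb.
rewrite !ge0_integralZl_EFin//; try exact: mb.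
rewrite !iB ?exprn_ge0//.
rewrite -!EFinM -EFinD; congr (_ + _)%:E.
  have -> : (2 * 2 ^+ j.+1) ^+ N = 4 ^+ N * (2 ^+ N) ^+ j :> R.
    by rewrite exprS mulrA exprMn -natrM [(2 ^+ j) ^+ N]exprAC.
  by rewrite /c exprMn; ring.
have -> : (2 * 2^-1 ^+ j) ^+ N = 2 ^+ N * (2 ^+ N)^-1 ^+ j :> R.
  by rewrite exprMn [_ ^+ j ^+ N]exprAC [2^-1 ^+ N]exprVn.
rewrite /d invfM !exprMn exprS.
set a := 4^-1 ^+ j; set b := B ^+ j; set u := 2 ^+ N; set v := u^-1 ^+ j; ring.
Qed.

Lemma levy_weight_integrable : mu.-integrable setT (EFin \o levy_weight).
Proof.
have mw := measurable_levy_weight.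
apply/integrableP; split; first exact/measurable_EFinP.
under eq_integral do rewrite /= ger0_norm ?levy_weight_ge0//.
have B2 : 0 < (2 : R) ^+ N by rewrite exprn_gt0.
(* The ratios of the two geometric series are 2^(-2 alpha) and 2^(2 alpha - 2): the far part needs
   alpha > 0, the near part alpha < 1. *)
have r1 : `|2 ^+ N / B| < 1.
  rewrite ger0_norm ?divr_ge0 ?ltW// ltr_pdivrMr// mul1r /B -powR_mulrn//.
  by case/andP: halpha => a0 _; rewrite powR2_lt// ltrDl mulr_gt0.
have r2 : `|B / (4 * 2 ^+ N)| < 1.
  rewrite ger0_norm ?divr_ge0 ?mulr_ge0 ?ltW// ltr_pdivrMr ?mulr_gt0// mul1r.
  have -> : 4 * 2 ^+ N = 2 `^ (N%:R + 2) :> R.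
    rewrite powRD ?pnatr_eq0 ?implybT// !powR_mulrn//; ring.
  by case/andP: halpha => _ a1; rewrite /B powR2_lt// ltrD2l; lra.
apply: (@le_lt_trans _ _ (\int[mu]_y (\sum_(j <oo) (F j y)%:E))%E).
  apply: ge0_le_integral => //.
  - by move=> y _; rewrite lee_fin levy_weight_ge0.
  - exact/measurable_EFinP.
  - by apply: ge0_emeasurable_sum => [j y _ _|j _]; [rewrite lee_fin|exact/measurable_EFinP].
  - move=> y _; have [j jw] := weight_le_F y.
    apply: (@le_trans _ _ (F j y)%:E); first by rewrite lee_fin.
    apply: (le_trans _ (nneseries_lim_ge j.+1 _)); last by move=> i _; rewrite lee_fin.
    rewrite big_nat_recr//= leeDr// sume_ge0// => i _; by rewrite lee_fin.
rewrite integral_nneseries//; last 2 first.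
- by move=> j; exact/measurable_EFinP.
- by move=> j y _; rewrite lee_fin.
set X := 4 ^+ N * (1 - 2 ^+ N / B)^-1; set Y := B * 2 ^+ N * (1 - B / (4 * 2 ^+ N))^-1.
apply: (@le_lt_trans _ _ (X + Y)%:E); last exact: ltry.
apply: lime_le.
  by apply: is_cvg_nneseries => j _ _; apply: integral_ge0 => y _; rewrite lee_fin.
near=> n; under eq_bigr do rewrite intF.
rewrite sumEFin lee_fin big_split/= lerD//.
  have := geometric_le_lim n (exprn_ge0 N (ler0n R 4)) (divr_gt0 B2 B0) r1.
  by rewrite /series/=.
have := geometric_le_lim n (mulr_ge0 (ltW B0) (ltW B2))
  (divr_gt0 B0 (mulr_gt0 (ltr0n R 4) B2)) r2.
by rewrite /series/=.
Unshelve. all: end_near. Qed.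

End kernel_integrability.

(** * Integrability of real-valued functions *)

Section real_integrable.
Context d (T : measurableType d) (R : realType) (m : {measure set T -> \bar R}).
Variable D : set T.
Hypothesis mD : measurable D.
Implicit Types f g h : T -> R.
Notation intg f := (m.-integrable D (EFin \o f)).

Lemma integrable_measurable f : intg f -> measurable_fun D f.
Proof. by move/integrableP => [/measurable_EFinP]. Qed.

Lemma integral_EFin_Rintegral f : intg f ->
  (\int[m]_(x in D) (f x)%:E = (\int[m]_(x in D) f x)%R%:E)%E.
Proof. by move=> fi; rewrite /Rintegral fineK//; exact: integrable_fin_num. Qed.

Lemma integrable_le f g : measurable_fun D f -> intg g ->
  (forall x, D x -> `|f x| <= g x) -> intg f.
Proof.
move=> mf ig fg; apply: (le_integrable mD _ _ ig).
  exact/measurable_EFinP.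
by move=> x Dx /=; rewrite lee_fin (le_trans (fg x Dx))// ler_norm.
Qed.

Lemma integrable_realD f g : intg f -> intg g -> intg (fun x => f x + g x).
Proof.
move=> fi gi; rewrite (_ : _ \o _ = (EFin \o f) \+ (EFin \o g))%E//.
exact: integrableD.
Qed.

Lemma integrable_realB f g : intg f -> intg g -> intg (fun x => f x - g x).
Proof.
move=> fi gi; rewrite (_ : _ \o _ = (EFin \o f) \- (EFin \o g))%E//.
exact: integrableB.
Qed.

Lemma integrable_realZl (c : R) f : intg f -> intg (fun x => c * f x).
Proof.
move=> fi; rewrite (_ : _ \o _ = (fun x => c%:E * (EFin \o f) x)%E)//.
exact: integrableZl.
Qed.

Lemma integrable_realM_bounded f h (B : R) : intg f -> measurable_fun D h ->
  (forall x, D x -> `|h x| <= B) -> intg (fun x => f x * h x).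
Proof.
move=> fi mh hB; apply: (@integrable_le _ (fun x => B * `|f x|)).
- by apply: measurable_funM => //; exact: integrable_measurable.
- by apply: integrable_realZl; exact: integrable_norm.
- by move=> x Dx; rewrite normrM mulrC ler_wpM2r// hB.
Qed.

Lemma integrable_real_sum (I : Type) (r : seq I) (f : I -> T -> R) :
  (forall i, intg (f i)) -> intg (fun x => \sum_(i <- r) f i x).
Proof.
move=> fi; rewrite (_ : _ \o _ = (fun x => \sum_(i <- r) (EFin \o f i) x)%E).
  exact: integrable_sum.
by apply/funext => x /=; rewrite sumEFin.
Qed.

End real_integrable.

(** * Levy operators in second-difference form and the fractional Laplacian *)

Section fractional_laplacian.
Context {R : realType} {N : nat} (alpha : R).
Hypothesis halpha : 0 < alpha < 1.
Notation mu := (@lebesgue_rV R N).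
Notation s := (N%:R + 2 * alpha).
Implicit Types (g : 'rV[R]_N -> R) (x y : 'rV[R]_N).

(** Symmetrising in y makes the singular integral absolutely convergent, so that operators with
    different kernels can be compared under one integral. *)
Definition sdiff g x y : R := 2 * g x - g (x + y) - g (x - y).

(** A derivative-free substitute for bounded second derivatives: it passes to sums, multiples and
    convolutions with explicit constants. *)
Definition sdiff_bounded (B M : R) g :=
  [/\ measurable_fun setT g, forall x, `|g x| <= B &
      forall x y, `|sdiff g x y| <= M * enorm y ^+ 2].

Lemma measurable_sdiff g x : measurable_fun setT g -> measurable_fun setT (sdiff g x).
Proof.
move=> mg; apply: measurable_funB; first apply: measurable_funB => //.
  exact: measurable_comp_shift.
exact: (measurable_comp_opp (F := fun y => g (x + y)) (measurable_comp_shift x mg)).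
Qed.

Lemma sdiff_le_min B M g x y : 0 <= M -> sdiff_bounded B M g ->
  `|sdiff g x y| <= (4 * B + M) * Num.min 1 (enorm y ^+ 2).
Proof.
move=> M0 [_ gB gM]; have B0 : 0 <= B by rewrite (le_trans _ (gB 0)).
have [y1|y1] := leP 1 (enorm y ^+ 2).
  rewrite mulr1 (@le_trans _ _ (4 * B))//; last by rewrite lerDl.
  rewrite /sdiff.
  have := gB x; have := gB (x + y); have := gB (x - y).
  rewrite !ler_norml => /andP[? ?] /andP[? ?] /andP[? ?]; apply/andP; split; lra.
rewrite (le_trans (gM x y))// ler_wpM2r ?sqr_ge0//; lra.
Qed.

(* A kernel dominated by the fractional one, in a form insensitive to the
   junk value of [enorm y `^ (- s)] at [y = 0]. *)
Record levy_kernel (k : 'rV[R]_N -> R) : Prop := {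
  levy_measurable : measurable_fun setT k ;
  levy_ge0 : forall y, 0 <= k y ;
  levy_even : forall y, k (- y) = k y ;
  levy_le : forall y, k y * Num.min 1 (enorm y ^+ 2) <= levy_weight alpha y }.

Lemma integrable_sdiff k B M g x : levy_kernel k -> 0 <= M -> sdiff_bounded B M g ->
  mu.-integrable setT (EFin \o (fun y => k y * sdiff g x y)).
Proof.
move=> kk M0 gBM; have [mg gB gM] := gBM.
have B0 : 0 <= B by rewrite (le_trans _ (gB 0)).
apply: (@integrable_le _ _ _ _ _ measurableT _
  (fun y => (4 * B + M) * levy_weight alpha y)).
- by apply: measurable_funM; [exact: levy_measurable|exact: measurable_sdiff].
- by apply: integrable_realZl => //; exact: levy_weight_integrable.
- move=> y _; rewrite normrM ger0_norm ?levy_ge0//.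
  rewrite (le_trans (ler_wpM2l (levy_ge0 kk y) (sdiff_le_min x y M0 gBM)))//.
  by rewrite mulrCA ler_wpM2l ?levy_le// addr_ge0 ?mulr_ge0.
Qed.

Definition levy_op (k : 'rV[R]_N -> R) g x : R := 2^-1 * \int[mu]_y (k y * sdiff g x y).

Definition frac_kernel y : R := enorm y `^ (- s).

Lemma frac_kernel_levy : levy_kernel frac_kernel.
Proof.
split=> [|y|y|y]; rewrite /frac_kernel ?enormN ?powR_ge0//.
  exact: measurableT_comp (measurable_powR _) (@measurable_enorm R N).
by rewrite /levy_weight mulrC.
Qed.

Definition trunc_kernel (e : R) (y : 'rV[R]_N) : R := (e < enorm y)%R%:R * frac_kernel y.

Lemma measurable_enorm_gt (e : R) : measurable [set y : 'rV[R]_N | e < enorm y].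
Proof.
rewrite (_ : [set _ | _] = (@enorm R N) @^-1` `]e, +oo[); last first.
  by apply/seteqP; split=> y; rewrite /= in_itv/= andbT.
by rewrite -[X in measurable X]setTI; exact: measurable_enorm.
Qed.

Lemma measurable_enorm_lt_fun (e : R) :
  measurable_fun setT (fun y : 'rV[R]_N => (e < enorm y)%R%:R : R).
Proof.
rewrite (_ : (fun _ => _) = \1_[set y : 'rV[R]_N | e < enorm y]).
  apply: measurable_indic; exact: measurable_enorm_gt.
apply/funext => y; rewrite indicE; case: ltP => h; first by rewrite mem_set.
by rewrite memNset//= ltNge h.
Qed.

Lemma trunc_kernel_levy e : levy_kernel (trunc_kernel e).
Proof.
have [mk k0 ke kl] := frac_kernel_levy.
split=> [|y|y|y]; rewrite /trunc_kernel ?enormN ?ke ?mulr_ge0//.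
  by apply: measurable_funM => //; exact: measurable_enorm_lt_fun.
rewrite (le_trans _ (kl y))// ler_wpM2r ?le_min ?ler01 ?sqr_ge0//.
by rewrite ler_piMl//; case: (_ < _).
Qed.

Lemma trunc_kernel_integrable e : 0 < e ->
  mu.-integrable setT (EFin \o trunc_kernel e).
Proof.
move=> e0; apply: (@integrable_le _ _ _ _ _ measurableT _
  (fun y => (1 + e ^- 2) * levy_weight alpha y)).
- exact: levy_measurable (trunc_kernel_levy e).
- by apply: integrable_realZl => //; exact: levy_weight_integrable.
move=> y _; rewrite ger0_norm ?(levy_ge0 (trunc_kernel_levy e))//.
have w0 := levy_weight_ge0 alpha y.
(* For |y| > e one has (1 + e^-2) min(1, |y|^2) >= 1, which is the origin of the constant. *)
rewrite /trunc_kernel; case: ltP => ey; last by rewrite mul0r mulr_ge0// addr_ge0// invr_ge0 sqr_ge0.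
rewrite mul1r /levy_weight mulrA ler_peMl ?powR_ge0//.
have e2 : 0 < e ^+ 2 by rewrite exprn_gt0.
have ey2 : e ^+ 2 <= enorm y ^+ 2 by rewrite lerXn2r ?nnegrE ?enorm_ge0 ?(ltW e0)// ltW.
have [y1|y1] := leP 1 (enorm y ^+ 2); first by rewrite mulr1 lerDl invr_ge0 ltW.
rewrite mulrDl mul1r (le_trans _ (lerD (lexx _) (ler_wpM2l _ ey2))) ?invr_ge0 ?sqr_ge0//.
by rewrite mulVf ?gt_eqF// lerDr sqr_ge0.
Qed.


Lemma measurable_Rintegral_param (F : 'rV[R]_N * 'rV[R]_N -> R) :
  measurable_fun setT F -> measurable_fun setT (fun x => \int[mu]_y F (x, y)).
Proof.
move=> mF; have mEF : measurable_fun setT (EFin \o F) by exact/measurable_EFinP.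
apply: (measurableT_comp (f := fine)); first exact: fine_measurable.
rewrite (_ : (fun x => _) = (fubini_F mu (EFin \o F)^\+ \- fubini_F mu (EFin \o F)^\-)%E).
  apply: emeasurable_funB; apply: measurable_fun_fubini_tonelli_F => //.
    exact: measurable_funepos.
  exact: measurable_funeneg.
apply/funext => x; rewrite integralE /fubini_F.
by congr (_ - _)%E; apply: eq_integral => y _; rewrite ?funeposE ?funenegE.
Qed.

Lemma Rintegral_shift x g : measurable_fun setT g ->
  \int[mu]_y g (x + y) = \int[mu]_y g y.
Proof.
move=> mg; rewrite /Rintegral; congr fine.
by apply: (lebesgue_rV_shift_integral x (F := EFin \o g)); exact/measurable_EFinP.
Qed.

Lemma Rintegral_opp g : measurable_fun setT g ->
  \int[mu]_y g (- y) = \int[mu]_y g y.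
Proof.
move=> mg; rewrite /Rintegral; congr fine.
by apply: (lebesgue_rV_opp_integral (F := EFin \o g)); exact/measurable_EFinP.
Qed.

Lemma integrable_shift x g : mu.-integrable setT (EFin \o g) ->
  mu.-integrable setT (EFin \o (fun y => g (x + y))).
Proof.
move=> gi; have mg := integrable_measurable gi.
apply/integrableP; split; first by apply/measurable_EFinP; exact: measurable_comp_shift.
rewrite (lebesgue_rV_shift_integral x (F := fun y => `|(g y)%:E|%E)).
  by case/integrableP : gi.
by apply: measurableT_comp => //; exact/measurable_EFinP.
Qed.

Lemma integrable_opp g : mu.-integrable setT (EFin \o g) ->
  mu.-integrable setT (EFin \o (fun y => g (- y))).
Proof.
move=> gi; have mg := integrable_measurable gi.
apply/integrableP; split; first by apply/measurable_EFinP; exact: measurable_comp_opp.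
rewrite (lebesgue_rV_opp_integral (F := fun y => `|(g y)%:E|%E)).
  by case/integrableP : gi.
by apply: measurableT_comp => //; exact/measurable_EFinP.
Qed.

Lemma integrable_kernel_diff k g x B : levy_kernel k ->
  mu.-integrable setT (EFin \o k) -> measurable_fun setT g -> (forall y, `|g y| <= B) ->
  mu.-integrable setT (EFin \o (fun y => k y * (g x - g (x + y)))).
Proof.
move=> kk ki mg gB; apply: (@integrable_realM_bounded _ _ _ _ _ measurableT _ _ (B + B) ki).
  by apply: measurable_funB => //; exact: measurable_comp_shift.
by move=> y _; rewrite (le_trans (ler_normB _ _))// lerD.
Qed.

(** For an integrable even kernel, first differences are already integrable and reflection shows
    that the symmetrised integral counts them twice, whence the factor 1/2 in [levy_op]. *)
Lemma levy_opE k g x B : levy_kernel k ->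
  mu.-integrable setT (EFin \o k) -> measurable_fun setT g -> (forall y, `|g y| <= B) ->
  levy_op k g x = \int[mu]_y (k y * (g x - g (x + y))).
Proof.
move=> kk ki mg gB.
have fi := integrable_kernel_diff x kk ki mg gB.
have fE := Rintegral_opp (integrable_measurable fi).
rewrite /levy_op; set I := RHS.
rewrite (_ : \int[mu]_y _ = I + I); first by field.
rewrite -[X in _ = X + _]fE -RintegralD//; last exact: integrable_opp fi.
by apply: eq_Rintegral => y _; rewrite levy_even// /sdiff; ring.
Qed.

Lemma frac_lap_epsE e g x B : 0 < e -> measurable_fun setT g ->
  (forall y, `|g y| <= B) ->
  frac_lap_eps alpha e g x = (levy_op (trunc_kernel e) g x)%:E.
Proof.
move=> e0 mg gB; have kk := trunc_kernel_levy e.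
have ki := trunc_kernel_integrable e0.
rewrite (levy_opE x kk ki mg gB).
have fi := integrable_kernel_diff x kk ki mg gB.
rewrite -integral_EFin_Rintegral// /frac_lap_eps [LHS]integral_mkcond/=.
pose F z := (trunc_kernel e (z - x) * (g x - g z))%:E.
rewrite (_ : _ \_ _ = F).
  rewrite -(lebesgue_rV_shift_integral x).
    by apply: eq_integral => y _; rewrite /F addrAC subrr add0r.
  apply/measurable_EFinP; apply: measurable_funM; last exact: measurable_funB.
  have := measurable_comp_shift (- x) (levy_measurable kk).
  by under eq_fun do rewrite addrC.
apply/funext => z; rewrite /F /patch /trunc_kernel /frac_kernel powRN -(enormN (z - x)) opprB.
case: ifPn => [/set_mem/= ->|/negP zx].
  by congr EFin; rewrite mul1r; exact: mulrC.
have -> : (e < enorm (x - z)) = false by apply/negP => h; apply: zx; rewrite inE.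
by rewrite !mul0r.
Qed.

(** Altering the kernel only inside the ball of radius e changes [levy_op] by at most M times the
    integral of this weight. *)
Definition near_weight (e : R) y : R :=
  (enorm y <= e)%R%:R * (enorm y ^+ 2 * frac_kernel y).

Lemma near_weight_ge0 e y : 0 <= near_weight e y.
Proof. by rewrite !mulr_ge0 ?powR_ge0 ?sqr_ge0// enorm_ge0. Qed.

Lemma measurable_near_weight e : measurable_fun setT (near_weight e).
Proof.
apply: measurable_funM; last first.
  apply: measurable_funM; last exact: levy_measurable frac_kernel_levy.
  apply: measurable_funX; exact: measurable_enorm.
rewrite (_ : (fun _ => _) = (fun y => 1 - (e < enorm y)%R%:R)).
  by apply: measurable_funB => //; exact: measurable_enorm_lt_fun.
by apply/funext => y; case: leP => _; rewrite ?subr0 ?subrr.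
Qed.

Lemma near_weight_le e y : e <= 1 -> near_weight e y <= levy_weight alpha y.
Proof.
move=> e1; rewrite /near_weight; have [ye|ye] := leP (enorm y) e; last first.
  by rewrite mul0r levy_weight_ge0.
rewrite mul1r /levy_weight ler_wpM2r ?powR_ge0// le_min lexx andbT.
by rewrite expr_le1// ?enorm_ge0// (le_trans ye).
Qed.

Lemma near_weight_integrable e : e <= 1 -> mu.-integrable setT (EFin \o near_weight e).
Proof.
move=> e1; apply: (@integrable_le _ _ _ _ _ measurableT _ (levy_weight alpha)).
- exact: measurable_near_weight.
- exact: levy_weight_integrable.
- by move=> y _; rewrite ger0_norm ?near_weight_ge0// near_weight_le.
Qed.

Definition near_mass (e : R) : R := \int[mu]_y near_weight e y.

(** Dominated convergence along the radii 1/(n+1), with [levy_weight] as majorant; monotonicity in e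
    extends the bound to all smaller radii. *)
Lemma near_mass_small (eta : R) : 0 < eta ->
  exists2 e0, 0 < e0 <= 1 & forall e, e <= e0 -> near_mass e <= eta.
Proof.
move=> eta0.
have cv : (\int[mu]_y (near_weight n.+1%:R^-1 y)%:E @[n --> \oo] --> \int[mu]_y (0 : \bar R))%E.
  apply: (@dominated_cvg _ _ _ mu setT measurableT _ _ (EFin \o levy_weight alpha)).
  - by move=> n; apply/measurable_EFinP; exact: measurable_near_weight.
  - move=> y _; have [y0|y0] := eqVneq (enorm y) 0.
      rewrite (_ : (fun _ => _) = fun=> 0%:E); first exact: cvg_cst.
      by apply/funext => n; rewrite /near_weight y0 expr0n mul0r mulr0.
    have {}y0 : 0 < enorm y by rewrite lt_def y0 enorm_ge0.
    apply: cvg_near_cst.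
    exists (Num.bound (enorm y)^-1) => // n /= nb.
    rewrite /near_weight leNgt (_ : _ < _) ?mul0r//.
    rewrite invf_plt ?posrE// (lt_le_trans (archi_boundP _)) ?invr_ge0 ?ltW//.
    by rewrite ltr_nat ltnS.
  - by [].
  - exact: levy_weight_integrable.
  - move=> n y _; rewrite /= ger0_norm ?near_weight_ge0// lee_fin.
    by apply: near_weight_le; rewrite invf_le1// ler1n.
rewrite integral0 in cv.
move/fine_cvgP : cv => [_ /cvgrPdist_le/(_ _ eta0)[n _ /(_ n (leqnn n))]] /=.
rewrite sub0r normrN => h; exists n.+1%:R^-1.
  by rewrite invr_gt0 ltr0Sn/= invf_le1// ler1n.
move=> e en; apply: le_trans h; apply: le_trans (ler_norm _).
have n1 : n.+1%:R^-1 <= 1 :> R by rewrite invf_le1// ler1n.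
apply: le_Rintegral => //.
- exact: (near_weight_integrable (le_trans en n1)).
- exact: (near_weight_integrable n1).
move=> y _; rewrite /near_weight ler_wpM2r ?mulr_ge0 ?enorm_ge0 ?powR_ge0//.
by rewrite ler_nat; have [ye|//] := leP (enorm y) e; rewrite (le_trans ye en).
Qed.

Lemma levy_op_dist k1 k2 e B M g x : levy_kernel k1 -> levy_kernel k2 -> e <= 1 ->
  0 <= M -> sdiff_bounded B M g ->
  (forall y, `|k1 y - k2 y| * enorm y ^+ 2 <= near_weight e y) ->
  `|levy_op k1 g x - levy_op k2 g x| <= M * near_mass e.
Proof.
move=> kk1 kk2 e1 M0 gBM kd; have [mg gB gM] := gBM.
have i1 := integrable_sdiff x kk1 M0 gBM; have i2 := integrable_sdiff x kk2 M0 gBM.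
have ni := near_weight_integrable e1.
rewrite /levy_op -mulrBr -RintegralB// normrM ger0_norm//.
apply: (@le_trans _ _ (1 * `|\int[mu]_y (k1 y * sdiff g x y - k2 y * sdiff g x y)|)).
  by rewrite ler_wpM2r// invf_le1// ler1n.
have di := integrable_realB measurableT i1 i2.
rewrite mul1r (le_trans (le_normr_Rintegral measurableT di))//.
rewrite /near_mass -RintegralZl//; apply: le_Rintegral => //.
- exact: integrable_norm di.
- exact: integrable_realZl.
move=> y _; rewrite -mulrBl normrM (le_trans (ler_wpM2l _ (gM x y)))//.
by rewrite mulrCA ler_wpM2l.
Qed.


Lemma frac_trunc_dist e y : `|frac_kernel y - trunc_kernel e y| * enorm y ^+ 2 <= near_weight e y.
Proof.
rewrite /trunc_kernel /near_weight; have [ye|ye] := leP (enorm y) e.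
  by rewrite mul0r subr0 mul1r ger0_norm ?powR_ge0// mulrC.
by rewrite mul1r subrr normr0 !mul0r.
Qed.

Lemma frac_lap_cvg B M g x : 0 <= M -> sdiff_bounded B M g ->
  frac_lap_eps alpha e g x @[e --> 0^'+] --> (levy_op frac_kernel g x)%:E.
Proof.
move=> M0 gBM; have [mg gB _] := gBM.
apply: cvg_EFin; first by near=> e; rewrite (frac_lap_epsE _ _ mg gB).
apply/cvgrPdist_le => eta eta0.
(* [M + 1] rather than [M] keeps the divisor positive when M = 0. *)
have M1 : 0 < M + 1 by lra.
have [e0 /andP[e00 e01] small] := near_mass_small (divr_gt0 eta0 M1).
near=> e; have ee0 : e <= e0 by near: e; exact: nbhs_right_le.
rewrite /= (frac_lap_epsE _ _ mg gB)//=.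
have e1 := le_trans ee0 e01.
have le1 := levy_op_dist x frac_kernel_levy (trunc_kernel_levy e) e1 M0 gBM (frac_trunc_dist e).
apply: (le_trans le1); apply: (@le_trans _ _ ((M + 1) * near_mass e)).
  rewrite ler_wpM2r ?lerDl//; apply: Rintegral_ge0 => y _; exact: near_weight_ge0.
by rewrite mulrC -ler_pdivlMr// small.
Unshelve. all: end_near. Qed.

Lemma frac_lapE B M g x : 0 <= M -> sdiff_bounded B M g ->
  frac_lap alpha g x = levy_op frac_kernel g x.
Proof.
move=> M0 gBM; rewrite /frac_lap (cvg_lim _ (frac_lap_cvg M0 gBM))//.
Qed.

Lemma has_frac_lap_sdiff B M g x : 0 <= M -> sdiff_bounded B M g ->
  has_frac_lap alpha g x.
Proof.
by move=> M0 gBM; exists (levy_op frac_kernel g x); exact: frac_lap_cvg M0 gBM.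
Qed.

Definition levy_mass : R := \int[mu]_y levy_weight alpha y.

Lemma levy_op_le k B M g x : levy_kernel k -> 0 <= M -> sdiff_bounded B M g ->
  `|levy_op k g x| <= (4 * B + M) * levy_mass.
Proof.
move=> kk M0 gBM; have [_ gB _] := gBM.
have B0 : 0 <= B by rewrite (le_trans _ (gB 0)).
have ki := integrable_sdiff x kk M0 gBM.
have wi := levy_weight_integrable N halpha.
rewrite /levy_op normrM ger0_norm//.
apply: (@le_trans _ _ (1 * `|\int[mu]_y (k y * sdiff g x y)|)).
  by rewrite ler_wpM2r// invf_le1// ler1n.
rewrite mul1r (le_trans (le_normr_Rintegral measurableT ki))//.
rewrite /levy_mass -RintegralZl//; apply: le_Rintegral => //.
- exact: integrable_norm ki.
- exact: integrable_realZl.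
move=> y _; rewrite normrM ger0_norm ?levy_ge0//.
rewrite (le_trans (ler_wpM2l (levy_ge0 kk y) (sdiff_le_min x y M0 gBM)))//.
by rewrite mulrCA ler_wpM2l ?levy_le// addr_ge0 ?mulr_ge0.
Qed.

Lemma measurable_levy_op k B M g : levy_kernel k -> 0 <= M -> sdiff_bounded B M g ->
  measurable_fun setT (levy_op k g).
Proof.
move=> kk M0 gBM; have [mg gB _] := gBM.
apply: measurable_funM => //.
have mF : measurable_fun [set: 'rV[R]_N * 'rV[R]_N]
    (fun z => k z.2 * sdiff g z.1 z.2).
  apply: measurable_funM.
    exact: measurableT_comp (levy_measurable kk) measurable_snd.
  apply: measurable_funB; first apply: measurable_funB.
  - apply: measurable_funM => //; exact: measurableT_comp mg measurable_fst.
  - exact: measurableT_comp mg (@measurable_rVD R N).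
  - apply: (measurableT_comp mg); apply: measurable_fun_rVP => i.
    rewrite (_ : (fun z : 'rV[R]_N * 'rV[R]_N => (z.1 - z.2) 0 i) =
      (fun z => z.1 0 i - z.2 0 i)); last by apply/funext => z; rewrite !mxE.
    apply: measurable_funB.
      exact: (measurableT_comp (measurable_coord i) measurable_fst).
    exact: (measurableT_comp (measurable_coord i) measurable_snd).
exact: measurable_Rintegral_param mF.
Qed.

Lemma levy_opD k B1 M1 B2 M2 g1 g2 x : levy_kernel k ->
  0 <= M1 -> sdiff_bounded B1 M1 g1 -> 0 <= M2 -> sdiff_bounded B2 M2 g2 ->
  levy_op k (fun x => g1 x + g2 x) x = levy_op k g1 x + levy_op k g2 x.
Proof.
move=> kk M10 g1B M20 g2B; rewrite /levy_op -mulrDr -RintegralD//.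
- by congr (_ * _); apply: eq_Rintegral => y _; rewrite /sdiff; ring.
- exact: integrable_sdiff kk M10 g1B.
- exact: integrable_sdiff kk M20 g2B.
Qed.

Lemma levy_opZ k B M g c x : levy_kernel k -> 0 <= M -> sdiff_bounded B M g ->
  levy_op k (fun x => c * g x) x = c * levy_op k g x.
Proof.
move=> kk M0 gB; rewrite /levy_op [RHS]mulrCA -[in RHS]RintegralZl//.
- by congr (_ * _); apply: eq_Rintegral => y _; rewrite /sdiff; ring.
- exact: integrable_sdiff kk M0 gB.
Qed.

Lemma sdiff_boundedD B1 M1 B2 M2 g1 g2 : sdiff_bounded B1 M1 g1 -> sdiff_bounded B2 M2 g2 ->
  sdiff_bounded (B1 + B2) (M1 + M2) (fun x => g1 x + g2 x).
Proof.
move=> [m1 b1 s1] [m2 b2 s2]; split=> [|x|x y]; first exact: measurable_funD.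
  by rewrite (le_trans (ler_normD _ _))// lerD.
rewrite (_ : sdiff _ _ _ = sdiff g1 x y + sdiff g2 x y); last by rewrite /sdiff; ring.
by rewrite mulrDl (le_trans (ler_normD _ _))// lerD.
Qed.

Lemma sdiff_boundedZ B M g c : sdiff_bounded B M g ->
  sdiff_bounded (`|c| * B) (`|c| * M) (fun x => c * g x).
Proof.
move=> [m b s']; split=> [|x|x y]; first exact: measurable_funM.
  by rewrite normrM ler_wpM2l.
rewrite (_ : sdiff _ _ _ = c * sdiff g x y); last by rewrite /sdiff; ring.
by rewrite normrM -mulrA ler_wpM2l.
Qed.

End fractional_laplacian.

(** * The capped kernel and the Gaussian *)

Section regularised_kernel.
Context {R : realType} {N : nat} (alpha : R).
Hypothesis halpha : 0 < alpha < 1.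
Notation mu := (@lebesgue_rV R N).
Notation s := (N%:R + 2 * alpha).
Implicit Types (g k : 'rV[R]_N -> R) (x y z : 'rV[R]_N).

Lemma exponent_gt0 : 0 < s.
Proof. by case/andP: halpha => a0 _; rewrite ltr_wpDl ?mulr_gt0. Qed.

(** The kernel is capped near 0, not set to zero there as in [trunc_kernel]: it stays positive and
    dominates [reg_kernel 1] for e <= 1, which the Gaussian lower bound needs. *)
Definition reg_kernel (e : R) y : R := Num.max (enorm y) e `^ (- s).

Lemma measurable_reg_kernel e : measurable_fun setT (reg_kernel e).
Proof.
apply: (measurableT_comp (measurable_powR _)).
by apply: measurable_maxr => //; exact: measurable_enorm.
Qed.

Lemma powRN_le (u v : R) : 0 < u -> u <= v -> v `^ (- s) <= u `^ (- s).
Proof.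
move=> u0 uv; have v0 := lt_le_trans u0 uv.
rewrite !powRN lef_pV2 ?posrE ?powR_gt0//.
by apply: ge0_ler_powR => //; rewrite ?nnegrE ltW// exponent_gt0.
Qed.

Lemma reg_kernel_le e y : 0 < e -> e <= 1 -> reg_kernel 1 y <= reg_kernel e y.
Proof.
move=> e0 e1; apply: powRN_le; first by rewrite lt_max e0 orbT.
by rewrite ge_max !le_max lexx/= e1 orbT.
Qed.

Lemma reg_kernel_levy e : 0 < e -> levy_kernel alpha (reg_kernel e).
Proof.
move=> e0; split=> [|y|y|y]; rewrite /reg_kernel ?enormN ?powR_ge0//.
  exact: measurable_reg_kernel.
rewrite /levy_weight mulrC.
have [->|y0] := eqVneq (enorm y) 0; first by rewrite expr0n minEle ler10 !mul0r.
have {}y0 : 0 < enorm y by rewrite lt_def y0 enorm_ge0.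
by rewrite ler_wpM2l ?le_min ?ler01 ?sqr_ge0// powRN_le// le_max lexx.
Qed.

Lemma integrable_box (r : R) : 0 <= r ->
  mu.-integrable setT (EFin \o (\1_(box r) : 'rV[R]_N -> R)).
Proof.
move=> r0; have mb : measurable_fun setT (\1_(box r) : 'rV[R]_N -> R).
  by apply: measurable_indic; exact: measurable_box.
apply/integrableP; split; first exact/measurable_EFinP.
under eq_integral do rewrite /= ger0_norm//.
suff -> : (\int[mu]_x (\1_(box r) x)%:E = ((2 * r) ^+ N)%:E)%E by exact: ltry.
rewrite integral_indic//; last exact: measurable_box.
by rewrite -[RHS]lebesgue_rV_box_cube//; congr (mu _); rewrite setIT.
Qed.

Lemma reg_kernel_integrable e : 0 < e -> mu.-integrable setT (EFin \o reg_kernel e).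
Proof.
move=> e0; apply: (@integrable_le _ _ _ _ _ measurableT _
  (fun y => trunc_kernel alpha e y + e `^ (- s) * \1_(box (e + e)) y)).
- exact: measurable_reg_kernel.
- apply: integrable_realD => //; first exact: trunc_kernel_integrable.
  by apply: integrable_realZl => //; apply: integrable_box; rewrite addr_ge0 ?ltW.
move=> y _; rewrite ger0_norm ?powR_ge0//.
rewrite /reg_kernel /trunc_kernel; have [ye|ye] := leP (enorm y) e.
  rewrite mul0r add0r indicE mem_set ?mulr1//.
  by apply: enorm_lt_box; rewrite (le_lt_trans ye)// ltrDr.
by rewrite mul1r lerDl mulr_ge0 ?powR_ge0.
Qed.

Lemma frac_reg_dist e y : 0 < e ->
  `|frac_kernel alpha y - reg_kernel e y| * enorm y ^+ 2 <= near_weight alpha e y.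
Proof.
move=> e0; rewrite /reg_kernel /near_weight /frac_kernel.
have [ye|ye] := leP (enorm y) e; last by rewrite subrr normr0 !mul0r.
have [->|y0] := eqVneq (enorm y) 0; first by rewrite expr0n !mul0r !mulr0.
have {}y0 : 0 < enorm y by rewrite lt_def y0 enorm_ge0.
rewrite mul1r mulrC ler_wpM2l ?sqr_ge0// ger0_norm ?subr_ge0 ?powRN_le//.
by rewrite gerBl powR_ge0.
Qed.

Definition gauss y : R := expR (- enorm y ^+ 2).

Lemma gauss_gt0 y : 0 < gauss y. Proof. exact: expR_gt0. Qed.

Lemma gauss_le1 y : gauss y <= 1.
Proof. by rewrite -expR0 ler_expR oppr_le0 sqr_ge0. Qed.

Lemma gauss0 : gauss 0 = 1.
Proof.
rewrite /gauss sqr_enorm big1 ?oppr0 ?expR0// => i _.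
by rewrite mxE expr0n.
Qed.

Lemma measurable_gauss : measurable_fun setT gauss.
Proof.
apply: (measurableT_comp (f := expR)) => //; apply: measurable_funN.
apply: measurable_funX; exact: measurable_enorm.
Qed.

Lemma parallelogram x y :
  enorm (x + y) ^+ 2 + enorm (x - y) ^+ 2 = 2 * enorm x ^+ 2 + 2 * enorm y ^+ 2.
Proof.
rewrite !sqr_enorm !mulr_sumr -!big_split/=; apply: eq_bigr => i _.
rewrite !mxE; ring.
Qed.

(* AM-GM: [exp(-|x+y|^2) + exp(-|x-y|^2) >= 2 exp(-|x|^2-|y|^2)] *)
Lemma sdiff_gauss x y : sdiff gauss x y <= 2 * (Num.min 1 (enorm y ^+ 2) * gauss x).
Proof.
have amgm : 2 * (gauss x * gauss y) <= gauss (x + y) + gauss (x - y).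
  set p := expR (- enorm (x + y) ^+ 2 / 2); set q := expR (- enorm (x - y) ^+ 2 / 2).
  have -> : gauss (x + y) = p ^+ 2.
    by rewrite /p -expRM_natl; congr expR; field.
  have -> : gauss (x - y) = q ^+ 2.
    by rewrite /q -expRM_natl; congr expR; field.
  have -> : gauss x * gauss y = p * q.
    rewrite /gauss /p /q -!expRD; congr expR.
    have := parallelogram x y; lra.
  by have := sqr_ge0 (p - q); rewrite sqrrB -mulr_natl; lra.
have g1 : 1 - enorm y ^+ 2 <= gauss y by exact: expR_ge1Dx.
have gx := gauss_gt0 x; have gy := gauss_gt0 y.
have g2 := ler_wpM2l (ltW gx) g1; have g3 := mulr_gt0 gx gy.
rewrite /sdiff; have [h|h] := leP 1 (enorm y ^+ 2); lra.
Qed.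

(** With n = N + 2, the exponent N + 2 alpha is at most 2n, and max(r, 1)^2 <= 2n (1 + r^2/(2n)) <=
    2n exp(r^2/(2n)); the n-th power of this gives the constant (2n)^n. *)
Definition gauss_const : R := ((2 * N.+2%:R) ^+ N.+2)^-1.

Lemma gauss_const_gt0 : 0 < gauss_const.
Proof. by rewrite invr_gt0 exprn_gt0// mulr_gt0. Qed.

Lemma gauss_le_reg_kernel x z :
  gauss_const * (gauss x * gauss z) <= reg_kernel 1 (x - z).
Proof.
set n := N.+2; set r := enorm (x - z).
have n0 : 0 < 2 * n%:R :> R by rewrite mulr_gt0.
(* By the parallelogram law |x|^2 + |z|^2 >= |x - z|^2 / 2. *)
have gxz : gauss x * gauss z <= expR (- (r ^+ 2 / 2)).
  rewrite /gauss -expRD ler_expR.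
  have := parallelogram x z; have := sqr_ge0 (enorm (x + z)); rewrite -/r; lra.
rewrite /reg_kernel -/r powRN.
have m0 : 0 < Num.max r 1 by rewrite lt_max ltr01 orbT.
have key : Num.max r 1 `^ s <= (2 * n%:R) ^+ n * expR (r ^+ 2 / 2).
  apply: (@le_trans _ _ (Num.max r 1 `^ (2 * n)%:R)).
    apply: ler_powR; first by rewrite le_max lexx orbT.
    by case/andP: halpha => a0 a1; rewrite natrM /n -addn2 natrD; have := ler0n R N; lra.
  rewrite (powR_mulrn _ (ltW m0)) exprM.
  have -> : r ^+ 2 / 2 = (r ^+ 2 / (2 * n%:R)) * n%:R by field; rewrite pnatr_eq0.
  rewrite expRM_natr -exprMn lerXn2r ?nnegrE ?sqr_ge0//.
  apply: (@le_trans _ _ (2 * n%:R * (1 + r ^+ 2 / (2 * n%:R)))); last first.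
    by rewrite ler_pM2l// expR_ge1Dx.
  rewrite mulrDr mulr1 mulrCA mulfV ?gt_eqF// mulr1.
  have r0 := sqr_ge0 r; have n2 : 2 <= n%:R :> R by rewrite ler_nat.
  by have [h|h] := leP r 1; rewrite ?expr1n; lra.
have e0 := expR_gt0 (r ^+ 2 / 2).
rewrite (le_trans (ler_wpM2l (ltW gauss_const_gt0) gxz))//.
have P0 : 0 < (2 * n%:R) ^+ n * expR (r ^+ 2 / 2) by rewrite mulr_gt0// exprn_gt0.
by rewrite expRN /gauss_const -invfM lef_pV2 ?posrE// powR_gt0.
Qed.

(** The kernel bound at z = 0 already dominates the Gaussian by an integrable function. *)
Lemma gauss_integrable : mu.-integrable setT (EFin \o gauss).
Proof.
have c0 := gauss_const_gt0.
apply: (@integrable_le _ _ _ _ _ measurableT _ (fun y => gauss_const^-1 * reg_kernel 1 y)).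
- exact: measurable_gauss.
- by apply: integrable_realZl => //; apply: reg_kernel_integrable.
move=> y _; rewrite ger0_norm ?expR_ge0// ler_pdivlMl//.
by have := gauss_le_reg_kernel y 0; rewrite gauss0 mulr1 subr0.
Qed.

End regularised_kernel.

(** * Convolution with an integrable even kernel *)

Section convolution.
Context {R : realType} {N : nat} (alpha : R).
Hypothesis halpha : 0 < alpha < 1.
Notation mu := (@lebesgue_rV R N).
Notation s := (N%:R + 2 * alpha).
Notation intg f := (mu.-integrable setT (EFin \o f)).
Implicit Types (g k h : 'rV[R]_N -> R) (x y : 'rV[R]_N).

Definition kconv k g x : R := \int[mu]_y (k y * g (x + y)).

Lemma conv_integrable k g x B : intg k -> measurable_fun setT g ->
  (forall y, `|g y| <= B) -> intg (fun y => k y * g (x + y)).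
Proof.
move=> ki mg gB; apply: (integrable_realM_bounded measurableT ki (B := B)) => //.
exact: measurable_comp_shift.
Qed.

Lemma measurable_conv k g : measurable_fun setT k -> measurable_fun setT g ->
  measurable_fun setT (kconv k g).
Proof.
move=> mk mg.
have mF : measurable_fun [set: 'rV[R]_N * 'rV[R]_N] (fun z => k z.2 * g (z.1 + z.2)).
  apply: measurable_funM; first exact: measurableT_comp mk measurable_snd.
  exact: measurableT_comp mg (@measurable_rVD R N).
exact: measurable_Rintegral_param mF.
Qed.

Lemma conv_ge0 k g x : (forall y, 0 <= k y) -> (forall y, 0 <= g y) -> 0 <= kconv k g x.
Proof. by move=> k0 g0; apply: Rintegral_ge0 => y _; rewrite mulr_ge0. Qed.

Lemma le_conv k g1 g2 B1 B2 x : intg k -> (forall y, 0 <= k y) ->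
  measurable_fun setT g1 -> (forall y, `|g1 y| <= B1) ->
  measurable_fun setT g2 -> (forall y, `|g2 y| <= B2) ->
  (forall y, g1 y <= g2 y) -> kconv k g1 x <= kconv k g2 x.
Proof.
move=> ki k0 m1 b1 m2 b2 g12; apply: le_Rintegral => //.
- exact: conv_integrable ki m1 b1.
- exact: conv_integrable ki m2 b2.
- by move=> y _; rewrite ler_wpM2l.
Qed.

Lemma convZ k g c B x : intg k -> measurable_fun setT g -> (forall y, `|g y| <= B) ->
  kconv k (fun y => c * g y) x = c * kconv k g x.
Proof.
move=> ki mg gB; rewrite /kconv -RintegralZl//; last exact: conv_integrable ki mg gB.
by apply: eq_Rintegral => y _; rewrite mulrCA.
Qed.

Lemma norm_conv_le k g B x : intg k -> (forall y, 0 <= k y) ->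
  measurable_fun setT g -> (forall y, `|g y| <= B) ->
  `|kconv k g x| <= (\int[mu]_y k y) * B.
Proof.
move=> ki k0 mg gB; have ci := conv_integrable x ki mg gB.
rewrite (le_trans (le_normr_Rintegral measurableT ci))// -RintegralZr//.
apply: le_Rintegral => //; first exact: integrable_norm ci.
- rewrite (_ : _ \o _ = EFin \o (fun y => B * k y)); first exact: integrable_realZl.
  by apply/funext => y /=; rewrite mulrC.
- by move=> y _; rewrite normrM ger0_norm// ler_wpM2l.
Qed.

(** Second differences commute with translations, hence with averaging against k; both constants are
    multiplied by the mass of k. *)
Lemma conv_sdiff_bounded k B M g : intg k -> (forall y, 0 <= k y) ->
  sdiff_bounded B M g ->
  sdiff_bounded ((\int[mu]_y k y) * B) ((\int[mu]_y k y) * M) (kconv k g).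
Proof.
move=> ki k0 [mg gB gM]; split=> [|x|x y].
- exact: measurable_conv (integrable_measurable ki) mg.
- exact: norm_conv_le.
have -> : sdiff (kconv k g) x y = \int[mu]_z (k z * sdiff g (x + z) y).
  rewrite /sdiff /kconv -RintegralZl//; last exact: conv_integrable ki mg gB.
  rewrite -RintegralB//; last 2 first.
  - by apply: integrable_realZl => //; exact: conv_integrable ki mg gB.
  - exact: conv_integrable ki mg gB.
  rewrite -RintegralB//; last 2 first.
  - apply: integrable_realB => //; last exact: conv_integrable ki mg gB.
    by apply: integrable_realZl => //; exact: conv_integrable ki mg gB.
  - exact: conv_integrable ki mg gB.
  apply: eq_Rintegral => z _; rewrite -!(addrAC x z) /=.
  ring.
have mG : measurable_fun setT (fun z => sdiff g (x + z) y).
  rewrite /sdiff; apply: measurable_funB; first apply: measurable_funB.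
  - by apply: measurable_funM => //; exact: measurable_comp_shift.
  - under eq_fun do rewrite addrAC; exact: measurable_comp_shift.
  - under eq_fun do rewrite addrAC; exact: measurable_comp_shift.
rewrite -mulrA.
have := norm_conv_le 0 ki k0 (g := fun z => sdiff g (x + z) y) mG
  (fun z => gM (x + z) y).
by rewrite /kconv; under eq_Rintegral do rewrite add0r.
Qed.

Lemma levy_op_conv k g x B : levy_kernel alpha k -> intg k -> measurable_fun setT g ->
  (forall y, `|g y| <= B) -> levy_op k g x = (\int[mu]_y k y) * g x - kconv k g x.
Proof.
move=> kk ki mg gB; rewrite (levy_opE x kk ki mg gB) -RintegralZr// -RintegralB//.
- by apply: eq_Rintegral => y _; rewrite mulrBr.
- rewrite (_ : _ \o _ = EFin \o (fun y => g x * k y)); first exact: integrable_realZl.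
  by apply/funext => y /=; rewrite mulrC.
- exact: conv_integrable ki mg gB.
Qed.

(** By [sdiff_gauss] and [levy_le], [levy_op k gauss] is at most [levy_mass * gauss]. The loss is
    the same for every admissible kernel, so it does not deteriorate as the cap is removed. *)
Lemma conv_gauss_ge k x : levy_kernel alpha k -> intg k ->
  (\int[mu]_y k y - @levy_mass R N alpha) * gauss x <= kconv k gauss x.
Proof.
move=> kk ki; have mg := @measurable_gauss R N.
have gB y : `|gauss y| <= 1 :> R by rewrite ger0_norm ?gauss_le1// ltW// gauss_gt0.
have E := levy_op_conv x kk ki mg gB.
rewrite mulrBl lerBlDr -lerBlDl -E /levy_op /levy_mass -ler_pdivlMl// invrK.
have wi := levy_weight_integrable N halpha.
rewrite -RintegralZr// -RintegralZl//; last first.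
  rewrite (_ : _ \o _ = EFin \o (fun y => gauss x * levy_weight alpha y)).
    exact: integrable_realZl.
  by apply/funext => y /=; rewrite mulrC.
apply: le_Rintegral => //.
- apply: (integrable_realM_bounded measurableT ki (B := 4)).
    exact: measurable_sdiff.
  move=> y _; rewrite /sdiff.
  have := gB x; have := gB (x + y); have := gB (x - y).
  rewrite !ler_norml => /andP[? ?] /andP[? ?] /andP[? ?]; apply/andP; split; lra.
- apply: integrable_realZl => //.
  rewrite (_ : _ \o _ = EFin \o (fun y => gauss x * levy_weight alpha y)).
    exact: integrable_realZl.
  by apply/funext => y /=; rewrite mulrC.
move=> y _; rewrite (le_trans (ler_wpM2l (levy_ge0 kk y) (sdiff_gauss x y)))//.
rewrite mulrCA ler_wpM2l// mulrA ler_wpM2r ?levy_le// ltW// gauss_gt0//.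
Qed.

(** Tonelli, the substitutions x - y for x and -y for y, and evenness of k. Only g is integrable: h
    may be the constant 1, which yields conservation of mass, or the Gaussian. *)
Lemma conv_adjoint k g h : levy_kernel alpha k -> intg k ->
  intg g -> (forall y, 0 <= g y) -> forall B, (forall y, g y <= B) ->
  measurable_fun setT h -> (forall y, 0 <= h y) -> forall C, (forall y, h y <= C) ->
  (\int[mu]_x (kconv k g x * h x)%:E = \int[mu]_x (g x * kconv k h x)%:E)%E.
Proof.
move=> kk ki gi g0 B gB mh h0 C hC.
have mg := integrable_measurable gi; have mk := integrable_measurable ki.
have gB' y : `|g y| <= B by rewrite ger0_norm.
have hC' y : `|h y| <= C by rewrite ger0_norm.
have k0 := levy_ge0 kk.
have mF : measurable_fun [set: 'rV[R]_N * 'rV[R]_N]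
    (fun z => (k z.2 * g (z.1 + z.2) * h z.1)%:E).
  apply/measurable_EFinP; apply: measurable_funM.
    apply: measurable_funM; first exact: measurableT_comp mk measurable_snd.
    exact: measurableT_comp mg (@measurable_rVD R N).
  exact: measurableT_comp mh measurable_fst.
have F0 z : (0 <= (k z.2 * g (z.1 + z.2) * h z.1)%:E)%E.
  by rewrite lee_fin !mulr_ge0.
transitivity (\int[mu]_x \int[mu]_y (k y * g (x + y) * h x)%:E)%E.
  apply: eq_integral => x _; rewrite EFinM /kconv.
  rewrite -integral_EFin_Rintegral//; last exact: conv_integrable ki mg gB'.
  rewrite -ge0_integralZr//.
  - apply/measurable_EFinP; apply: measurable_funM => //; exact: measurable_comp_shift.
  - by move=> y _; rewrite lee_fin mulr_ge0.
  - by rewrite lee_fin.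
rewrite (fubini_tonelli (m1 := mu) (m2 := mu) _ mF F0)/=.
transitivity (\int[mu]_y \int[mu]_x (k y * g x * h (x - y))%:E)%E.
  apply: eq_integral => y _.
  rewrite -(lebesgue_rV_shift_integral y (F := fun x => (k y * g x * h (x - y))%:E)).
    by apply: eq_integral => x _; rewrite (addrC y) addrK.
  apply/measurable_EFinP; apply: measurable_funM; first exact: measurable_funM.
  by under eq_fun do rewrite addrC; exact: measurable_comp_shift.
have mG : measurable_fun [set: 'rV[R]_N * 'rV[R]_N]
    (fun z => (k z.1 * g z.2 * h (z.2 - z.1))%:E).
  apply/measurable_EFinP; apply: measurable_funM.
    apply: measurable_funM; first exact: measurableT_comp mk measurable_fst.
    exact: measurableT_comp mg measurable_snd.
  apply: (measurableT_comp mh); apply: measurable_fun_rVP => i.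
  rewrite (_ : (fun z : 'rV[R]_N * 'rV[R]_N => (z.2 - z.1) 0 i) =
    (fun z => z.2 0 i - z.1 0 i)); last by apply/funext => z; rewrite !mxE.
  apply: measurable_funB.
    exact: (measurableT_comp (measurable_coord i) measurable_snd).
  exact: (measurableT_comp (measurable_coord i) measurable_fst).
have G0 z : (0 <= (k z.1 * g z.2 * h (z.2 - z.1))%:E)%E.
  by rewrite lee_fin !mulr_ge0.
rewrite (fubini_tonelli (m1 := mu) (m2 := mu) _ mG G0)/=.
apply: eq_integral => x _.
have hi := conv_integrable x ki mh hC'.
rewrite EFinM /kconv -integral_EFin_Rintegral//.
rewrite -ge0_integralZl//; last 3 first.
- by case/integrableP : hi.
- by move=> y _; rewrite lee_fin mulr_ge0.
- by rewrite lee_fin.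
rewrite -(lebesgue_rV_opp_integral (F := fun y => ((g x)%:E * (k y * h (x + y))%:E)%E)).
  by apply: eq_integral => y _; rewrite (levy_even kk) -EFinM; congr EFin; ring.
by apply: emeasurable_funM => //; case/integrableP : hi.
Qed.

End convolution.

(** * Powers of the jump operator and their Gaussian lower bounds *)

Section iterates.
Context {R : realType} {N : nat} (alpha : R).
Hypothesis halpha : 0 < alpha < 1.
Notation mu := (@lebesgue_rV R N).
Notation intg f := (mu.-integrable setT (EFin \o f)).
Implicit Types (g k h : 'rV[R]_N -> R) (x y : 'rV[R]_N).

Lemma levy_mass_ge0 : 0 <= @levy_mass R N alpha.
Proof. by apply: Rintegral_ge0 => y _; exact: levy_weight_ge0. Qed.

Definition reg_mass (e : R) : R := \int[mu]_y reg_kernel alpha e y.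

Lemma reg_mass_ge0 e : 0 <= reg_mass e.
Proof. by apply: Rintegral_ge0 => y _; rewrite powR_ge0. Qed.

(** [levy_mass] is what the Gaussian loses under convolution, and [reg_mass 1] the mass of the part
    of the kernel reserved for creating Gaussian height in [jump_op_lower]. Neither depends on e. *)
Definition decay_rate : R := @levy_mass R N alpha + reg_mass 1.

Lemma decay_rate_ge0 : 0 <= decay_rate.
Proof. by rewrite addr_ge0 ?levy_mass_ge0 ?reg_mass_ge0. Qed.

Variable e : R.
Hypothesis he : 0 < e <= 1.
Let e0 : 0 < e. Proof. by case/andP: he. Qed.
Let e1 : e <= 1. Proof. by case/andP: he. Qed.

(* Adding the multiple [decay_rate] of the identity to the convolution does not
   change [total_rate * g - jump_op g], but keeps the lower bounds below
   nonnegative. *)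
Definition total_rate : R := reg_mass e + decay_rate.

Definition jump_op g x : R := kconv (reg_kernel alpha e) g x + decay_rate * g x.

Lemma total_rate_ge0 : 0 <= total_rate.
Proof. by rewrite addr_ge0 ?reg_mass_ge0 ?decay_rate_ge0. Qed.

Let ki := @reg_kernel_integrable R N alpha halpha e e0.
Let kk := @reg_kernel_levy R N alpha halpha e e0.
Let k0 := levy_ge0 kk.

Record density (B M : R) g : Prop := {
  density_sdiff : sdiff_bounded B M g ;
  density_ge0 : forall x, 0 <= g x ;
  density_integrable : intg g }.

Definition gauss_mass g : R := \int[mu]_x (g x * gauss x).

Lemma gauss_mass_integrable B M g : density B M g ->
  intg (fun x => g x * gauss x).
Proof.
move=> [_ g0 gi]; apply: (integrable_realM_bounded measurableT gi (B := 1)).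
  exact: measurable_gauss.
by move=> y _; rewrite ger0_norm ?gauss_le1// ltW// gauss_gt0.
Qed.

Lemma total_rate_levy_op g x B M : sdiff_bounded B M g ->
  total_rate * g x - jump_op g x = levy_op (reg_kernel alpha e) g x.
Proof.
move=> [mg gB _]; rewrite (levy_op_conv x kk ki mg gB) /total_rate /jump_op -/(reg_mass e).
ring.
Qed.

Lemma jump_op_sdiff B M g : sdiff_bounded B M g ->
  sdiff_bounded (total_rate * B) (total_rate * M) (jump_op g).
Proof.
move=> gb; rewrite (mulrDl _ _ B) (mulrDl _ _ M); apply: sdiff_boundedD; first exact: conv_sdiff_bounded.
have := sdiff_boundedZ decay_rate gb; by rewrite ger0_norm ?decay_rate_ge0.
Qed.

(** The adjoint identity against the constant 1; finiteness of the resulting integral also gives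
    integrability. *)
Lemma conv_density_integral B M g : density B M g ->
  intg (kconv (reg_kernel alpha e) g) /\
  \int[mu]_x kconv (reg_kernel alpha e) g x = reg_mass e * \int[mu]_x g x.
Proof.
move=> [[mg gB gM] g0 gi].
have gB' y : g y <= B by rewrite (le_trans (ler_norm _)).
have mone : measurable_fun setT (cst 1 : 'rV[R]_N -> R) by [].
have E := conv_adjoint kk ki gi g0 gB' mone (fun=> ler01) (C := 1) (fun=> lexx _).
have conv1 x : kconv (reg_kernel alpha e) (cst 1) x = reg_mass e.
  by apply: eq_Rintegral => y _ /=; rewrite mulr1.
have Ei : (\int[mu]_x (kconv (reg_kernel alpha e) g x)%:E = (reg_mass e * \int[mu]_x g x)%:E)%E.
  rewrite -RintegralZl// -integral_EFin_Rintegral//; last exact: integrable_realZl.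
  transitivity (\int[mu]_x (kconv (reg_kernel alpha e) g x * cst 1 x)%:E)%E.
    by apply: eq_integral => x _; rewrite mulr1.
  by rewrite E; apply: eq_integral => x _; rewrite conv1 mulrC.
split; last by rewrite /Rintegral Ei.
apply/integrableP; split.
  by apply/measurable_EFinP; exact: measurable_conv (integrable_measurable ki) mg.
under eq_integral do rewrite /= ger0_norm ?conv_ge0//.
by rewrite Ei ltry.
Qed.

Lemma jump_op_density B M g : density B M g ->
  density (total_rate * B) (total_rate * M) (jump_op g).
Proof.
move=> gd; have [gb g0 gi] := gd; have [ci _] := conv_density_integral gd.
split; first exact: jump_op_sdiff.
  by move=> x; rewrite addr_ge0 ?conv_ge0// mulr_ge0 ?decay_rate_ge0.
by apply: integrable_realD => //; exact: integrable_realZl.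
Qed.

Lemma jump_op_integral B M g : density B M g ->
  \int[mu]_x jump_op g x = total_rate * \int[mu]_x g x.
Proof.
move=> gd; have [gb g0 gi] := gd; have [ci cE] := conv_density_integral gd.
rewrite RintegralD//; last exact: integrable_realZl.
by rewrite cE RintegralZl// -mulrDl.
Qed.

(** The convolution is moved onto the Gaussian, whose loss [levy_mass] is outweighed by the added
    [decay_rate]. *)
Lemma jump_op_gauss_mass B M g : density B M g ->
  reg_mass e * gauss_mass g <= gauss_mass (jump_op g).
Proof.
move=> gd; have [[mg gB gM] g0 gi] := gd; have [ci cE] := conv_density_integral gd.
have gB' y : g y <= B by rewrite (le_trans (ler_norm _)).
have mb := @measurable_gauss R N.
have b0 y : 0 <= gauss y :> R by rewrite ltW// gauss_gt0.
have E := conv_adjoint kk ki gi g0 gB' mb b0 (C := 1) (@gauss_le1 R N).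
have gbi := gauss_mass_integrable gd.
have cbi : intg (fun x => kconv (reg_kernel alpha e) g x * gauss x).
  apply: (integrable_realM_bounded measurableT ci (B := 1)) => //.
  by move=> y _; rewrite ger0_norm ?gauss_le1.
have b1 y : `|gauss y| <= 1 :> R by rewrite ger0_norm ?gauss_le1.
have gcbi : intg (fun x => g x * kconv (reg_kernel alpha e) gauss x).
  apply: (integrable_realM_bounded measurableT gi) => //.
    exact: measurable_conv (integrable_measurable ki) mb.
  by move=> y _; exact: (norm_conv_le y ki k0 mb b1).
have E' : \int[mu]_x (kconv (reg_kernel alpha e) g x * gauss x) =
    \int[mu]_x (g x * kconv (reg_kernel alpha e) gauss x).
  by rewrite /Rintegral E.
rewrite /gauss_mass.
under [X in _ <= X]eq_Rintegral do rewrite /jump_op mulrDl -mulrA.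
rewrite RintegralD//; last exact: integrable_realZl.
rewrite E' RintegralZl// -/(gauss_mass g) -lerBlDr -mulrBl.
rewrite -RintegralZl//; apply: le_Rintegral => //; first exact: integrable_realZl.
move=> x _; rewrite mulrCA ler_wpM2l//.
apply: le_trans (conv_gauss_ge halpha x kk ki).
by rewrite ler_wpM2r// -/(reg_mass e) lerB// /decay_rate lerDl reg_mass_ge0.
Qed.

(** The kernel is split as k' plus [reg_kernel 1]. The first part propagates the height q already
    present, the second converts the Gaussian mass of g into new height, and the term
    [decay_rate * g] restores exactly what the first part lost. *)
Lemma jump_op_lower B M g q : density B M g -> 0 <= q ->
  (forall x, q * gauss x <= g x) ->
  forall x, (reg_mass e * q + @gauss_const R N * gauss_mass g) * gauss x <= jump_op g x.
Proof.
move=> gd q0 qg x; have [[mg gB gM] g0 gi] := gd.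
have mb := @measurable_gauss R N.
have b0 y : 0 <= gauss y :> R by rewrite ltW// gauss_gt0.
have b1 y : `|gauss y| <= 1 :> R by rewrite ger0_norm ?gauss_le1.
have k1i := @reg_kernel_integrable R N alpha halpha 1 ltr01.
pose k' y := reg_kernel alpha e y - reg_kernel alpha 1 y.
have k'i : intg k' by exact: integrable_realB.
have k'le y : 0 <= k' y <= reg_kernel alpha e y.
  by rewrite subr_ge0 reg_kernel_le//= gerBl powR_ge0.
have kk' : levy_kernel alpha k'.
  split=> [|y|y|y]; first exact: integrable_measurable k'i.
  - by case/andP: (k'le y).
  - by rewrite /k' /reg_kernel enormN.
  - rewrite (le_trans _ (levy_le kk y))// ler_wpM2r//; last by case/andP: (k'le y).
    by rewrite le_min ler01 sqr_ge0.
have split_conv : kconv (reg_kernel alpha e) g x = kconv k' g x + kconv (reg_kernel alpha 1) g x.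
  rewrite /kconv -RintegralD//; try exact: (conv_integrable x _ mg gB).
  by apply: eq_Rintegral => y _; rewrite /k' -mulrDl subrK.
have k'mass : \int[mu]_y k' y = reg_mass e - reg_mass 1 by exact: RintegralB.
have low1 : q * ((reg_mass e - decay_rate) * gauss x) <= kconv k' g x.
  have qb y : `|q * gauss y| <= q by rewrite normrM (ger0_norm q0) ler_piMr.
  apply: le_trans (le_conv x k'i (levy_ge0 kk') (measurable_funM _ mb) qb mg gB qg) => //.
  rewrite (convZ q x k'i mb b1) ler_wpM2l//.
  apply: le_trans (conv_gauss_ge halpha x kk' k'i); rewrite k'mass /decay_rate.
  by rewrite ler_wpM2r// opprD [- _ - reg_mass 1]addrC addrA lexx.
have low2 : @gauss_const R N * gauss_mass g * gauss x <= kconv (reg_kernel alpha 1) g x.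
  have gbi := gauss_mass_integrable gd.
  have gbxi := integrable_shift x gbi.
  rewrite /gauss_mass -(Rintegral_shift x (integrable_measurable gbi)).
  rewrite mulrAC -RintegralZl//; apply: le_Rintegral => //.
  - exact: integrable_realZl.
  - exact: (conv_integrable x k1i mg gB).
  move=> y _; rewrite (mulrC (g _)) mulrA ler_wpM2r//.
  have := gauss_le_reg_kernel halpha x (x + y).
  by rewrite opprD addrA subrr add0r /reg_kernel enormN -mulrA.
rewrite /jump_op split_conv.
have low3 := ler_wpM2l decay_rate_ge0 (qg x).
apply: le_trans (lerD (lerD low1 low2) low3); rewrite le_eqVlt; apply/orP; left; apply/eqP.
move: (gauss x) (gauss_mass g) (reg_mass e) (@gauss_const R N) decay_rate => u m r c d.
ring.
Qed.

Definition iterate (i : nat) g := iter i jump_op g.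

Lemma iterate_density B M g i : density B M g ->
  density (total_rate ^+ i * B) (total_rate ^+ i * M) (iterate i g).
Proof.
move=> gd; elim: i => [|i ih]; first by rewrite !expr0 !mul1r.
by rewrite !exprS -!mulrA; exact: jump_op_density.
Qed.

Lemma iterate_integral B M g i : density B M g ->
  \int[mu]_x iterate i g x = total_rate ^+ i * \int[mu]_x g x.
Proof.
move=> gd; elim: i => [|i ih]; first by rewrite expr0 mul1r.
by rewrite [LHS](jump_op_integral (iterate_density i gd)) ih exprS mulrA.
Qed.

Lemma gauss_mass_ge0 B M g : density B M g -> 0 <= gauss_mass g.
Proof.
by move=> gd; apply: Rintegral_ge0 => x _; rewrite mulr_ge0 ?(density_ge0 gd)// ltW// gauss_gt0.
Qed.

Lemma iterate_gauss_mass B M g i : density B M g ->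
  reg_mass e ^+ i * gauss_mass g <= gauss_mass (iterate i g).
Proof.
move=> gd; elim: i => [|i ih]; first by rewrite expr0 mul1r.
apply: le_trans (jump_op_gauss_mass (iterate_density i gd)).
by rewrite exprS -mulrA ler_wpM2l ?reg_mass_ge0.
Qed.

(** Up to a common factor the heights obey q_(i+1) = r q_i + r^i with q_0 = 0, solved by i r^(i-1).
    The truncated predecessor at i = 0 is harmless because of the factor i. *)
Lemma iterate_lower B M g i : density B M g -> forall x,
  (@gauss_const R N * gauss_mass g) * (i%:R * reg_mass e ^+ i.-1) * gauss x <= iterate i g x.
Proof.
move=> gd; elim: i => [|i ih] x; first by rewrite mul0r mulr0 mul0r (density_ge0 gd).
have c0 := @gauss_const_gt0 R N; have th0 := gauss_mass_ge0 gd.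
have l0 := reg_mass_ge0 e.
apply: le_trans (jump_op_lower (iterate_density i gd) _ ih x); last first.
  by rewrite !mulr_ge0 ?exprn_ge0// ltW.
rewrite ler_wpM2r ?(ltW (gauss_gt0 x))//.
apply: le_trans (lerD (lexx _) (ler_wpM2l (ltW c0) (iterate_gauss_mass i gd))).
case: i {ih} => [|i]; first by rewrite !expr0 !mul0r !mulr0 add0r !mulr1 mul1r.
rewrite /= exprS -natr1.
by rewrite le_eqVlt; apply/orP; left; apply/eqP; ring.
Qed.

End iterates.

(** * The time profiles and their differential inequalities *)

Section time_profiles.
Context {R : realType}.
Notation leb := (@lebesgue_measure R).
Variable T : R.
Hypothesis T0 : 0 < T.
Implicit Types (a f : R -> R) (t nu c : R).

Lemma within_continuous_integrable a : {within `[0, T], continuous a} ->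
  leb.-integrable `[0, T] (EFin \o a).
Proof. by move=> ca; apply: continuous_compact_integrable => //; exact: segment_compact. Qed.

Lemma within_continuous_bounded a : {within `[0, T], continuous a} ->
  exists2 B, 0 <= B & forall t, 0 <= t <= T -> `|a t| <= B.
Proof.
move=> ca.
have cpt : compact [set a t | t in `[0, T]].
  by apply: continuous_compact => //; exact: segment_compact.
have [B [_ hB]] := compact_bounded cpt.
exists (`|B| + 1) => [|t tT]; first by rewrite addr_ge0.
apply: (hB (`|B| + 1)) => /=.
  by rewrite (le_lt_trans (ler_norm B))// ltrDl.
by exists t.
Qed.

Let withinT (g : R -> R) : continuous g -> {within `[0, T], continuous g}.
Proof. exact: continuous_subspaceT. Qed.

Lemma within_continuousM (f g : R -> R) : {within `[0, T], continuous f} ->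
  {within `[0, T], continuous g} -> {within `[0, T], continuous (fun r => f r * g r)}.
Proof. by move=> cf cg x; apply: cvgM; [exact: cf|exact: cg]. Qed.

Lemma within_continuousD (f g : R -> R) : {within `[0, T], continuous f} ->
  {within `[0, T], continuous g} -> {within `[0, T], continuous (fun r => f r + g r)}.
Proof. by move=> cf cg x; apply: cvgD; [exact: cf|exact: cg]. Qed.

Lemma within_continuousB (f g : R -> R) : {within `[0, T], continuous f} ->
  {within `[0, T], continuous g} -> {within `[0, T], continuous (fun r => f r - g r)}.
Proof. by move=> cf cg x; apply: cvgB; [exact: cf|exact: cg]. Qed.

Let withinC c : {within `[0, T], continuous (cst c : R -> R)}.
Proof. by apply: withinT => r; exact: cvg_cst. Qed.

Let within_id : {within `[0, T], continuous (@idfun R)}.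
Proof. by apply: withinT => r; exact: cvg_id. Qed.

Let continuous_weight c : continuous (fun r : R => expR (c * r)).
Proof.
move=> r; apply: (continuous_comp (f := *%R c)); last exact: continuous_expR.
exact: mulrl_continuous.
Qed.

Let within_weight c : {within `[0, T], continuous (fun r => expR (c * r))}.
Proof. by apply: withinT; exact: continuous_weight. Qed.

Lemma is_derive_expRM c t : is_derive t (1:R) (fun r => expR (c * r)) (expR (c * t) * c).
Proof.
apply: (is_derive1_comp (f := expR) (g := fun r => c * r)).
have := is_deriveZ (f := id) c (is_derive_id t (1 : R)).
by rewrite /GRing.scale/= mulr1.
Qed.

Lemma is_derive_realM (f g : R -> R) (df dg : R) t :
  is_derive t (1:R) f df -> is_derive t (1:R) g dg ->
  is_derive t (1:R) (fun r => f r * g r) (f t * dg + g t * df).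
Proof. by move=> d1 d2; exact: (is_deriveM (f := f)). Qed.

Lemma is_derive_realD (f g : R -> R) (df dg : R) t :
  is_derive t (1:R) f df -> is_derive t (1:R) g dg ->
  is_derive t (1:R) (fun r => f r + g r) (df + dg).
Proof. by move=> d1 d2; exact: (is_deriveD (f := f)). Qed.

Lemma is_derive_realB (f g : R -> R) (df dg : R) t :
  is_derive t (1:R) f df -> is_derive t (1:R) g dg ->
  is_derive t (1:R) (fun r => f r - g r) (df - dg).
Proof. by move=> d1 d2; exact: (is_deriveB (f := f)). Qed.

Lemma is_derive_realZ c (f : R -> R) (df : R) t :
  is_derive t (1:R) f df -> is_derive t (1:R) (fun r => c * f r) (c * df).
Proof.
move=> d1; have dP := is_derive_realM (is_derive_cst c t (1:R)) d1.
by apply: (is_derive_eq dP); rewrite mulr0 addr0.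
Qed.

Lemma is_derive_realX n (f : R -> R) (df : R) t : is_derive t (1:R) f df ->
  is_derive t (1:R) (fun r => f r ^+ n) (n%:R * f t ^+ n.-1 * df).
Proof.
move=> d1; elim: n => [|n ih]; first by rewrite !mul0r; exact: is_derive_cst.
rewrite (_ : (fun r => _) = (fun r => f r * f r ^+ n)); last first.
  by apply/funext => r; rewrite exprS.
apply: (is_derive_eq (is_derive_realM d1 ih)).
case: n {ih} => [|n]; first by rewrite /=; ring.
rewrite [n.+1.-1]/= [n.+2.-1]/= exprS -[n.+2%:R]natr1; ring.
Qed.

(** A backward Gronwall argument: [expR (- c * t) * X t] is nonincreasing, so nonnegativity at T
    propagates back to time 0. *)
Lemma ge0_of_derive_le c (X dX : R -> R) : {within `[0, T], continuous X} ->
  (forall t, 0 < t < T -> is_derive t (1:R) X (dX t)) ->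
  (forall t, 0 < t < T -> dX t <= c * X t) -> 0 <= X T ->
  forall t, 0 <= t <= T -> 0 <= X t.
Proof.
move=> cX dXE dX0 XT t /andP[t0 tT].
pose Y r := expR (- c * r) * X r.
have YE r : 0 < r < T -> is_derive r (1:R) Y (expR (- c * r) * (dX r - c * X r)).
  move=> rT; have dP := is_derive_realM (is_derive_expRM (- c) r) (dXE r rT).
  by apply: (is_derive_eq dP); ring.
rewrite -(pmulr_rge0 _ (expR_gt0 (- c * t))) -/(Y t).
apply: (@le_trans _ _ (Y T)); first by rewrite mulr_ge0 ?expR_ge0.
apply: (@ler0_derive1_nincr R Y 0 T) => // [x|x|].
- by rewrite in_itv/= => xT; have := YE x xT => -[].
- rewrite in_itv/= => xT; have := YE x xT => ?; rewrite derive1E derive_val.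
  by rewrite mulr_ge0_le0 ?expR_ge0// subr_le0 dX0.
- by rewrite /Y; apply: within_continuousM => //; exact: within_weight.
Qed.

(* [profile_step nu a] is the solution of b' = nu b - a with b(T) = 0. *)
Definition weighted_primitive nu a t : R := \int[leb]_(r in `[0, t]) (expR (- nu * r) * a r).

Definition profile_step nu a t : R :=
  expR (nu * t) * (weighted_primitive nu a T - weighted_primitive nu a t).

Let weighted_continuous nu a : {within `[0, T], continuous a} ->
  {within `[0, T], continuous (fun r => expR (- nu * r) * a r)}.
Proof. by move=> ca; apply: within_continuousM => //; exact: within_weight. Qed.

Lemma profile_step_continuous nu a : {within `[0, T], continuous a} ->
  {within `[0, T], continuous (profile_step nu a)}.
Proof.
move=> ca; have fi := within_continuous_integrable (@weighted_continuous nu a ca).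
have cI := parameterized_integral_continuous (ltW T0) fi.
rewrite /profile_step; apply: within_continuousM; first exact: within_weight.
by apply: within_continuousB; [exact: withinC|exact: cI].
Qed.

Lemma profile_step_derive nu a t : {within `[0, T], continuous a} -> 0 < t < T ->
  is_derive t (1:R) (profile_step nu a) (nu * profile_step nu a t - a t).
Proof.
move=> ca /andP[t0 tT].
have cw := @weighted_continuous nu a ca.
have fi := within_continuous_integrable cw.
have ct : {for t, continuous (fun r => expR (- nu * r) * a r)}.
  move/(continuous_within_itvP _ T0) : cw => [cio _ _].
  by apply: cio; rewrite in_itv/= t0 tT.
have [dI I'] := continuous_FTC1_closed tT fi t0 ct.
have dI' : is_derive t (1:R) (weighted_primitive nu a) (expR (- nu * t) * a t).
  by split; [exact: dI|rewrite -derive1E].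
have dB : is_derive t (1:R) (fun r => weighted_primitive nu a T - weighted_primitive nu a r)
    (0 - expR (- nu * t) * a t).
  exact: (is_deriveB (f := cst (weighted_primitive nu a T))).
have dP := is_derive_realM (is_derive_expRM nu t) dB.
apply: (is_derive_eq dP); rewrite /profile_step.
have e1 : expR (nu * t) * expR (- nu * t) = 1 by rewrite -expRD mulNr subrr expR0.
rewrite -[X in _ = _ - X]mul1r -e1; ring.
Qed.

Lemma profile_step_end nu a : profile_step nu a T = 0.
Proof. by rewrite /profile_step subrr mulr0. Qed.

Lemma profile_step0 a : profile_step 0 a 0 = \int[leb]_(r in `[0, T]) a r.
Proof.
rewrite /profile_step mul0r expR0 mul1r /weighted_primitive set_itv1 Rintegral_set1 subr0.
by apply: eq_Rintegral => r _; rewrite oppr0 mul0r expR0 mul1r.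
Qed.

Fixpoint profile nu f (i : nat) : R -> R :=
  if i is i'.+1 then profile_step nu (profile nu f i') else f.

Variables (nu : R) (f : R -> R).
Hypotheses (nu0 : 0 <= nu) (cf : {within `[0, T], continuous f}).
Hypothesis f0 : forall t, 0 <= t <= T -> 0 <= f t.
Notation a_ := (profile nu f).

Lemma profile_continuous i : {within `[0, T], continuous (a_ i)}.
Proof. by elim: i => //= i ih; exact: profile_step_continuous. Qed.

Lemma profile_derive i t : 0 < t < T ->
  is_derive t (1:R) (a_ i.+1) (nu * a_ i.+1 t - a_ i t).
Proof. by apply: profile_step_derive; exact: profile_continuous. Qed.

Lemma profile_end i : a_ i.+1 T = 0. Proof. exact: profile_step_end. Qed.

Let oc t : 0 < t < T -> 0 <= t <= T.
Proof. by move=> /andP[? ?]; rewrite !ltW. Qed.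

Lemma profile_ge0 i t : 0 <= t <= T -> 0 <= a_ i t.
Proof.
elim: i t => [|i ih] t tT; first exact: f0.
apply: (@ge0_of_derive_le nu (a_ i.+1) (fun r => nu * a_ i.+1 r - a_ i r)).
- exact: (@profile_continuous i.+1).
- exact: profile_derive.
- by move=> r /oc rT; rewrite gerBl ih.
- by rewrite profile_end.
- exact: tT.
Qed.

(** Since nu >= 0, the term with nu only lowers the profiles, which stay below the i-fold backward
    primitives of the constant B. The factorial later beats the powers of the rate. *)
Lemma profile_le B : (forall t, 0 <= t <= T -> f t <= B) ->
  forall i t, 0 <= t <= T -> a_ i t <= B * ((T - t) ^+ i / i`!%:R).
Proof.
move=> fB; elim=> [|i ih] t tT; first by rewrite expr0 fact0 divr1 mulr1 fB.
rewrite -subr_ge0.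
have dp r : is_derive r (1:R) (fun r => B * ((T - r) ^+ i.+1 / i.+1`!%:R))
    (- (B * ((T - r) ^+ i / i`!%:R))).
  have d1 : is_derive r (1:R) (fun r => T - r) (- 1).
    by have := is_deriveB (f := cst T) (is_derive_cst T r (1:R)) (is_derive_id r (1:R)); rewrite sub0r.
  rewrite (_ : (fun r => _) = (fun r => (B / i.+1`!%:R) * (T - r) ^+ i.+1)); last first.
    by apply/funext => z; rewrite mulrA mulrAC.
  apply: (is_derive_eq (is_derive_realZ _ (is_derive_realX i.+1 d1))).
  rewrite /= factS natrM.
  have i0 : i`!%:R != 0 :> R by rewrite pnatr_eq0 -lt0n fact_gt0.
  have i1 : i.+1%:R != 0 :> R by rewrite pnatr_eq0.
  move: i0 i1; move: (i`!%:R) (i.+1%:R) ((T - r) ^+ i) => p q v p0 q0.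
  by field; rewrite p0 q0.
apply: (@ge0_of_derive_le 0 (fun r => B * ((T - r) ^+ i.+1 / i.+1`!%:R) - a_ i.+1 r)
  (fun r => - (B * ((T - r) ^+ i / i`!%:R)) - (nu * a_ i.+1 r - a_ i r))).
- apply: within_continuousB; last exact: (@profile_continuous i.+1).
  apply: withinT => r.
  apply/differentiable_continuous; rewrite -derivable1_diffP.
  by have := dp r => -[].
- by move=> r rT; exact: (is_derive_realB (dp r) (@profile_derive i r rT)).
- move=> r rT; rewrite mul0r opprB addrA addrAC -opprD.
  have := ih r (oc rT); have := mulr_ge0 nu0 (profile_ge0 i.+1 (oc rT)); lra.
- by rewrite subrr expr0n mul0r mulr0 sub0r profile_end oppr0.
- exact: tT.
Qed.

Definition profile_sum (w : nat -> R) m t : R := \sum_(i < m) w i * a_ i.+1 t.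

Lemma profile_sum_continuous w m : {within `[0, T], continuous (profile_sum w m)}.
Proof.
elim: m => [|m ih].
  rewrite (_ : profile_sum _ _ = cst 0); first exact: withinC.
  by apply/funext => t; rewrite /profile_sum big_ord0.
rewrite (_ : profile_sum _ _ = fun t => profile_sum w m t + w m * a_ m.+1 t).
  apply: within_continuousD => //; apply: within_continuousM; first exact: withinC.
  exact: (@profile_continuous m.+1).
by apply/funext => t; rewrite /profile_sum big_ord_recr.
Qed.

Lemma profile_sum_derive w m t : 0 < t < T ->
  is_derive t (1:R) (profile_sum w m) (\sum_(i < m) w i * (nu * a_ i.+1 t - a_ i t)).
Proof.
move=> tT; elim: m => [|m ih].
  rewrite (_ : profile_sum _ _ = cst 0); first by rewrite big_ord0; exact: is_derive_cst.
  by apply/funext => r; rewrite /profile_sum big_ord0.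
rewrite (_ : profile_sum _ _ = fun t => profile_sum w m t + w m * a_ m.+1 t).
  rewrite big_ord_recr/=; exact: (is_derive_realD ih (is_derive_realZ (w m) (@profile_derive m t tT))).
by apply/funext => r; rewrite /profile_sum big_ord_recr.
Qed.

Lemma profile_sum_end w m : profile_sum w m T = 0.
Proof. by rewrite /profile_sum big1// => i _; rewrite profile_end mulr0. Qed.

(** The sum telescopes: D = sum mu^i a_(i+1) satisfies D' = (nu - mu) D - f up to the last
    profile. *)
Lemma profile_sum_powers (mu : R) m t :
  \sum_(i < m) mu ^+ i * (nu * a_ i.+1 t - a_ i t) =
  (nu - mu) * profile_sum (GRing.exp mu) m t - f t + mu ^+ m * a_ m t.
Proof.
elim: m => [|m ih].
  by rewrite /profile_sum !big_ord0 mulr0 expr0 mul1r add0r addNr.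
rewrite big_ord_recr/= ih /profile_sum [in RHS]big_ord_recr/= exprS; ring.
Qed.

(** This is the derivative in mu of [profile_sum_powers]. *)
Lemma profile_sum_dpowers (mu : R) m t :
  \sum_(i < m) (i%:R * mu ^+ i.-1) * (nu * a_ i.+1 t - a_ i t) =
  (nu - mu) * profile_sum (fun i => i%:R * mu ^+ i.-1) m t
  - profile_sum (GRing.exp mu) m t + m%:R * mu ^+ m.-1 * a_ m t.
Proof.
elim: m => [|m ih].
  by rewrite /profile_sum !big_ord0 mulr0 !mul0r subrr addr0.
rewrite big_ord_recr/= ih /profile_sum [in RHS]big_ord_recr/= [in RHS]big_ord_recr/=.
case: m {ih} => [|m]; first by rewrite /= !big_ord0 expr0 /=; ring.
rewrite [m.+1.-1]/= [mu ^+ m.+1]exprS -[m.+2%:R]natr1; ring.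
Qed.

(** At mu = nu the linear term cancels, which bounds the sum by the integral of f over [t, T],
    whatever nu and m are. *)
Lemma profile_sum_le m t : 0 <= t <= T ->
  profile_sum (GRing.exp nu) m t <= profile_step 0 f t.
Proof.
move=> tT; rewrite -subr_ge0.
apply: (@ge0_of_derive_le 0 (fun r => profile_step 0 f r - profile_sum (GRing.exp nu) m r)
  (fun r => (0 * profile_step 0 f r - f r)
    - \sum_(i < m) nu ^+ i * (nu * a_ i.+1 r - a_ i r))).
- apply: within_continuousB; last exact: profile_sum_continuous.
  exact: profile_step_continuous.
- by move=> r rT; apply: is_derive_realB; [exact: profile_step_derive|exact: profile_sum_derive].
- move=> r rT; rewrite profile_sum_powers subrr !mul0r !add0r.
  by rewrite opprD opprK addrA addNr add0r oppr_le0 mulr_ge0 ?exprn_ge0 ?profile_ge0 ?oc.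
- by rewrite profile_step_end profile_sum_end subrr.
- exact: tT.
Qed.

(** Without remainders the system is E' = c E - D, D' = c D - f with zero values at T. Then exp(-c
    r) (E + r D) has derivative -r exp(-c r) f, and integrating it gives E(0). This is the origin of
    the factor t in the barrier. *)
Lemma profile_sum_lower (mu : R) B m : 0 <= mu <= nu ->
  (forall t, 0 <= t <= T -> f t <= B) ->
  \int[leb]_(r in `[0, T]) (r * expR (- (nu - mu) * r) * f r)
    - T * (B * (m%:R * mu ^+ m.-1 + T * mu ^+ m) * (T ^+ m / m`!%:R))
  <= profile_sum (fun i => i%:R * mu ^+ i.-1) m 0.
Proof.
move=> /andP[mu0 munu] fB; set c := nu - mu; set del := B * _ * _.
have c0 : 0 <= c by rewrite subr_ge0.
pose fw r := r * expR (- c * r) * f r.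
have cfw : {within `[0, T], continuous fw}.
  apply: within_continuousM => //; apply: within_continuousM; first exact: within_id.
  exact: within_weight.
set w := (fun i : nat => i%:R * mu ^+ i.-1).
pose E r := profile_sum w m r; pose D r := profile_sum (GRing.exp mu) m r.
(* [profile_step 0 fw] is the integral of [fw] over [r, T]; the linear term, of slope -del, absorbs
   the remainders so that Y is nonincreasing. *)
pose Y r := expR (- c * r) * (E r + r * D r) - profile_step 0 fw r + del * (T - r).
pose dY r := (expR (- c * r) * ((c * E r - D r + m%:R * mu ^+ m.-1 * a_ m r) +
    (r * (c * D r - f r + mu ^+ m * a_ m r) + D r * 1)) +
    (E r + r * D r) * (expR (- c * r) * - c)) - (0 * profile_step 0 fw r - fw r) + del * (0 - 1).
have B0 : 0 <= B by rewrite (le_trans _ (fB 0 _)) ?f0// lexx ltW.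
have am r : 0 <= r <= T -> a_ m r <= B * (T ^+ m / m`!%:R).
  move=> rT; apply: (le_trans (profile_le fB m rT)).
  rewrite ler_wpM2l// ler_wpM2r ?invr_ge0//; case/andP: rT => r0 rT.
  by rewrite lerXn2r ?nnegrE ?subr_ge0 ?(ltW T0)// gerBl.
suff : 0 <= Y 0.
  rewrite /Y mulr0 expR0 mul0r mul1r addr0 subr0 profile_step0 -/(E 0) mulrC; lra.
apply: (@ge0_of_derive_le 0 Y dY).
- rewrite /Y; apply: within_continuousD; first apply: within_continuousB.
  + apply: within_continuousM; first exact: within_weight.
    apply: within_continuousD; first exact: profile_sum_continuous.
    by apply: within_continuousM; [exact: within_id|exact: profile_sum_continuous].
  + exact: profile_step_continuous.
  + apply: within_continuousM; first exact: withinC.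
    by apply: within_continuousB; [exact: withinC|exact: within_id].
- move=> r rT.
  have dE : is_derive r (1:R) E (c * E r - D r + m%:R * mu ^+ m.-1 * a_ m r).
    by apply: (is_derive_eq (profile_sum_derive w m rT)); exact: profile_sum_dpowers.
  have dD : is_derive r (1:R) D (c * D r - f r + mu ^+ m * a_ m r).
    by apply: (is_derive_eq (profile_sum_derive (GRing.exp mu) m rT)); exact: profile_sum_powers.
  rewrite /Y; apply: is_derive_realD; first apply: is_derive_realB.
  + apply: is_derive_realM; first exact: is_derive_expRM.
  + exact: profile_step_derive.
- move=> r rT; have rT' := oc rT; have [r0 rT2] := andP rT'.
  rewrite mul0r /dY /fw.
  have -> : expR (- c * r) * ((c * E r - D r + m%:R * mu ^+ m.-1 * a_ m r) +
    (r * (c * D r - f r + mu ^+ m * a_ m r) + D r * 1)) +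
    (E r + r * D r) * (expR (- c * r) * - c) - (0 * profile_step 0 (fun r => r * expR (- c * r) * f r) r
      - r * expR (- c * r) * f r) + del * (0 - 1)
    = expR (- c * r) * ((m%:R * mu ^+ m.-1 + r * mu ^+ m) * a_ m r) - del by ring.
  rewrite subr_le0 /del.
  have e1 : expR (- c * r) <= 1 by rewrite -expR0 ler_expR mulNr oppr_le0 mulr_ge0.
  have h0 : 0 <= m%:R * mu ^+ m.-1 + r * mu ^+ m by rewrite addr_ge0 ?mulr_ge0 ?exprn_ge0.
  apply: (@le_trans _ _ (1 * ((m%:R * mu ^+ m.-1 + r * mu ^+ m) * a_ m r))).
    by rewrite ler_wpM2r// mulr_ge0// profile_ge0.
  rewrite mul1r -[leRHS]mulrA [leRHS]mulrCA ler_pM ?profile_ge0//; last exact: am.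
  by rewrite lerD2l ler_wpM2r ?exprn_ge0.
- by rewrite /Y /E /D !profile_sum_end profile_step_end; rewrite mulr0 addr0 mulr0 !subrr mulr0 addr0.
- by rewrite lexx ltW.
Qed.

End time_profiles.

(** * Integrals and norms of products on Q_T *)

Section slab.
Context {R : realType} {N : nat}.
Notation mu := (@lebesgue_rV R N).
Notation leb := (@lebesgue_measure R).
Notation tx := (@lebesgue_tx R N).
Variable T : R.
Hypothesis T0 : 0 < T.
Notation Q := (@Qset R N T).
Implicit Types (c : R -> R) (g : 'rV[R]_N -> R).

Lemma QsetE : Q = `]0, T[%classic `*` setT.
Proof. by apply/seteqP; split=> z /=; rewrite in_itv /Qset/=; [move=> ->|case]. Qed.

Lemma measurable_Qset : measurable (Q : set (measurableTypeR R * 'rV[R]_N)).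
Proof. by rewrite QsetE; exact: measurableX. Qed.

Lemma measurable_Q_fst c : measurable_fun (`]0, T[%classic : set (measurableTypeR R)) c ->
  measurable_fun (Q : set (measurableTypeR R * 'rV[R]_N)) (fun z => c z.1).
Proof.
move=> mc; apply: (measurable_comp (F := (`]0, T[%classic : set (measurableTypeR R)))) => //.
  by move=> _ [z zQ <-]; rewrite /= in_itv.
exact: measurable_funTS measurable_fst.
Qed.

Lemma measurable_Q_snd g : measurable_fun setT g ->
  measurable_fun (Q : set (measurableTypeR R * 'rV[R]_N)) (fun z => g z.2).
Proof. by move=> mg; apply: measurable_funTS; exact: measurableT_comp mg measurable_snd. Qed.

Lemma measurable_Q_prod c g : measurable_fun (`]0, T[%classic : set (measurableTypeR R)) c ->
  measurable_fun setT g ->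
  measurable_fun (Q : set (measurableTypeR R * 'rV[R]_N)) (fun z => c z.1 * g z.2).
Proof.
by move=> mc mg; apply: measurable_funM; [exact: measurable_Q_fst|exact: measurable_Q_snd].
Qed.

Lemma integral_Q_prod c g : measurable_fun (`]0, T[%classic : set (measurableTypeR R)) c ->
  (forall t, 0 < t < T -> 0 <= c t) -> measurable_fun setT g -> (forall x, 0 <= g x) ->
  (\int[tx]_(z in Q) (c z.1 * g z.2)%:E =
   (\int[leb]_(t in `]0%R, T[) (c t)%:E) * (\int[mu]_x (g x)%:E))%E.
Proof.
move=> mc c0 mg g0.
have mQ := measurable_Qset.
have mD : measurable (`]0, T[%classic : set (measurableTypeR R)) by [].
pose c' : measurableTypeR R -> R := c \_ `]0, T[%classic.
have mc' : measurable_fun setT c' by apply/(measurable_restrictT c).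
have c'0 t : 0 <= c' t.
  by rewrite /c' /patch; case: ifPn => // /set_mem/=; rewrite in_itv/= => /c0.
rewrite integral_mkcond.
have -> : ((fun z => (c z.1 * g z.2)%:E) \_ Q) = (fun z => (c' z.1 * g z.2)%:E).
  apply/funext => z; rewrite /c' /patch.
  have [zQ|zQ] := boolP (z \in Q).
    by rewrite mem_set//=; move/set_mem : zQ; rewrite QsetE => -[].
  rewrite memNset ?mul0r//= in_itv/=; move/negP : zQ; apply: contra_not => zQ.
  by rewrite inE.
have mF : measurable_fun [set: measurableTypeR R * 'rV[R]_N] (fun z => (c' z.1 * g z.2)%:E).
  apply/measurable_EFinP; apply: measurable_funM.
    exact: measurableT_comp mc' measurable_fst.
  exact: measurableT_comp mg measurable_snd.
have F0 (z : measurableTypeR R * 'rV[R]_N) : (0 <= (c' z.1 * g z.2)%:E)%E.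
  by rewrite lee_fin mulr_ge0.
rewrite (fubini_tonelli1 (m1 := leb) (m2 := mu) _ mF F0) /fubini_F/=.
transitivity (\int[leb]_t ((c' t)%:E * \int[mu]_x (g x)%:E))%E.
  apply: eq_integral => t _.
  under eq_integral do rewrite EFinM.
  rewrite ge0_integralZl_EFin//; first by move=> x _; rewrite lee_fin.
  exact/measurable_EFinP.
rewrite ge0_integralZr//; last 3 first.
- exact/measurable_EFinP.
- by move=> t _; rewrite lee_fin.
- by apply: integral_ge0 => x _; rewrite lee_fin.
by rewrite [in RHS]integral_mkcond restrict_EFin.
Qed.

Lemma integrable_Q_prod c g B : measurable_fun (`]0, T[%classic : set (measurableTypeR R)) c ->
  (forall t, 0 < t < T -> `|c t| <= B) -> mu.-integrable setT (EFin \o g) ->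
  tx.-integrable Q (EFin \o (fun z => c z.1 * g z.2)).
Proof.
move=> mc cB gi; have mg := integrable_measurable gi.
have B0 : 0 <= B.
  have := cB (T / 2); rewrite divr_gt0//= ltr_pdivrMr// mulr_natr mulr2n ltrDl T0.
  by move=> /(_ isT); apply: le_trans.
apply: (@integrable_le _ _ _ _ _ measurable_Qset _ (fun z => B * `|g z.2|)).
- exact: measurable_Q_prod.
- apply/integrableP; split.
    apply/measurable_EFinP; apply: (measurable_Q_prod (c := cst B) (g := fun x => `|g x|)) => //.
    exact: measurableT_comp.
  under eq_integral do rewrite /= ger0_norm ?mulr_ge0//.
  rewrite (integral_Q_prod (c := cst B) (g := fun x => `|g x|))//; last exact: measurableT_comp.
  have /integrableP[_ gi'] := gi.
  have -> : (\int[leb]_(t in `]0%R, T[) (cst B t)%:E = (B * (T - 0))%:E)%E.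
    transitivity (\int[leb]_(t in `]0%R, T[) cst B%:E t)%E; first by [].
    have lI : leb (`]0, T[%classic : set R) = (T - 0)%:E.
      by rewrite lebesgue_measure_itv/= lte_fin T0.
    by rewrite integral_cst// EFinM -lI.
  by rewrite lte_mul_pinfty// lee_fin mulr_ge0 ?subr_ge0// ltW.
- move=> z; rewrite /Qset/= => zT; rewrite normrM ler_wpM2r// cB//.
Qed.

Lemma LnormQ_pinfty_le (f : R * 'rV[R]_N -> R) B : 0 <= B ->
  (forall z, Q z -> `|f z| <= B) -> (LnormQ T +oo f <= B%:E)%E.
Proof.
(* The essential norm is defined by cases on whether the space has positive measure, with value 0
   otherwise. *)
move=> B0 fB; rewrite /LnormQ unlock /Lnorm; case: ifPn => _; last by rewrite lee_fin.
apply/ess_supP; apply: nearW => z /=; rewrite /patch; case: ifPn => [/set_mem zQ|_].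
  by rewrite /= lee_fin fB.
by rewrite abse0 lee_fin.
Qed.

Lemma LnormQ_1 (f : R * 'rV[R]_N -> R) :
  LnormQ T 1 f = (\int[tx]_(z in Q) `|(f z)%:E|)%E.
Proof.
rewrite /LnormQ Lnorm1 [RHS]integral_mkcond; apply: eq_integral => z _.
by rewrite /patch; case: ifPn => //=; rewrite normr0.
Qed.

End slab.

(** * Finite sums of products as test functions *)

Section separable.
Context {R : realType} {N : nat} (alpha : R).
Hypothesis halpha : 0 < alpha < 1.
Notation mu := (@lebesgue_rV R N).
Notation tx := (@lebesgue_tx R N).
Notation Q T := (@Qset R N T).
Implicit Types (c dc : nat -> R -> R) (G : nat -> 'rV[R]_N -> R).

Definition separable c G m (z : R * 'rV[R]_N) : R := \sum_(i < m) c i z.1 * G i z.2.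

Lemma separable0 c G : separable c G 0 = cst 0.
Proof. by apply/funext => z; rewrite /separable big_ord0. Qed.

Lemma separableS c G m :
  separable c G m.+1 = fun z => separable c G m z + c m z.1 * G m z.2.
Proof. by apply/funext => z; rewrite /separable big_ord_recr. Qed.

Lemma separable_ge0 c G m z : (forall i, 0 <= c i z.1) -> (forall i x, 0 <= G i x) ->
  0 <= separable c G m z.
Proof. by move=> c0 G0; apply: sumr_ge0 => i _; rewrite mulr_ge0. Qed.

Lemma within_continuous_measurable T (a : R -> R) : {within `[0, T], continuous a} ->
  measurable_fun (`]0, T[%classic : set (measurableTypeR R)) a.
Proof.
move=> ca; apply: (@measurable_funS _ _ _ _ (`[0, T]%classic : set (measurableTypeR R))) => //.
  exact: subset_itv_oo_cc.
exact: subspace_continuous_measurable_fun.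
Qed.

Section fixed_time_interval.
Variables (T : R) (c dc : nat -> R -> R) (G : nat -> 'rV[R]_N -> R) (B M : nat -> R).
Hypotheses (T0 : 0 < T) (hc : forall i, {within `[0, T], continuous (c i)}).
Hypothesis hdc : forall i, {within `[0, T], continuous (dc i)}.
Hypothesis hd : forall i t, 0 < t < T -> is_derive t (1:R) (c i) (dc i t).
Hypotheses (M0 : forall i, 0 <= M i) (hG : forall i, density (B i) (M i) (G i)).

Let mG i : measurable_fun setT (G i).
Proof. by case: (hG i) => -[]. Qed.

Let GB i x : `|G i x| <= B i.
Proof. by case: (hG i) => -[]. Qed.

(** Bounds and linearity go through the same induction, because additivity of [levy_op] needs the
    bounds of the partial sum. *)
Lemma separable_sdiff m t : exists B' M', [/\ 0 <= M',
  sdiff_bounded B' M' (fun x => separable c G m (t, x)) &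
  forall x, levy_op (frac_kernel alpha) (fun x => separable c G m (t, x)) x =
    separable c (fun i => levy_op (frac_kernel alpha) (G i)) m (t, x)].
Proof.
elim: m => [|m [B' [M' [M'0 sb lE]]]].
  exists 0, 0; rewrite !separable0; split=> //.
    split=> [|x|x y]; first exact: measurable_cst.
      by rewrite normr0.
    by rewrite /sdiff mulr0 !subrr normr0 mul0r.
  move=> x; rewrite /levy_op; under eq_Rintegral do rewrite /sdiff mulr0 !subrr mulr0.
  by rewrite Rintegral_cst// mul0r mulr0.
exists (B' + `|c m t| * B m), (M' + `|c m t| * M m).
have gz := sdiff_boundedZ (c m t) (density_sdiff (hG m)).
have gM : 0 <= `|c m t| * M m by rewrite mulr_ge0.
rewrite !separableS; split.
- by rewrite addr_ge0.
- exact: sdiff_boundedD sb gz.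
- move=> x; rewrite -lE.
  rewrite (levy_opD halpha x (@frac_kernel_levy R N alpha) M'0 sb gM gz).
  by rewrite (levy_opZ halpha (c m t) x (@frac_kernel_levy R N alpha) (M0 m) (density_sdiff (hG m))).
Qed.

Lemma frac_lap_separable m z :
  frac_lap_tx alpha (separable c G m) z =
  separable c (fun i => levy_op (frac_kernel alpha) (G i)) m z.
Proof.
case: z => t x; have [B' [M' [M'0 sb lE]]] := separable_sdiff m t.
by rewrite /frac_lap_tx (frac_lapE halpha x M'0 sb) lE.
Qed.

Lemma separable_derive m t x : 0 < t < T ->
  is_derive t (1:R) (fun s => separable c G m (s, x)) (separable dc G m (t, x)).
Proof.
move=> tT; elim: m => [|m ih]; first by rewrite !separable0; exact: is_derive_cst.
rewrite !separableS; apply: (is_derive_realD ih).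
rewrite mulrC (_ : (fun s => _) = (fun s => G m x * c m s)); last first.
  by apply/funext => s; rewrite mulrC.
exact: is_derive_realZ (hd m tT).
Qed.

Lemma dt_separable m z : Q T z -> dt (separable c G m) z = separable dc G m z.
Proof.
case: z => t x /= tT; have := @separable_derive m t x tT => ?.
by rewrite /dt derive1E derive_val.
Qed.

Lemma separable_continuous_time m x :
  {within `[0, T], continuous (fun t => separable c G m (t, x))}.
Proof.
elim: m => [|m ih].
  by rewrite separable0; apply: continuous_subspaceT => r; exact: cvg_cst.
rewrite separableS; apply: within_continuousD; first exact: ih.
apply: within_continuousM; first exact: hc.
have h : {within `[0, T], continuous (cst (G m x) : R -> R)}.
  by apply: continuous_subspaceT => r; exact: cvg_cst.
exact: h.
Qed.

End fixed_time_interval.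

Lemma separable_bounded T m c G : (forall i, {within `[0, T], continuous (c i)}) ->
  (forall i, exists B, forall x, `|G i x| <= B) ->
  exists2 B, 0 <= B & forall z, Q T z -> `|separable c G m z| <= B.
Proof.
move=> hc hG; elim: m => [|m [B B0 ih]].
  by exists 0 => // z _; rewrite separable0 normr0.
have [C C0 hC] := within_continuous_bounded (hc m); have [D hD] := hG m.
have D0 : 0 <= D := le_trans (normr_ge0 _) (hD 0).
exists (B + C * D) => [|z zQ]; first by rewrite addr_ge0 ?mulr_ge0.
rewrite separableS (le_trans (ler_normD _ _))// lerD ?ih// normrM ler_pM//.
by apply: hC; move: zQ; rewrite /Qset/= => /andP[? ?]; rewrite !ltW.
Qed.

Lemma measurable_separable T m c G : (forall i, {within `[0, T], continuous (c i)}) ->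
  (forall i, measurable_fun setT (G i)) ->
  measurable_fun (Q T : set (measurableTypeR R * 'rV[R]_N)) (separable c G m).
Proof.
move=> hc hG; apply: measurable_sum => i; apply: measurable_Q_prod => //.
exact: within_continuous_measurable.
Qed.

Lemma separable_integrable T m c G : 0 < T -> (forall i, {within `[0, T], continuous (c i)}) ->
  (forall i, mu.-integrable setT (EFin \o G i)) ->
  tx.-integrable (Q T) (EFin \o separable c G m).
Proof.
move=> T0 hc hG; apply: (integrable_real_sum (@measurable_Qset R N T) _
  (f := fun (i : 'I_m) z => c i z.1 * G i z.2)) => i.
have [C C0 hC] := within_continuous_bounded (hc i).
apply: (integrable_Q_prod T0 (B := C)) => //; first exact: within_continuous_measurable.
by move=> t /andP[? ?]; rewrite hC// !ltW.
Qed.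

Lemma separable_test_space T m c dc G B M : 0 < T ->
  (forall i, {within `[0, T], continuous (c i)}) ->
  (forall i, {within `[0, T], continuous (dc i)}) ->
  (forall i t, 0 < t < T -> is_derive t (1:R) (c i) (dc i t)) ->
  (forall i, 0 <= M i) -> (forall i, density (B i) (M i) (G i)) ->
  test_space alpha T (separable c G m).
Proof.
move=> T0 hc hdc hd M0 hG.
have hGB i : exists B', forall x, `|G i x| <= B'.
  by exists (B i) => x; case: (hG i) => -[].
have hLB i : exists B', forall x, `|levy_op (frac_kernel alpha) (G i) x| <= B'.
  eexists => x; exact: (levy_op_le halpha x (@frac_kernel_levy R N alpha) (M0 i) (density_sdiff (hG i))).
split.
- by apply: measurable_separable => // i; case: (hG i) => -[].
- by move=> x; apply: separable_continuous_time.
- by move=> t x tT; have := @separable_derive T c dc G hd m t x tT => -[].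
- move=> t x tT; have [B' [M' [M'0 sb _]]] := separable_sdiff c M0 hG m t.
  exact: (has_frac_lap_sdiff halpha _ M'0 sb).
- have [C1 C10 h1] := separable_bounded m hc hGB.
  have [C2 C20 h2] := separable_bounded m hdc hGB.
  have [C3 C30 h3] := separable_bounded m hc hLB.
  rewrite !lte_add_pinfty//.
  + rewrite LnormQ_1.
    have hGi i : mu.-integrable setT (EFin \o G i) by case: (hG i).
    by have /integrableP[_] := separable_integrable m T0 hc hGi.
  + by apply: (le_lt_trans (LnormQ_pinfty_le C10 h1)); exact: ltry.
  + apply: (@le_lt_trans _ _ C2%:E); last exact: ltry.
    by apply: LnormQ_pinfty_le => // z zQ; rewrite (@dt_separable T c dc G hd m z zQ) h2.
  + apply: (@le_lt_trans _ _ C3%:E); last exact: ltry.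
    by apply: LnormQ_pinfty_le => // z zQ; rewrite (frac_lap_separable c M0 hG) h3.
- move=> t tT; have [B' [M' [M'0 sb _]]] := separable_sdiff c M0 hG m t.
  have [msb bsb _] := sb.
  have B'0 : 0 <= B' := le_trans (normr_ge0 _) (bsb 0).
  (* [levy_op_le] is uniform over all truncation radii, so any eps0 would do; the added 1 makes the
     bound strictly positive. *)
  exists ((4 * B' + M') * @levy_mass R N alpha + 1), 1; split => //.
    by rewrite ltr_wpDl// mulr_ge0 ?levy_mass_ge0// addr_ge0// mulr_ge0.
  move=> e /andP[e0 _].
  rewrite unlock /Lnorm; case: ifPn => _; last first.
    by rewrite lee_fin addr_ge0// mulr_ge0 ?levy_mass_ge0// addr_ge0// mulr_ge0.
  apply/ess_supP; apply: nearW => x /=.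
  rewrite (frac_lap_epsE halpha x e0 msb bsb) /= lee_fin.
  rewrite (le_trans (levy_op_le halpha x (@trunc_kernel_levy R N alpha e) M'0 sb))//.
  by rewrite lerDl.
Qed.

End separable.

(** * The time weight that pays for the absorption *)

Section absorption_factor.
Context {R : realType} (beta : R).
Hypothesis hbeta : -1 < beta.
Notation leb := (@lebesgue_measure R).
Implicit Types (t del T : R).

(* [(absorb_factor del)' >= t^beta absorb_factor del] for t >= del, which is what
   pays for the absorption term; the shift by del keeps it differentiable up to
   t = 0 when beta < 0. *)
Definition absorb_const : R := Num.max 1 (2 `^ (- beta)).

Definition absorb_factor del t : R :=
  expR (absorb_const / (1 + beta) * (t + del) `^ (1 + beta)).

Definition absorb_dfactor del t : R :=
  absorb_const * (t + del) `^ beta * absorb_factor del t.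

Let b1 : 0 < 1 + beta. Proof. by rewrite -ltrBlDl sub0r. Qed.

Lemma absorb_const_ge1 : 1 <= absorb_const.
Proof. by rewrite /absorb_const le_max lexx. Qed.

Lemma is_derive_powR_shift (r del t : R) : 0 < t + del ->
  is_derive t (1:R) (fun v => (v + del) `^ r) (r * (t + del) `^ (r - 1)).
Proof.
move=> td.
have d1 : is_derive t (1:R) (fun v => v + del) (1 + 0).
  exact: is_derive_realD (is_derive_id t (1:R)) (is_derive_cst del t (1:R)).
have d2 := @is_derive1_powR R r (t + del) td.
have := @is_derive1_comp R (fun v => v `^ r) (fun v => v + del) t _ _ d2 d1.
by rewrite addr0 mulr1.
Qed.

Lemma absorb_factor_derive del t : 0 < t + del ->
  is_derive t (1:R) (absorb_factor del) (absorb_dfactor del t).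
Proof.
move=> td.
have d1 := is_derive_realZ (absorb_const / (1 + beta)) (is_derive_powR_shift (1 + beta) td).
have d2 := is_derive1_comp (is_derive_expR _) d1.
apply: (is_derive_eq d2); rewrite /absorb_dfactor /absorb_factor.
rewrite (_ : 1 + beta - 1 = beta); last by ring.
rewrite mulrC; congr (_ * _); rewrite mulrA mulfVK//; exact: lt0r_neq0.
Qed.

Lemma absorb_factor_within del T : 0 < del -> {within `[0, T], continuous (absorb_factor del)}.
Proof.
move=> d0; apply: derivable_within_continuous => t; rewrite in_itv/= => /andP[t0 _].
have td : 0 < t + del by rewrite ltr_wpDl.
by have := absorb_factor_derive td => -[].
Qed.

Lemma absorb_dfactor_within del T : 0 < del -> {within `[0, T], continuous (absorb_dfactor del)}.
Proof.
move=> d0; apply: within_continuousM; last exact: absorb_factor_within.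
apply: within_continuousM.
  by apply: continuous_subspaceT => r; exact: cvg_cst.
apply: derivable_within_continuous => t; rewrite in_itv/= => /andP[t0 _].
have td : 0 < t + del by rewrite ltr_wpDl.
by have := is_derive_powR_shift beta td => -[].
Qed.

Let exponent_ge0 del t : 0 <= absorb_const / (1 + beta) * (t + del) `^ (1 + beta).
Proof.
rewrite mulr_ge0 ?powR_ge0// divr_ge0 ?(ltW b1)//.
exact: le_trans ler01 absorb_const_ge1.
Qed.

Lemma absorb_factor_ge1 del t : 1 <= absorb_factor del t.
Proof. by rewrite -expR0 ler_expR exponent_ge0. Qed.

(** The bound is free of del, so the constants survive the choice of a small del. *)
Lemma absorb_factor_le del t T : 0 < del <= 1 -> 0 <= t <= T ->
  absorb_factor del t <= absorb_factor 1 T.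
Proof.
move=> /andP[d0 d1] /andP[t0 tT]; rewrite ler_expR ler_wpM2l//.
  rewrite divr_ge0 ?ltW//; exact: lt_le_trans ltr01 absorb_const_ge1.
apply: ge0_ler_powR; first exact: ltW.
- by rewrite nnegrE addr_ge0// ltW.
- by rewrite nnegrE addr_ge0// (le_trans t0).
- exact: lerD.
Qed.

(** From t <= t + del <= 2 t: the power is increasing for beta >= 0, and for beta < 0 it drops by at
    most the factor 2^beta. *)
Lemma absorb_powR del t : 0 < del -> del <= t ->
  t `^ beta <= absorb_const * (t + del) `^ beta.
Proof.
move=> d0 dt; have t0 : 0 < t := lt_le_trans d0 dt.
have td : 0 < t + del by rewrite addr_gt0.
have [be0|be0] := leP 0 beta.
  apply: (@le_trans _ _ (1 * (t + del) `^ beta)).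
    by rewrite mul1r ge0_ler_powR ?nnegrE ?(ltW t0) ?(ltW td)// lerDl ltW.
  by rewrite ler_wpM2r ?powR_ge0// absorb_const_ge1.
apply: (@le_trans _ _ (2 `^ (- beta) * (t + del) `^ beta)); last first.
  by rewrite ler_wpM2r ?powR_ge0// /absorb_const le_max lexx orbT.
have -> : t `^ beta = 2 `^ (- beta) * (2 * t) `^ beta.
  rewrite powRM ?(ltW t0)// mulrA -powRD; last by rewrite pnatr_eq0 implybT.
  by rewrite addNr powRr0 mul1r.
rewrite ler_wpM2l ?powR_ge0//.
rewrite -[beta]opprK !(powRN _ (- beta)) lef_pV2 ?posrE ?powR_gt0 ?mulr_gt0//.
apply: ge0_ler_powR; first by rewrite oppr_ge0 ltW.
- by rewrite nnegrE ltW.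
- by rewrite nnegrE mulr_ge0// ltW.
- lra.
Qed.

Definition tail_weight del t : R := (del <= t)%R%:R * t `^ beta.

Lemma tail_weight_ge0 del t : 0 <= tail_weight del t.
Proof. by rewrite mulr_ge0 ?powR_ge0. Qed.

Lemma measurable_tail_weight del : measurable_fun [set: measurableTypeR R] (tail_weight del).
Proof.
apply: measurable_funM; last exact: measurable_powR.
rewrite (_ : (fun _ => _) = \1_(`[del, +oo[%classic : set R)).
  exact: measurable_indic.
apply/funext => t; rewrite indicE; case: leP => h; first by rewrite mem_set//= in_itv/= h.
by rewrite memNset//= in_itv/= andbT leNgt h.
Qed.

Lemma tail_weight_integral del T : 0 < del -> del < T ->
  (\int[leb]_(t in `]0%R, T[) (tail_weight del t)%:E <= (T `^ (1 + beta) / (1 + beta))%:E)%E.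
Proof.
move=> d0 dT.
have mw := measurable_tail_weight del.
have cp : {within `[del, T], continuous (fun t => t `^ beta)}.
  apply: derivable_within_continuous => t; rewrite in_itv/= => /andP[t0 _].
  apply: derivable_powR; rewrite in_itv/= andbT; exact: lt_le_trans t0.
apply: (@le_trans _ _ (\int[leb]_(t in `[del, T]) (t `^ beta)%:E)%E).
  rewrite integral_mkcond [leRHS]integral_mkcond; apply: ge0_le_integral => //.
  - by move=> t _; rewrite /patch; case: ifPn => // _; rewrite lee_fin tail_weight_ge0.
  - apply/(measurable_restrictT _ _).1 => //; apply: measurable_funTS; exact/measurable_EFinP.
  - apply/(measurable_restrictT _ _).1 => //; apply: measurable_funTS; apply/measurable_EFinP.
    exact: measurable_powR.
  - move=> t _; rewrite /patch; case: ifPn => [|_]; last first.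
      by case: ifPn => // _; rewrite lee_fin powR_ge0.
    move=> /set_mem/=; rewrite in_itv/= => /andP[t0 tT].
    rewrite /tail_weight; have [dt|dt] := leP del t.
      by rewrite mem_set/= ?in_itv/= ?dt ?(ltW tT)// mul1r.
    by rewrite mul0r; case: ifPn => // _; rewrite lee_fin powR_ge0.
pose F t := t `^ (1 + beta) / (1 + beta).
have dF t : 0 < t -> is_derive t (1:R) F (t `^ beta).
  move=> t0; have d1 := is_derive_realZ (1 + beta)^-1 (@is_derive1_powR R (1 + beta) t t0).
  rewrite /F (_ : (fun t => _) = (fun t => (1 + beta)^-1 * t `^ (1 + beta))).
    apply: (is_derive_eq d1); rewrite mulrA mulVf ?lt0r_neq0// mul1r; congr (_ `^ _); ring.
  by apply/funext => v; rewrite mulrC.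
have cF : derivable_oo_LRcontinuous F del T.
  have : {within `[del, T], continuous F}.
    apply: derivable_within_continuous => t; rewrite in_itv/= => /andP[t0 _].
    by have := dF t (lt_le_trans d0 t0) => -[].
  move=> /(continuous_within_itvP _ dT)[_ h1 h2]; split => //.
  move=> t; rewrite in_itv/= => /andP[t0 _].
  by have := dF t (lt_trans d0 t0) => -[].
rewrite (continuous_FTC2 dT cp cF); last first.
  move=> t; rewrite in_itv/= => /andP[t0 _].
  by have := dF t (lt_trans d0 t0) => ?; rewrite derive1E derive_val.
by rewrite -EFinB lee_fin /F gerBl divr_ge0 ?powR_ge0// ltW.
Qed.

End absorption_factor.

Lemma measurable_lt_fun {R : realType} (del : R) :
  measurable_fun setT (fun t : measurableTypeR R => (t < del)%R%:R : R).
Proof.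
rewrite (_ : (fun _ => _) = \1_(`]-oo, del[%classic : set R)); first exact: measurable_indic.
apply/funext => t; rewrite indicE; case: ltP => tdel; first by rewrite mem_set//= in_itv/= tdel.
by rewrite memNset//= in_itv/= ltNge tdel.
Qed.

(** * The duality estimate for one weak solution and one product f g *)

Section main_estimate.
Context {R : realType} {N : nat} (alpha beta p k T : R) (u : R * 'rV[R]_N -> R).
Hypotheses (halpha : 0 < alpha < 1) (hbeta : -1 < beta) (hp : 0 < p <= 1).
Hypotheses (hk : 0 < k) (hu : weak_solution alpha beta p k u) (T0 : 0 < T).
Notation mu := (@lebesgue_rV R N).
Notation leb := (@lebesgue_measure R).
Notation tx := (@lebesgue_tx R N).
Notation Q := (@Qset R N T).
Notation space_time := (measurableTypeR R * 'rV[R]_N)%type.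
Variables (f : R -> R) (g : 'rV[R]_N -> R) (Bf Bg Mg : R).
Hypotheses (cf : {within `[0, T], continuous f}).
Hypotheses (f0 : forall t, 0 <= t <= T -> 0 <= f t).
Hypotheses (fB : forall t, 0 <= t <= T -> f t <= Bf).
Hypotheses (Mg0 : 0 <= Mg) (gd : density Bg Mg g).

(** The weight need not pay for the absorption at times below del. That part is made small instead
    through integrability of t^beta u^p, with del depending on u. *)
Definition early_absorption (del : R) : R :=
  \int[tx]_(z in Q) ((z.1 < del)%R%:R * (z.1 `^ beta * u z `^ p)).

Section fixed_parameters.
Variables (e del : R) (m : nat).
Hypotheses (he : 0 < e <= 1) (hdel : 0 < del <= 1) (delT : del < T).

Let e0 : 0 < e. Proof. by case/andP: he. Qed.
Let e1 : e <= 1. Proof. by case/andP: he. Qed.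
Let del0 : 0 < del. Proof. by case/andP: hdel. Qed.

Let nu : R := @total_rate R N alpha e.
Let nu0 : 0 <= nu. Proof. exact: total_rate_ge0. Qed.
Let a : nat -> R -> R := profile T nu f.
Let G (i : nat) : 'rV[R]_N -> R := iterate alpha e i g.
Let h : R -> R := absorb_factor beta del.
Let dh : R -> R := absorb_dfactor beta del.
Let H : R := absorb_factor beta 1 T.
Let c (i : nat) (t : R) : R := h t * a i.+1 t.
Let dc (i : nat) (t : R) : R := h t * (nu * a i.+1 t - a i t) + a i.+1 t * dh t.
Let LG (i : nat) : 'rV[R]_N -> R := levy_op (frac_kernel alpha) (G i).
Let EG (i : nat) (x : 'rV[R]_N) : R := LG i x - levy_op (reg_kernel alpha e) (G i) x.
Let a1 (i : nat) : R -> R := a i.+1.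
Let zeta := separable a1 G m.
Let xi := separable c G m.
Let err := separable a1 EG m.
Let Phi0 : R := \int[leb]_(r in `[0, T]) f r.
Let om : R := @near_mass R N alpha e.

Let Gd i : density (nu ^+ i * Bg) (nu ^+ i * Mg) (G i).
Proof. exact: iterate_density. Qed.

Let M0 i : 0 <= nu ^+ i * Mg.
Proof. by rewrite mulr_ge0 ?exprn_ge0. Qed.

Let ac i : {within `[0, T], continuous (a i)}.
Proof. exact: profile_continuous. Qed.

Let cc i : {within `[0, T], continuous (c i)}.
Proof.
by rewrite /c; apply: within_continuousM; [exact: absorb_factor_within|exact: ac].
Qed.

Let dcc i : {within `[0, T], continuous (dc i)}.
Proof.
rewrite /dc; apply: within_continuousD; apply: within_continuousM.
- exact: absorb_factor_within.
- apply: within_continuousB; last exact: ac.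
  apply: within_continuousM; last exact: ac.
  by apply: continuous_subspaceT => r; exact: cvg_cst.
- exact: ac.
- exact: absorb_dfactor_within.
Qed.

Let cd i t : 0 < t < T -> is_derive t (1:R) (c i) (dc i t).
Proof.
move=> tT; apply: is_derive_realM.
  by apply: absorb_factor_derive => //; case/andP: tT => t0 _; rewrite addr_gt0.
exact: profile_derive.
Qed.

Let oc t : 0 < t < T -> 0 <= t <= T.
Proof. by move=> /andP[? ?]; rewrite !ltW. Qed.

Let a_ge0 i t : 0 < t < T -> 0 <= a i t.
Proof. by move=> tT; apply: profile_ge0 => //; exact: oc. Qed.

Let Phi0_ge0 : 0 <= Phi0.
Proof. by apply: Rintegral_ge0 => t /=; rewrite in_itv/=; exact: f0. Qed.

Let sum_le t : 0 < t < T -> \sum_(i < m) nu ^+ i * a1 i t <= Phi0.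
Proof.
move=> tT; apply: (le_trans (profile_sum_le T0 nu0 cf f0 m (oc tT))).
rewrite /profile_step mul0r expR0 mul1r /weighted_primitive /Phi0.
have -> : \int[leb]_(r in `[0, T]) (expR (- 0 * r) * f r) = \int[leb]_(r in `[0, T]) f r.
  by apply: eq_Rintegral => r _; rewrite oppr0 mul0r expR0 mul1r.
rewrite gerBl; apply: Rintegral_ge0 => r /=; rewrite in_itv/= => /andP[r0 rt].
rewrite mulr_ge0 ?expR_ge0// f0// r0 (le_trans rt)//; case/andP: tT => _ /ltW//.
Qed.

Let zeta_ge0 z : Q z -> 0 <= zeta z.
Proof.
move=> zQ; apply: separable_ge0 => [i|i x]; first exact: a_ge0.
exact: density_ge0 (Gd i) x.
Qed.

Let Bg0 : 0 <= Bg.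
Proof. by have [[_ gB _] _ _] := gd; exact: le_trans (normr_ge0 _) (gB 0). Qed.

Let zeta_le z : Q z -> zeta z <= Bg * Phi0.
Proof.
move=> zQ; apply: (@le_trans _ _ (\sum_(i < m) Bg * (nu ^+ i * a1 i z.1))).
  apply: ler_sum => i _; rewrite mulrCA mulrA mulrC ler_wpM2r ?a_ge0//.
  have [[_ gB _] _ _] := Gd i; exact: le_trans (ler_norm _) (gB z.2).
by rewrite -mulr_sumr ler_wpM2l// sum_le.
Qed.

Let err_le z : Q z -> err z <= Phi0 * (Mg * om).
Proof.
move=> zQ; apply: (@le_trans _ _ (\sum_(i < m) (nu ^+ i * a1 i z.1) * (Mg * om))).
  rewrite /err /separable; apply: ler_sum => i _.
  rewrite (_ : _ * _ * _ = a1 i z.1 * (nu ^+ i * Mg * om)); last by ring.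
  apply: ler_wpM2l; first exact: a_ge0.
  apply: (le_trans (ler_norm _)).
  apply: (levy_op_dist halpha z.2 _ _ e1 (M0 i) (density_sdiff (Gd i))).
  - exact: frac_kernel_levy.
  - exact: reg_kernel_levy.
  - by move=> y; exact: frac_reg_dist.
rewrite -mulr_suml ler_wpM2r ?sum_le// mulr_ge0//.
by apply: Rintegral_ge0 => y _; exact: near_weight_ge0.
Qed.

(* The time profiles and the iterates telescope: up to the kernel error [err],
   [separable a1 G m] is a subsolution of the backward equation with source f g. *)
Let residual z : - separable dc G m z + separable c LG m z =
  h z.1 * (f z.1 * g z.2 - a m z.1 * G m z.2 + err z)
  - absorb_const beta * (z.1 + del) `^ beta * (h z.1 * zeta z).
Proof.
rewrite /err /zeta; elim: m => [|n ih].
  rewrite !separable0 /= /a /G /=; ring.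
have Gn : G n.+1 z.2 = nu * G n z.2 - levy_op (reg_kernel alpha e) (G n) z.2.
  by rewrite -(total_rate_levy_op halpha he z.2 (density_sdiff (Gd n))) subKr.
rewrite !separableS Gn /EG /dc /c /dh /absorb_dfactor -/(h _) /a1.
move: ih; set s1 := separable dc G n z; set s2 := separable c LG n z => ih.
have -> : forall s3 s4 : R, - (s1 + s3) + (s2 + s4) = (- s1 + s2) + (s4 - s3) by move=> *; ring.
rewrite ih; ring.
Qed.

Let h_ge1 t : 1 <= h t. Proof. exact: absorb_factor_ge1. Qed.

Let h_leH t : 0 < t < T -> h t <= H.
Proof. by move=> /oc tT; apply: absorb_factor_le. Qed.

Let u_ge0 z : Q z -> 0 <= u z.
Proof. by move=> /andP[z0 _]; apply: (weak_ge0 hu). Qed.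

(* The only place where p <= 1 enters. *)
Let powR_le1D (v : R) : 0 <= v -> v `^ p <= v + 1.
Proof.
move=> v0; case/andP: hp => p0 p1; have [v1|v1] := leP 1 v.
  by rewrite (le_trans (ler1_powR v1 p1))// lerDl.
apply: (@le_trans _ _ (1 `^ p)); last by rewrite powR1 lerDr.
by apply: ge0_ler_powR; rewrite ?nnegrE//; exact: ltW.
Qed.

Let integrand z := u z * (- separable dc G m z + separable c LG m z)
  + z.1 `^ beta * u z `^ p * xi z.

(** In order: the source, the kernel error, the additive 1 of u^p <= u + 1 at times t >= del, and
    the whole absorption at times t < del. *)
Let bound z := H * (u z * (f z.1 * g z.2)) + (H * (Phi0 * (Mg * om))) * u z
  + (H * (tail_weight beta del z.1 * zeta z)
  + (H * (Bg * Phi0)) * ((z.1 < del)%R%:R * (z.1 `^ beta * u z `^ p))).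

Let xiE z : xi z = h z.1 * zeta z.
Proof. by rewrite /xi /zeta /separable mulr_sumr; apply: eq_bigr => i _; rewrite mulrA. Qed.

Let integrand_le z : Q z -> integrand z <= bound z.
Proof.
move=> zQ; have u0 := u_ge0 zQ; have zt0 := zeta_ge0 zQ; have ztB := zeta_le zQ.
have hH := h_leH zQ; have hge1 := h_ge1 z.1; have erl := err_le zQ.
have h0 : 0 <= h z.1 := le_trans ler01 hge1.
have H0 : 0 <= H := le_trans h0 hH.
have am0 : 0 <= a m z.1 * G m z.2 by rewrite mulr_ge0 ?a_ge0//; exact: density_ge0 (Gd m) _.
have fg0 : 0 <= f z.1 * g z.2 by rewrite mulr_ge0 ?(density_ge0 gd)// f0// oc.
have om0 : 0 <= om by apply: Rintegral_ge0 => y _; exact: near_weight_ge0.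
have pe0 : 0 <= Phi0 * (Mg * om) by rewrite !mulr_ge0.
(* The series remainder a_m G_m has the favourable sign and is dropped. *)
have step1 : u z * (h z.1 * (f z.1 * g z.2 - a m z.1 * G m z.2 + err z)) <=
    H * (u z * (f z.1 * g z.2)) + (H * (Phi0 * (Mg * om))) * u z.
  apply: (@le_trans _ _ (u z * (H * (f z.1 * g z.2 + Phi0 * (Mg * om))))).
    rewrite ler_wpM2l//; apply: (@le_trans _ _ (h z.1 * (f z.1 * g z.2 + Phi0 * (Mg * om)))).
      by rewrite ler_wpM2l//; lra.
    by rewrite ler_wpM2r// addr_ge0.
  by rewrite le_eqVlt; apply/orP; left; apply/eqP; ring.
have zb0 : 0 <= z.1 `^ beta by exact: powR_ge0.
have up0 : 0 <= u z `^ p by exact: powR_ge0.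
have hz : 0 <= h z.1 * zeta z by rewrite mulr_ge0.
have hzH : h z.1 * zeta z <= H * zeta z by rewrite ler_wpM2r.
have Kp0 : 0 <= absorb_const beta * (z.1 + del) `^ beta.
  by rewrite mulr_ge0 ?powR_ge0// (le_trans ler01)// absorb_const_ge1.
have step2 : - u z * (absorb_const beta * (z.1 + del) `^ beta * (h z.1 * zeta z))
    + z.1 `^ beta * u z `^ p * (h z.1 * zeta z) <=
    H * (tail_weight beta del z.1 * zeta z)
    + (H * (Bg * Phi0)) * ((z.1 < del)%R%:R * (z.1 `^ beta * u z `^ p)).
  (* For t >= del the growth of h covers t^beta u and only t^beta is left over; for t < del the
     negative term is dropped and the absorption kept. *)
  rewrite /tail_weight; have [dz|dz] := leP del z.1.
    rewrite mul1r mul0r mulr0 addr0.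
    have k1 := absorb_powR beta del0 dz.
    apply: (@le_trans _ _ (z.1 `^ beta * (h z.1 * zeta z))).
      rewrite -subr_ge0.
      have -> : z.1 `^ beta * (h z.1 * zeta z) - (- u z * (absorb_const beta * (z.1 + del) `^ beta * (h z.1 * zeta z))
         + z.1 `^ beta * u z `^ p * (h z.1 * zeta z)) =
        (h z.1 * zeta z) * (u z * (absorb_const beta * (z.1 + del) `^ beta - z.1 `^ beta)
          + z.1 `^ beta * (u z + 1 - u z `^ p)) by ring.
      by rewrite mulr_ge0// addr_ge0// mulr_ge0// subr_ge0// powR_le1D.
    by rewrite [leRHS]mulrCA ler_wpM2l.
  rewrite !mul0r mulr0 add0r mul1r.
  apply: (@le_trans _ _ (z.1 `^ beta * u z `^ p * (h z.1 * zeta z))).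
    by rewrite gerDr mulNr oppr_le0 mulr_ge0// mulr_ge0.
  rewrite mulrC ler_wpM2r ?mulr_ge0// ler_pM//.
rewrite /integrand /bound residual xiE mulrBr.
set X := u z * (h z.1 * _); set Y := u z * _; set Z := _ * (h z.1 * zeta z).
move: step1 step2; rewrite -/X mulNr -/Y -/Z => step1 step2.
by rewrite -addrA; apply: lerD.
Qed.


Let mQ := @measurable_Qset R N T.
Let ui : tx.-integrable Q (EFin \o (u : space_time -> R)).
Proof. exact: (weak_L1 hu T0). Qed.
Let upi : tx.-integrable Q (EFin \o (fun z : space_time => z.1 `^ beta * u z `^ p)).
Proof. exact: (weak_absorption_L1 hu T0). Qed.

Let sep_bounded (c' : nat -> R -> R) (G' : nat -> 'rV[R]_N -> R) :
  (forall i, {within `[0, T], continuous (c' i)}) -> (forall i, measurable_fun setT (G' i)) ->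
  (forall i, exists B, forall x, `|G' i x| <= B) ->
  forall v : space_time -> R, tx.-integrable Q (EFin \o v) ->
  tx.-integrable Q (EFin \o (fun z => v z * separable c' G' m z)).
Proof.
move=> hc' mG' hG' v vi; have [B _ hB] := separable_bounded m hc' hG'.
by apply: (integrable_realM_bounded mQ vi (B := B)) => //; exact: measurable_separable.
Qed.

Let mG i : measurable_fun setT (G i). Proof. by case: (Gd i) => -[]. Qed.
Let GB i : exists B, forall x, `|G i x| <= B.
Proof. by exists (nu ^+ i * Bg) => x; case: (Gd i) => -[]. Qed.
Let fkl := @frac_kernel_levy R N alpha.
Let mLG i : measurable_fun setT (LG i).
Proof. exact: (measurable_levy_op fkl (M0 i) (density_sdiff (Gd i))). Qed.
Let LGB i : exists B, forall x, `|LG i x| <= B.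
Proof. by eexists => x; exact: (levy_op_le halpha x fkl (M0 i) (density_sdiff (Gd i))). Qed.

Let integrand_integrable : tx.-integrable Q (EFin \o (integrand : space_time -> R)).
Proof.
have i1 := sep_bounded dcc mG GB ui.
have i2 := sep_bounded cc mLG LGB ui.
have i3 := sep_bounded cc mG GB upi.
have := integrable_realD mQ (integrable_realB mQ i2 i1) i3.
apply: eq_integrable => // z _; rewrite /= /integrand /xi; congr EFin; ring.
Qed.

Let source_integrable :
  tx.-integrable Q (EFin \o (fun z : space_time => u z * (f z.1 * g z.2))).
Proof.
have [[mg gB _] _ _] := gd.
apply: (integrable_realM_bounded mQ ui (B := Bf * Bg)).
  by apply: measurable_Q_prod => //; exact: within_continuous_measurable.
move=> z zQ; rewrite normrM ler_pM// ger0_norm ?fB ?f0//; exact: oc.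
Qed.

Let early_integrable :
  tx.-integrable Q (EFin \o (fun z : space_time => (z.1 < del)%R%:R * (z.1 `^ beta * u z `^ p))).
Proof.
have mi := measurable_lt_fun del.
apply: (@integrable_le _ _ _ _ _ mQ _ (fun z : space_time => z.1 `^ beta * u z `^ p)) => //.
- apply: measurable_funM; last exact: integrable_measurable upi.
  by apply: (measurable_Q_fst (c := fun t => (t < del)%R%:R)); exact: measurable_funTS.
- move=> z _; have v0 : 0 <= z.1 `^ beta * u z `^ p by rewrite mulr_ge0 ?powR_ge0.
  by rewrite normrM [X in _ * X]ger0_norm// ler_piMl// ger0_norm//; case: (_ < _).
Qed.

Let Ig : R := \int[mu]_x g x.
Let CT : R := T `^ (1 + beta) / (1 + beta).

(** Integrating in x first replaces [G i] by its mass nu^i [Ig]; [sum_le] then bounds the sum at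
    each time, leaving the integral of t^beta. *)
Let zeta_integral :
  (\int[tx]_(z in Q) (tail_weight beta del z.1 * zeta z)%:E <= (Phi0 * CT * Ig)%:E)%E.
Proof.
have mw := measurable_tail_weight beta del.
have w0 := tail_weight_ge0 beta del.
have ma i : measurable_fun (`]0, T[%classic : set (measurableTypeR R)) (a1 i).
  exact: within_continuous_measurable (@ac i.+1).
have mwa i : measurable_fun (`]0, T[%classic : set (measurableTypeR R))
    (fun t => tail_weight beta del t * a1 i t).
  by apply: measurable_funM => //; exact: measurable_funTS.
have Ig0 : 0 <= Ig by apply: Rintegral_ge0 => x _; exact: density_ge0 gd x.
have Gi i : (\int[mu]_x (G i x)%:E = (nu ^+ i * Ig)%:E)%E.
  rewrite integral_EFin_Rintegral//; last by case: (Gd i).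
  by rewrite (iterate_integral halpha he i gd).
have dm z : Q z -> 0 < z.1 < T by [].
have term0 i z : Q z -> (0 <= (tail_weight beta del z.1 * a1 i z.1 * G i z.2)%:E)%E.
  move=> zQ; rewrite lee_fin mulr_ge0 ?(density_ge0 (Gd i))// mulr_ge0// a_ge0//.
have -> : (\int[tx]_(z in Q) (tail_weight beta del z.1 * zeta z)%:E =
    \sum_(i < m) \int[tx]_(z in Q) (tail_weight beta del z.1 * a1 i z.1 * G i z.2)%:E)%E.
  rewrite -ge0_integral_sum//; last 2 first.
  - move=> i; apply/measurable_EFinP.
    exact: (measurable_Q_prod (mwa i) (mG i)).
  - by move=> i z; exact: term0.
  apply: eq_integral => z _; rewrite sumEFin /zeta /separable mulr_sumr; congr EFin.
  by apply: eq_bigr => i _; rewrite mulrA.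
have wa0 i t : 0 < t < T -> 0 <= tail_weight beta del t * a1 i t.
  by move=> tT; rewrite mulr_ge0// a_ge0.
have -> : (\sum_(i < m) \int[tx]_(z in Q) (tail_weight beta del z.1 * a1 i z.1 * G i z.2)%:E =
    \sum_(i < m) \int[leb]_(t in `]0%R, T[) ((tail_weight beta del t * a1 i t)%:E * (nu ^+ i * Ig)%:E))%E.
  apply: eq_bigr => i _.
  rewrite (integral_Q_prod (mwa i) (wa0 i) (mG i) (density_ge0 (Gd i))) Gi.
  rewrite ge0_integralZr//.
  - exact/measurable_EFinP.
  - by move=> t; rewrite /= in_itv/= => tT; rewrite lee_fin wa0.
  - by rewrite lee_fin mulr_ge0 ?exprn_ge0.
rewrite -ge0_integral_sum//; last 2 first.
- by move=> i; apply: emeasurable_funM => //; exact/measurable_EFinP.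
- move=> i t; rewrite /= in_itv/= => tT; rewrite -EFinM lee_fin mulr_ge0 ?wa0//.
  by rewrite mulr_ge0 ?exprn_ge0.
apply: (@le_trans _ _ (\int[leb]_(t in `]0%R, T[) ((tail_weight beta del t)%:E * (Phi0 * Ig)%:E))%E).
  apply: ge0_le_integral => //.
  - move=> t; rewrite /= in_itv/= => tT; rewrite sume_ge0// => i _.
    by rewrite -EFinM lee_fin mulr_ge0 ?wa0// mulr_ge0 ?exprn_ge0.
  - apply: emeasurable_sum => i; apply: emeasurable_funM => //; exact/measurable_EFinP.
  - apply: emeasurable_funM => //; apply/measurable_EFinP; exact: measurable_funTS.
  - move=> t; rewrite /= in_itv/= => tT.
    under eq_bigr do rewrite -EFinM.
    rewrite sumEFin -EFinM lee_fin.
    rewrite (eq_bigr (fun i : 'I_m => tail_weight beta del t * Ig * (nu ^+ i * a1 i t))).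
      by rewrite -mulr_sumr -mulrA ler_wpM2l// mulrC ler_wpM2r// sum_le.
    by move=> i _; ring.
rewrite ge0_integralZr//; last 3 first.
- by apply/measurable_EFinP; exact: measurable_funTS.
- by move=> t _; rewrite lee_fin.
- by rewrite lee_fin mulr_ge0.
rewrite [X in (_ <= X%:E)%E](_ : _ = CT * (Phi0 * Ig)); last by ring.
rewrite [X in (_ <= X)%E]EFinM; apply: lee_wpmul2r; first by rewrite lee_fin mulr_ge0.
exact: tail_weight_integral.
Qed.

Let zeta_integrable : tx.-integrable Q
  (EFin \o (fun z : space_time => tail_weight beta del z.1 * zeta z)).
Proof.
apply/integrableP; split.
  apply/measurable_EFinP; apply: measurable_funM.
    apply: (measurable_Q_fst (c := tail_weight beta del)); apply: measurable_funTS.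
    exact: measurable_tail_weight.
  by apply: measurable_separable => i; [exact: (@ac i.+1)|exact: mG].
apply: (le_lt_trans _ (ltry (Phi0 * CT * Ig))); apply: le_trans zeta_integral.
rewrite le_eqVlt; apply/orP; left; apply/eqP; apply: eq_integral => z /set_mem zQ.
by rewrite /= ger0_norm// mulr_ge0 ?tail_weight_ge0// zeta_ge0.
Qed.

Let source_mass : R := \int[tx]_(z in Q) (u z * (f z.1 * g z.2)).
Let total_mass : R := \int[tx]_(z in Q) u z.

Let bound_integral :
  \int[tx]_(z in Q) bound z <= H * source_mass + H * (Phi0 * (Mg * om)) * total_mass
    + (H * (Phi0 * CT * Ig) + H * (Bg * Phi0) * early_absorption del).
Proof.
have j1 := integrable_realZl mQ H source_integrable.
have j2 := integrable_realZl mQ (H * (Phi0 * (Mg * om))) ui.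
have j3 := integrable_realZl mQ H zeta_integrable.
have j4 := integrable_realZl mQ (H * (Bg * Phi0)) early_integrable.
have H0 : 0 <= H := le_trans ler01 (absorb_factor_ge1 hbeta 1 T).
rewrite /bound RintegralD//; [|exact: integrable_realD|exact: integrable_realD].
rewrite lerD//.
  by rewrite RintegralD// !RintegralZl.
rewrite RintegralD// !RintegralZl// lerD2r ler_wpM2l//.
have := zeta_integral; rewrite integral_EFin_Rintegral//.
Qed.

Lemma fixed_parameters_estimate :
  k * (@gauss_const R N * gauss_mass g *
    (\int[leb]_(r in `[0, T]) (r * expR (- @decay_rate R N alpha * r) * f r)
     - T * (Bf * (m%:R * @reg_mass R N alpha e ^+ m.-1 + T * @reg_mass R N alpha e ^+ m)
        * (T ^+ m / m`!%:R)))) <=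
  H * source_mass + H * (Phi0 * (Mg * om)) * total_mass
    + (H * (Phi0 * CT * Ig) + H * (Bg * Phi0) * early_absorption del).
Proof.
set r := @reg_mass R N alpha e; set d := @decay_rate R N alpha.
have r0 : 0 <= r by exact: reg_mass_ge0.
(* The exponential rate in the lower bound is independent of e, although nu and r separately are
   not. *)
have nuE : nu - r = d by rewrite /nu /total_rate addrAC subrr add0r.
have xi_test : test_space alpha T xi.
  exact: (@separable_test_space R N alpha halpha T m c dc G
    (fun i => nu ^+ i * Bg) (fun i => nu ^+ i * Mg)).
(* The coefficients use only profiles of positive index, which vanish at T; this removes the unknown
   terminal values of u. *)
have xiT x : xi (T, x) = 0.
  rewrite /xi /separable big1// => i _; rewrite /c /a /=.
  by rewrite profile_step_end mulr0 mul0r.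
have := weak_identity hu T0 xi_test.
rewrite [X in (_ - X)%E](_ : _ = 0%E); last first.
  by apply: integral0_eq => x _; rewrite xiT mul0r.
rewrite sube0.
have -> : (\int[tx]_(z in Q) (u z * (- dt xi z + frac_lap_tx alpha xi z)
      + z.1 `^ beta * u z `^ p * xi z)%:E = \int[tx]_(z in Q) (integrand z)%:E)%E.
  apply: eq_integral => z /set_mem zQ; congr EFin; rewrite /integrand.
  by rewrite (@dt_separable R N T c dc G cd m z zQ) (frac_lap_separable halpha c M0 Gd).
rewrite integral_EFin_Rintegral// => -[eqxi].
apply: (le_trans _ bound_integral); apply: (@le_trans _ _ (k * xi (0, 0))); last first.
  rewrite -eqxi; apply: le_Rintegral => //.
  have H0 : 0 <= H := le_trans ler01 (absorb_factor_ge1 hbeta 1 T).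
  apply: integrable_realD => //; apply: integrable_realD => //; exact: integrable_realZl.
rewrite ler_wpM2l ?(ltW hk)//.
have th0 : 0 <= @gauss_const R N * gauss_mass g.
  rewrite mulr_ge0 ?(ltW (@gauss_const_gt0 R N))//; exact: gauss_mass_ge0 gd.
have T00 : (0 : R) <= 0 <= T by rewrite lexx ltW.
(* The weight h is at least 1 at time 0, so it may be discarded on this side. *)
apply: (@le_trans _ _ (zeta (0, 0))); last first.
  rewrite xiE/= ler_peMl//; apply: sumr_ge0 => i _.
  by rewrite mulr_ge0 ?(density_ge0 (Gd i))//; exact: (@profile_ge0 R T T0 nu f cf f0 i.+1).
have rnu : 0 <= r <= nu by rewrite r0 /nu /total_rate lerDl decay_rate_ge0.
have low := profile_sum_lower T0 nu0 cf f0 m rnu fB.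
rewrite nuE in low.
apply: (le_trans (ler_wpM2l th0 low)).
(* Term by term, the spatial bound i r^(i-1) at the origin supplies exactly the weights of the
   profile sum. *)
rewrite /profile_sum mulr_sumr; apply: ler_sum => i _.
have := iterate_lower halpha he i gd 0; rewrite gauss0 mulr1 -/(G i) => lowG.
rewrite mulrA mulrC /=; apply: ler_wpM2l => //.
exact: (@profile_ge0 R T T0 nu f cf f0 i.+1).
Qed.

End fixed_parameters.

Lemma early_absorption_small (eta : R) : 0 < eta ->
  exists del, [/\ 0 < del <= 1, del < T & early_absorption del <= eta].
Proof.
move=> eta0; have mQ := @measurable_Qset R N T.
have upi : tx.-integrable Q (EFin \o (fun z : space_time => z.1 `^ beta * u z `^ p)).
  exact: (weak_absorption_L1 hu T0).
(* The cap at T/2 keeps del strictly below T. *)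
pose d0 : R := Num.min 1 (T / 2).
have T2 : T / 2 < T by rewrite ltr_pdivrMr// mulr_natr mulr2n ltrDl.
have d00 : 0 < d0 by rewrite lt_min ltr01 divr_gt0.
pose del n : R := d0 / n.+1%:R.
have del0 n : 0 < del n by rewrite divr_gt0.
have del1 n : del n <= d0 by rewrite ler_pdivrMr// ler_peMr ?ler1n// ltW.
pose F (z : space_time) : R := z.1 `^ beta * u z `^ p.
have F0 z : 0 <= F z by rewrite mulr_ge0 ?powR_ge0.
have cv : (\int[tx]_(z in Q) ((z.1 < del n)%R%:R * F z)%:E @[n --> \oo] -->
    \int[tx]_(z in Q) (0 : \bar R))%E.
  apply: (@dominated_cvg _ _ _ tx Q mQ _ _ (EFin \o F)) => //.
  - move=> n; apply/measurable_EFinP; apply: measurable_funM; last exact: integrable_measurable upi.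
    apply: (measurable_Q_fst (c := fun t => (t < del n)%R%:R)); apply: measurable_funTS.
    exact: measurable_lt_fun.
  - move=> z zQ; have z0 : 0 < z.1 by case/andP: zQ.
    apply: cvg_near_cst; exists (Num.bound (d0 / z.1)) => // n /= nb.
    rewrite ltNge (_ : del n <= z.1) ?mul0r//.
    rewrite ler_pdivrMr// mulrC -ler_pdivrMr// ltW//.
    rewrite (lt_le_trans (archi_boundP _)) ?divr_ge0 ?ltW//.
    by rewrite ltr_nat ltnS.
  - move=> n z _; rewrite /= lee_fin normrM [X in _ * X]ger0_norm// ler_piMl//.
    by rewrite ger0_norm//; case: (_ < _).
rewrite integral0 in cv.
move/fine_cvgP : cv => [_ /cvgrPdist_le/(_ _ eta0)[n _ /(_ n (leqnn n))]] /=.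
rewrite sub0r normrN => small; exists (del n); split.
- by rewrite del0/= (le_trans (del1 n))// ge_min lexx.
- by rewrite (le_lt_trans (del1 n))// (le_lt_trans _ T2)// ge_min lexx orbT.
- exact: le_trans (ler_norm _) small.
Qed.

Lemma exp_coeff_small (x eta : R) : 0 < eta ->
  exists n, forall j, (n <= j)%N -> x ^+ j / j`!%:R <= eta.
Proof.
move=> eta0; have /cvg_series_cvg_0/cvgrPdist_le/(_ _ eta0)[n _ nP] := is_cvg_series_exp_coeff x.
exists n => j nj; have := nP j nj; rewrite /= sub0r normrN.
exact: le_trans (ler_norm _).
Qed.

(** The three parameters are removed at fixed u: each error is brought below eta / 3. The number of
    terms is chosen last, since its threshold involves the mass of the kernel capped at e. *)
Lemma weak_solution_estimate :
  k * (@gauss_const R N * gauss_mass g *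
    \int[leb]_(r in `[0, T]) (r * expR (- @decay_rate R N alpha * r) * f r)) <=
  absorb_factor beta 1 T * (\int[tx]_(z in Q) (u z * (f z.1 * g z.2))
    + (\int[leb]_(r in `[0, T]) f r) * (T `^ (1 + beta) / (1 + beta)) * \int[mu]_x g x).
Proof.
set H := absorb_factor beta 1 T; set Phi0 := \int[leb]_(r in `[0, T]) f r.
set CT := T `^ (1 + beta) / (1 + beta); set th := _ * gauss_mass g.
set I := \int[leb]_(r in _) (r * _ * _).
have H0 : 0 <= H := le_trans ler01 (absorb_factor_ge1 hbeta 1 T).
have Phi00 : 0 <= Phi0 by apply: Rintegral_ge0 => t /=; rewrite in_itv/=; exact: f0.
have Bg0 : 0 <= Bg by have [[_ gB _] _ _] := gd; exact: le_trans (normr_ge0 _) (gB 0).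
have th0 : 0 <= th.
  rewrite mulr_ge0 ?(ltW (@gauss_const_gt0 R N))//; exact: gauss_mass_ge0 gd.
have Bf0 : 0 <= Bf.
  have T00 : (0 : R) <= 0 <= T by rewrite lexx ltW.
  exact: le_trans (f0 T00) (fB T00).
have tm0 : 0 <= \int[tx]_(z in Q) u z.
  by apply: Rintegral_ge0 => z /andP[z0 _]; exact: (weak_ge0 hu).
apply/ler_addgt0Pr => eta eta0; have eta3 : 0 < eta / 3 by rewrite divr_gt0.
(* The constants [A1], [A2], [A3] may be zero, hence the denominators with 1 added. *)
set A1 := H * (Bg * Phi0); have A10 : 0 < A1 + 1 by rewrite ltr_wpDl// !mulr_ge0.
have [del [hdel delT early]] := early_absorption_small (divr_gt0 eta3 A10).
set A2 := H * (Phi0 * Mg) * \int[tx]_(z in Q) u z.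
have A20 : 0 < A2 + 1 by rewrite ltr_wpDl// !mulr_ge0.
have [e he near] := @near_mass_small R N alpha halpha _ (divr_gt0 eta3 A20).
have {}near := near e (lexx e).
set r := @reg_mass R N alpha e.
set A3 := k * th * T * Bf * T * 2.
have A30 : 0 < A3 + 1.
  rewrite ltr_wpDl// /A3; clearbody th.
  by rewrite !mulr_ge0 ?(ltW hk) ?(ltW T0).
have [n nP] := exp_coeff_small (r * T) (divr_gt0 eta3 A30).
have key := fixed_parameters_estimate n.+1 he hdel delT.
have E1 : H * (Bg * Phi0) * early_absorption del <= eta / 3.
  rewrite -/A1; apply: (@le_trans _ _ ((A1 + 1) * early_absorption del)); last first.
    by rewrite mulrC -ler_pdivlMr.
  rewrite ler_wpM2r ?lerDl//; apply: Rintegral_ge0 => z _.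
  by rewrite !mulr_ge0 ?powR_ge0.
have E2 : H * (Phi0 * (Mg * @near_mass R N alpha e)) * \int[tx]_(z in Q) u z <= eta / 3.
  rewrite (_ : _ * _ = A2 * @near_mass R N alpha e); last by rewrite /A2; ring.
  apply: (@le_trans _ _ ((A2 + 1) * @near_mass R N alpha e)); last first.
    by rewrite mulrC -ler_pdivlMr.
  by rewrite ler_wpM2r ?lerDl//; apply: Rintegral_ge0 => z _; exact: near_weight_ge0.
have E3 : k * (th * (T * (Bf * (n.+1%:R * r ^+ n + T * r ^+ n.+1) * (T ^+ n.+1 / n.+1`!%:R)))) <= eta / 3.
  have s1 := nP n (leqnn n); have s2 := nP n.+1 (leqnSn n).
  rewrite -[Bf * _ * _]mulrA.
  (* The factor m = n + 1 cancels against m!, so both remainders are T times exponential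
     coefficients of r T; the 2 in [A3] counts them. *)
  have -> : (n.+1%:R * r ^+ n + T * r ^+ n.+1) * (T ^+ n.+1 / n.+1`!%:R) =
      T * ((r * T) ^+ n / n`!%:R + (r * T) ^+ n.+1 / n.+1`!%:R).
    rewrite factS natrM !exprMn !exprS.
    have i0 : n`!%:R != 0 :> R by rewrite pnatr_eq0 -lt0n fact_gt0.
    have i1 : n.+1%:R != 0 :> R by rewrite pnatr_eq0.
    move: i0 i1; move: (n`!%:R) (n.+1%:R) (T ^+ n) (r ^+ n) => a b v w a0 b0.
    by field; rewrite a0 b0.
  apply: (@le_trans _ _ (k * (th * (T * (Bf * (T * (eta / 3 / (A3 + 1) + eta / 3 / (A3 + 1)))))))).
    by rewrite (ler_wpM2l (ltW hk))// (ler_wpM2l th0)// (ler_wpM2l (ltW T0))// (ler_wpM2l Bf0)// (ler_wpM2l (ltW T0))// lerD.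
  rewrite (_ : _ * _ = A3 * (eta / 3 / (A3 + 1))); last by rewrite /A3; ring.
  apply: (@le_trans _ _ ((A3 + 1) * (eta / 3 / (A3 + 1)))).
    by rewrite ler_wpM2r ?lerDl// divr_ge0 ?ltW.
  by rewrite mulrC divfK// gt_eqF.
move: key; rewrite /= -/r -/th -/I -/H -/Phi0 -/CT => key.
rewrite [leRHS](_ : _ = H * (\int[tx]_(z in Q) (u z * (f z.1 * g z.2))) + eta / 3
   + (H * (Phi0 * CT * \int[mu]_x g x) + eta / 3) + eta / 3); last by field.
rewrite -lerBlDr; apply: le_trans (le_trans key _); last first.
  by rewrite !lerD.
by rewrite !mulrBr lerD2l lerN2.
Qed.

End main_estimate.

(** * A class of spatial factors closed under products *)

Section second_difference_class.
Context {R : realType} {N : nat}.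
Implicit Types (G : 'rV[R]_N -> R) (x y : 'rV[R]_N).

(* The Lipschitz bound is what makes the class stable under products. *)
Definition C11 G := exists B L M : R, [/\ 0 <= M, sdiff_bounded B M G &
  forall x y, `|G (x + y) - G x| <= L * enorm y].

Lemma C11_cst c : C11 (fun=> c).
Proof.
exists `|c|, 0, 0; split=> //.
  split=> // x y; rewrite /sdiff mul0r (_ : _ - c - c = 0) ?normr0//; ring.
by move=> x y; rewrite subrr normr0 mul0r.
Qed.

Lemma C11M G G' : C11 G -> C11 G' -> C11 (fun x => G x * G' x).
Proof.
move=> [B [L [M [M0 [mG GB GM] GL]]]] [B' [L' [M' [M'0 [mG' GB' GM'] GL']]]].
have B0 : 0 <= B := le_trans (normr_ge0 _) (GB 0).
have B'0 : 0 <= B' := le_trans (normr_ge0 _) (GB' 0).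
pose S : R := `|L * L'| *+ 2.
exists (B * B'), (B * L' + B' * L), (B * M' + B' * M + S); split=> [||x y].
- by rewrite !addr_ge0 ?mulrn_wge0// mulr_ge0.
- split; first exact: measurable_funM.
    by move=> x; rewrite normrM ler_pM.
  move=> x y; pose a z := G (x + z) - G x; pose b z := G' (x + z) - G' x.
  have ab z : `|a z * b z| <= `|L * L'| * enorm z ^+ 2.
    rewrite normrM (le_trans (ler_pM _ _ (GL x z) (GL' x z)))//.
    rewrite [leLHS](_ : _ = (L * L') * enorm z ^+ 2); last by ring.
    by rewrite ler_wpM2r ?sqr_ge0// ler_norm.
  (* Discrete Leibniz rule: the cross terms are products of two first differences, each of order
     |y|, hence quadratic. *)
  rewrite (_ : sdiff _ x y = (G x * sdiff G' x y + G' x * sdiff G x y)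
    - (a y * b y + a (- y) * b (- y))); last by rewrite /sdiff /a /b; ring.
  rewrite (le_trans (ler_normB _ _))// [leRHS]mulrDl lerD//.
    rewrite (le_trans (ler_normD _ _))// [leRHS]mulrDl -!mulrA lerD//.
      by rewrite normrM ler_pM.
    by rewrite normrM ler_pM.
  rewrite (le_trans (ler_normD _ _))// /S mulr2n [leRHS]mulrDl lerD//.
  by rewrite -[in leRHS](enormN y).
- rewrite (_ : _ - _ = G (x + y) * (G' (x + y) - G' x) + G' x * (G (x + y) - G x)); last by ring.
  by rewrite (le_trans (ler_normD _ _))// [leRHS]mulrDl -!mulrA lerD// normrM ler_pM.
Qed.

Lemma C11_prod (I : Type) (s : seq I) (G : I -> 'rV[R]_N -> R) :
  (forall i, C11 (G i)) -> C11 (fun x => \prod_(i <- s) G i x).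
Proof.
move=> GC; elim: s => [|i s ih].
  by under eq_fun do rewrite big_nil; exact: C11_cst.
by under eq_fun do rewrite big_cons; exact: C11M.
Qed.

Lemma density_C11 G : C11 G -> (forall x, 0 <= G x) ->
  (@lebesgue_rV R N).-integrable setT (EFin \o G) -> exists B M : R, 0 <= M /\ density B M G.
Proof. by move=> [B [L [M [M0 GM GL]]]] G0 Gi; exists B, M. Qed.

End second_difference_class.

(** * One-variable profiles: logistic functions and Gaussians *)

Section smooth_profiles.
Context {R : realType}.
Implicit Types (phi : R -> R).

Lemma is_derive_continuous phi (dphi : R -> R) : (forall r, is_derive r (1:R) phi (dphi r)) -> continuous phi.
Proof. by move=> dP r; apply: differentiable_continuous; apply/derivable1_diffP; case: (dP r). Qed.

Lemma mean_value phi (dphi : R -> R) (a b : R) : (forall r, is_derive r (1:R) phi (dphi r)) ->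
  exists2 c, `|c - a| <= `|b - a| & phi b - phi a = dphi c * (b - a).
Proof.
move=> dP; have cP := is_derive_continuous dP.
have [ab|/ltW ba] := leP a b.
  have [c] := MVT_segment ab (fun r _ => dP r) (continuous_subspaceT cP).
  rewrite in_itv/= => /andP[ac cb] E; exists c => //.
  by rewrite !ger0_norm ?subr_ge0// lerD2r.
have [c] := MVT_segment ba (fun r _ => dP r) (continuous_subspaceT cP).
rewrite in_itv/= => /andP[bc ca] E; exists c.
  by rewrite [leLHS]distrC [leRHS]distrC !ger0_norm ?subr_ge0// lerD2l lerN2.
by rewrite -[LHS]opprB E -mulrN opprB.
Qed.

Lemma C11_profile N (i : 'I_N) (a b : R) phi (dphi ddphi : R -> R) (B L M : R) :
  (forall r, is_derive r (1:R) phi (dphi r)) -> (forall r, is_derive r (1:R) dphi (ddphi r)) ->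
  (forall r, `|phi r| <= B) -> (forall r, `|dphi r| <= L) -> (forall r, `|ddphi r| <= M) ->
  C11 (fun x : 'rV[R]_N => phi (a * x 0 i + b)).
Proof.
move=> dP ddP PB dB ddB.
have L0 : 0 <= L := le_trans (normr_ge0 _) (dB 0).
have M0 : 0 <= M := le_trans (normr_ge0 _) (ddB 0).
have lip r s : `|phi (r + s) - phi r| <= L * `|s|.
  have [c _ ->] := mean_value r (r + s) dP.
  by rewrite addrAC subrr add0r normrM ler_wpM2r.
(* The mean value theorem gives two intermediate points within |s| of r, so within 2|s| of each
   other; applied to [dphi] between them it gives the constant 2 M. *)
have second r s : `|2 * phi r - phi (r + s) - phi (r - s)| <= 2 * M * s ^+ 2.
  have [c] := mean_value r (r + s) dP; rewrite addrAC subrr add0r => cr E.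
  have [c'] := mean_value r (r - s) dP; rewrite addrAC subrr add0r normrN => cr' E'.
  have [d _ D] := mean_value c c' ddP.
  have cc' : `|c' - c| <= 2 * `|s|.
    rewrite (_ : _ - _ = (c' - r) - (c - r)); last by ring.
    by rewrite (le_trans (ler_normB _ _))// mulr_natl mulr2n lerD.
  rewrite (_ : 2 * _ - _ - _ = - (phi (r + s) - phi r) - (phi (r - s) - phi r)); last by ring.
  rewrite E E' (_ : _ - _ = s * (dphi c' - dphi c)); last by ring.
  rewrite D !normrM (@le_trans _ _ (`|s| * (M * (2 * `|s|))))//.
    by rewrite ler_wpM2l// ler_pM.
  rewrite -(real_normK (num_real s)) le_eqVlt; apply/orP; left; apply/eqP; ring.
have coordE (x y : 'rV[R]_N) : a * (x + y) 0 i + b = (a * x 0 i + b) + a * y 0 i.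
  by rewrite !mxE; ring.
have K0 : 0 <= 2 * M * a ^+ 2 by rewrite mulr_ge0 ?sqr_ge0 ?mulr_ge0.
exists B, (L * `|a|), (2 * M * a ^+ 2); split=> [||x y].
- exact: K0.
- split=> // [|x y].
    apply: (measurableT_comp (f := phi)).
      by apply: continuous_measurable_fun; exact: is_derive_continuous dP.
    by apply: measurable_funD => //; apply: measurable_funM => //; exact: measurable_coord.
  rewrite /sdiff !coordE mxE mulrN (le_trans (second _ _))//.
  rewrite exprMn mulrA; apply: (ler_wpM2l K0).
  by rewrite -(real_normK (num_real (y 0 i))) ler_sqr ?nnegrE ?enorm_ge0// coord_le_enorm.
- rewrite coordE (le_trans (lip _ _))// normrM mulrA ler_wpM2l ?mulr_ge0//.
  exact: coord_le_enorm.
Qed.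

(** A decreasing smooth step whose complement is its own reflection, 1 - logistic r = logistic (-
    r), and whose derivative is a polynomial in itself. *)
Definition logistic (r : R) : R := (1 + expR r)^-1.

Lemma logistic_gt0 r : 0 < logistic r.
Proof. by rewrite invr_gt0 addr_gt0// expR_gt0. Qed.

Lemma logistic_lt1 r : logistic r < 1.
Proof. by rewrite invf_lt1 ?ltrDl ?addr_gt0// expR_gt0. Qed.

Lemma is_derive_logistic r : is_derive r (1:R) logistic (logistic r ^+ 2 - logistic r).
Proof.
have e0 : 1 + expR r != 0 by rewrite gt_eqF// addr_gt0// expR_gt0.
have d1 := is_derive_realD (is_derive_cst (1 : R) r (1:R)) (is_derive_expR r).
have d2 := is_deriveV (f := fun r => 1 + expR r) e0 d1.
apply: (is_derive_eq d2); rewrite /logistic /GRing.scale/=.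
by move: (expR r) e0 => v e0; field.
Qed.

Lemma C11_logistic N (i : 'I_N) (a b : R) :
  C11 (fun x : 'rV[R]_N => logistic (a * x 0 i + b)).
Proof.
pose d1 r : R := logistic r ^+ 2 - logistic r.
pose d2 r : R := 2%:R * logistic r ^+ 2.-1 * d1 r - d1 r.
have l0 r := ltW (logistic_gt0 r); have l1 r := ltW (logistic_lt1 r).
have d1B r : `|d1 r| <= 1.
  rewrite /d1 ler_norml; move: (l0 r) (l1 r); move: (logistic r) => v v0 v1.
  by nra.
apply: (@C11_profile N i a b logistic d1 d2 1 1 1).
- exact: is_derive_logistic.
- by move=> r; have d := is_derive_logistic r; exact: is_derive_realB (is_derive_realX 2 d) d.
- by move=> r; rewrite ger0_norm.
- exact: d1B.
- move=> r; rewrite /d2 /= expr1.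
  rewrite (_ : _ - _ = d1 r * (2 * logistic r - 1)); last by ring.
  rewrite normrM -[leRHS]mulr1; apply: ler_pM => //.
  rewrite ler_norml; move: (l0 r) (l1 r); move: (logistic r) => v v0 v1; lra.
Qed.

Lemma sqr_mul_expRN_le (r : R) : r ^+ 2 * expR (- r ^+ 2) <= 1.
Proof.
rewrite expRN -ler_pdivlMr ?invr_gt0 ?expR_gt0// invrK mul1r.
by rewrite (le_trans _ (expR_ge1Dx _))// lerDr.
Qed.

Lemma C11_gauss N : C11 (@gauss R N).
Proof.
have -> : @gauss R N = fun x => \prod_(i < N) expR (- (1 * x 0 i + 0) ^+ 2).
  apply/funext => x; rewrite /gauss sqr_enorm -sumrN expR_sum.
  by apply: eq_bigr => i _; rewrite mul1r addr0.
apply: C11_prod => i.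
pose phi (r : R) := expR (- r ^+ 2).
pose d1 r := phi r * (- 2 * r); pose d2 r := phi r * - 2 + (- 2 * r) * d1 r.
have phi0 r : 0 <= phi r by exact: expR_ge0.
have phi1 r : phi r <= 1 by rewrite -expR0 ler_expR oppr_le0 sqr_ge0.
have phi2 r : r ^+ 2 * phi r <= 1 by exact: sqr_mul_expRN_le.
have dP r : is_derive r (1:R) phi (d1 r).
  have e := is_derive_realX 2 (is_derive_id r (1:R)).
  have {}e := is_derive_realB (is_derive_cst (0 : R) r (1:R)) e.
  have -> : phi = (fun r => expR (0 - r ^+ 2)) by apply/funext => s; rewrite sub0r.
  have -> : d1 r = expR (0 - r ^+ 2) * (0 - 2%:R * r ^+ 2.-1 * 1).
    by rewrite /d1 /phi !sub0r /= expr1 mulr1 mulNr.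
  exact: (is_derive1_comp (f := expR) (g := fun r => 0 - r ^+ 2)).
have ddP r : is_derive r (1:R) d1 (d2 r).
  have e := is_derive_realZ (- 2) (is_derive_id r (1:R)).
  by apply: (is_derive_eq (is_derive_realM (dP r) e)); rewrite mulr1.
(* From phi <= 1 and r^2 phi <= 1: 2 |r| phi <= (1 + r^2) phi <= 2, and |phi''| <= 2 phi + 4 r^2 phi
   <= 6. *)
apply: (@C11_profile N i 1 0 phi d1 d2 1 2 6) => // r.
- by rewrite ger0_norm.
- rewrite /d1; move: (phi0 r) (phi1 r) (phi2 r); move: (phi r) => v v0 v1 v2.
  have s1 : 0 <= (1 + r) ^+ 2 * v by rewrite mulr_ge0 ?sqr_ge0.
  have s2 : 0 <= (1 - r) ^+ 2 * v by rewrite mulr_ge0 ?sqr_ge0.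
  rewrite ler_norml; nra.
- rewrite /d2 /d1; move: (phi0 r) (phi1 r) (phi2 r); move: (phi r) => v v0 v1 v2.
  have s1 : 0 <= r ^+ 2 * v by rewrite mulr_ge0 ?sqr_ge0.
  rewrite ler_norml; nra.
Qed.

End smooth_profiles.

(** * Logistic approximation of half-lines *)

Section logistic_steps.
Context {R : realType}.
Implicit Types r x : R.

Lemma logistic_le r : 0 < r -> logistic r <= r^-1.
Proof.
move=> r0; rewrite lef_pV2 ?posrE ?addr_gt0 ?expR_gt0//.
by have := expR_ge1Dx r; lra.
Qed.

Lemma logisticN r : logistic (- r) = 1 - logistic r.
Proof.
rewrite /logistic expRN; have := expR_gt0 r; move: (expR r) => v v0.
by field; rewrite ?gt_eqF// ?addr_gt0.
Qed.

(** With m = n + 1 the argument is m + m^2 (r - x): the extra m sends the value at r = x to 0, so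
    the limit is the indicator of the strict inequality everywhere. *)
Definition logistic_slope (n : nat) : R := n.+1%:R ^+ 2.
Definition logistic_shift x (n : nat) : R := n.+1%:R - n.+1%:R ^+ 2 * x.

Lemma cvg_logistic_step x r :
  logistic (logistic_slope n * r + logistic_shift x n) @[n --> \oo] --> ((r < x)%R%:R : R).
Proof.
apply/cvgrPdist_le => eta eta0.
have arch c : 0 < c -> exists n0, forall n, (n0 <= n)%N -> c <= n.+1%:R :> R.
  move=> c0; exists (Num.bound c) => n cn; rewrite ltW//.
  by rewrite (lt_le_trans (archi_boundP (ltW c0)))// ler_nat (leq_trans cn).
have [n1 n1P] := arch _ (divr_gt0 (ltr01 : 0 < 1 :> R) eta0).
have small (s : R) n : (n1 <= n)%N -> n.+1%:R <= s -> logistic s <= eta.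
  move=> nn ns; have s0 : 0 < s := lt_le_trans (ltr0Sn _ _) ns.
  rewrite (le_trans (logistic_le s0))// -[leRHS]invrK lef_pV2 ?posrE ?invr_gt0//.
  by rewrite (le_trans _ ns)// -[eta^-1]mul1r n1P.
have [xr|rx] := leP x r.
  exists n1 => // n /= nn; rewrite sub0r normrN ger0_norm ?(ltW (logistic_gt0 _))//.
  apply: (small _ n) => //; rewrite /logistic_slope /logistic_shift.
  rewrite (_ : _ + _ = n.+1%:R + n.+1%:R ^+ 2 * (r - x)); last by ring.
  by rewrite lerDl mulr_ge0 ?sqr_ge0// subr_ge0.
have d0 : 0 < x - r by rewrite subr_gt0.
have [n2 n2P] := arch _ (divr_gt0 (ltr0n R 2) d0).
exists (maxn n1 n2) => // n /=; rewrite geq_max => /andP[nn1 /n2P nn2].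
rewrite -logisticN ger0_norm ?(ltW (logistic_gt0 _))//.
apply: (small _ n) => //; rewrite /logistic_slope /logistic_shift.
rewrite ler_pdivrMr// in nn2; have m0 : 0 < n.+1%:R :> R by exact: ltr0Sn.
move: (n.+1%:R) m0 nn2 => m m0 nn2.
rewrite (_ : - _ = m * (m * (x - r) - 1)); last by ring.
by rewrite ler_peMr ?(ltW m0)//; lra.
Qed.

End logistic_steps.

(** * From nonnegativity against products to nonnegativity almost everywhere *)

Section ae_nonneg.
Context {R : realType} {N : nat} (T : R).
Notation mu := (@lebesgue_rV R N).
Notation tx := (@lebesgue_tx R N).
Notation Q := (@Qset R N T).
Notation space_time := (measurableTypeR R * 'rV[R]_N)%type.
Implicit Types (h s : space_time -> R) (E F : set space_time).

(** Only bounded factors are required, so that constants and logistic cutoffs qualify; integrability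
    is supplied later by a Gaussian factor. *)
Inductive product_cone : (space_time -> R) -> Prop :=
| product_cone_prod (c : R -> R) (G : 'rV[R]_N -> R) :
    continuous c -> (forall t, 0 <= c t) -> C11 G -> (forall x, 0 <= G x) ->
    product_cone (fun z => c z.1 * G z.2)
| product_cone_add h h' : product_cone h -> product_cone h' ->
    product_cone (fun z => h z + h' z).

Lemma product_coneM h h' : product_cone h -> product_cone h' ->
  product_cone (fun z => h z * h' z).
Proof.
elim=> [c G cc c0 CG G0|h1 h2 _ ih1 _ ih2]; last first.
  move=> ch'; under eq_fun do rewrite mulrDl.
  by apply: product_cone_add; [exact: ih1|exact: ih2].
elim=> [c' G' cc' c'0 CG' G'0|h1 h2 _ ih1 _ ih2].
  rewrite (_ : (fun _ => _) = fun z : space_time => (c z.1 * c' z.1) * (G z.2 * G' z.2)).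
    apply: (product_cone_prod (c := fun t => c t * c' t) (G := fun x => G x * G' x)).
    - by move=> t; apply: cvgM; [exact: cc|exact: cc'].
    - by move=> t; rewrite mulr_ge0.
    - exact: C11M.
    - by move=> x; rewrite mulr_ge0.
  by apply/funext => z; ring.
under eq_fun do rewrite mulrDr.
exact: product_cone_add.
Qed.

Lemma product_cone_cst (a : R) : 0 <= a -> product_cone (fun=> a).
Proof.
move=> a0; rewrite (_ : (fun _ => _) = fun z : space_time => a * 1); last first.
  by apply/funext => z; rewrite mulr1.
apply: (product_cone_prod (c := fun=> a) (G := fun=> 1)) => //; first exact: cst_continuous.
exact: C11_cst.
Qed.

Lemma product_cone_ge0 h : product_cone h -> forall z, 0 <= h z.
Proof.
by elim=> [c G _ c0 _ G0|h1 h2 _ ih1 _ ih2] z; [rewrite mulr_ge0|rewrite addr_ge0].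
Qed.

Lemma measurable_product_cone h : product_cone h -> measurable_fun Q h.
Proof.
elim=> [c G cc _ [B [L [M [_ [mG _ _] _]]]] _|h1 h2 _ ih1 _ ih2]; last exact: measurable_funD.
apply: (@measurable_Q_prod R N T c G) => //; apply: within_continuous_measurable.
exact: continuous_subspaceT.
Qed.

(* Both h and 1 - h lie in the cone, so that approximable sets are closed under
   complementation. *)
Definition smooth_cutoff h := product_cone h /\ product_cone (fun z => 1 - h z).

Lemma smooth_cutoffC h : smooth_cutoff h -> smooth_cutoff (fun z => 1 - h z).
Proof. by move=> [h1 h2]; split => //; under eq_fun do rewrite subKr. Qed.

Lemma smooth_cutoffM h h' : smooth_cutoff h -> smooth_cutoff h' ->
  smooth_cutoff (fun z => h z * h' z).
Proof.
move=> [h1 h2] [h1' h2']; split; first exact: product_coneM.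
rewrite (_ : (fun _ => _) = fun z => (1 - h z) + h z * (1 - h' z)).
  by apply: product_cone_add => //; exact: product_coneM.
by apply/funext => z; ring.
Qed.

Lemma smooth_cutoff_itv h : smooth_cutoff h -> forall z, 0 <= h z <= 1.
Proof. by move=> [h1 h2] z; rewrite product_cone_ge0//= -subr_ge0 (product_cone_ge0 h2). Qed.

Lemma smooth_cutoff1 : smooth_cutoff (fun=> 1).
Proof.
by split; [exact: product_cone_cst|under eq_fun do rewrite subrr; exact: product_cone_cst].
Qed.

Lemma smooth_cutoff_time (a b : R) : smooth_cutoff (fun z => logistic (a * z.1 + b)).
Proof.
have cl (a' b' : R) : product_cone (fun z => logistic (a' * z.1 + b')).
  rewrite (_ : (fun _ => _) = fun z : space_time => logistic (a' * z.1 + b') * 1); last first.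
    by apply/funext => z; rewrite mulr1.
  apply: (product_cone_prod (c := fun t => logistic (a' * t + b')) (G := fun=> 1)) => //.
  - move=> t; apply: (continuous_comp (f := fun t => a' * t + b') (g := logistic)).
      by apply: cvgD; [exact: mulrl_continuous|exact: cvg_cst].
    exact: (is_derive_continuous (@is_derive_logistic R)).
  - by move=> t; exact/ltW/logistic_gt0.
  - exact: C11_cst.
split=> //; under eq_fun do rewrite -logisticN opprD -mulNr; exact: cl.
Qed.

Lemma smooth_cutoff_space i (a b : R) : smooth_cutoff (fun z => logistic (a * z.2 0 i + b)).
Proof.
have cl (a' b' : R) : product_cone (fun z => logistic (a' * z.2 0 i + b')).
  rewrite (_ : (fun _ => _) = fun z : space_time => 1 * logistic (a' * z.2 0 i + b')); last first.
    by apply/funext => z; rewrite mul1r.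
  apply: (product_cone_prod (c := fun=> 1) (G := fun x : 'rV[R]_N => logistic (a' * x 0 i + b'))) => //.
  - exact: cst_continuous.
  - exact: C11_logistic.
  - by move=> x; exact/ltW/logistic_gt0.
split=> //; under eq_fun do rewrite -logisticN opprD -mulNr; exact: cl.
Qed.

Section approximation.
Variable V : space_time -> R.
Hypothesis Vi : tx.-integrable Q (EFin \o V).
Let mQ := @measurable_Qset R N T.

(** The L^1 distance for the finite measure |V| dt dx; for the plain measure the distance of two
    cutoffs on Q_T may be infinite. *)
Definition cutoff_dist s h : R := \int[tx]_(z in Q) (`|V z| * `|s z - h z|).

Definition unit_valued s := measurable_fun Q s /\ forall z, 0 <= s z <= 1.

Lemma smooth_cutoff_unit h : smooth_cutoff h -> unit_valued h.
Proof. by move=> hh; split; [case: hh => /measurable_product_cone|exact: smooth_cutoff_itv]. Qed.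

Lemma unit_dist_le1 s h z : unit_valued s -> unit_valued h -> `|s z - h z| <= 1.
Proof.
move=> [_ /(_ z)/andP[s0 s1]] [_ /(_ z)/andP[h0 h1]].
rewrite ler_norml; lra.
Qed.

Lemma cutoff_dist_integrable s h : unit_valued s -> unit_valued h ->
  tx.-integrable Q (EFin \o (fun z => `|V z| * `|s z - h z|)).
Proof.
move=> us uh; apply: (integrable_realM_bounded mQ (B := 1)).
- exact: integrable_norm.
- by apply: measurableT_comp => //; apply: measurable_funB; [case: us|case: uh].
- by move=> z _; rewrite normr_id unit_dist_le1.
Qed.

Definition approximable s := unit_valued s /\
  forall eta, 0 < eta -> exists2 h, smooth_cutoff h & cutoff_dist s h <= eta.

Lemma approximable_cutoff h : smooth_cutoff h -> approximable h.
Proof.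
move=> hh; split=> [|eta eta0]; first exact: smooth_cutoff_unit.
exists h => //; rewrite /cutoff_dist.
under eq_Rintegral do rewrite subrr normr0 mulr0.
by rewrite Rintegral_cst// mul0r ltW.
Qed.

Lemma approximableC s : approximable s -> approximable (fun z => 1 - s z).
Proof.
move=> [[ms s01] sP]; split.
  split; first exact: measurable_funB.
  by move=> z; have /andP[? ?] := s01 z; rewrite subr_ge0 gerDl oppr_le0; apply/andP.
move=> eta /sP[h hh hs]; exists (fun z => 1 - h z); first exact: smooth_cutoffC.
apply: le_trans hs; rewrite le_eqVlt; apply/orP; left; apply/eqP.
apply: eq_Rintegral => z _; congr (_ * _); rewrite distrC; congr `|_|; ring.
Qed.

Lemma approximableM s s' : approximable s -> approximable s' ->
  approximable (fun z => s z * s' z).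
Proof.
move=> [us sP] [us' s'P].
have itvM h h' z : 0 <= h z <= 1 -> 0 <= h' z <= 1 -> 0 <= h z * h' z <= 1.
  by move=> /andP[? ?] /andP[? ?]; rewrite mulr_ge0//= mulr_ile1.
have uM h h' : unit_valued h -> unit_valued h' -> unit_valued (fun z => h z * h' z).
  by move=> [mh h01] [mh' h'01]; split; [exact: measurable_funM|move=> z; exact: itvM].
split; first exact: uM.
move=> eta eta0; have e2 : 0 < eta / 2 by rewrite divr_gt0.
have [h hh hs] := sP _ e2; have [h' hh' hs'] := s'P _ e2.
have uh := smooth_cutoff_unit hh; have uh' := smooth_cutoff_unit hh'.
exists (fun z => h z * h' z); first exact: smooth_cutoffM.
rewrite (splitr eta); apply: le_trans (lerD hs hs').
rewrite /cutoff_dist -RintegralD//; try exact: cutoff_dist_integrable.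
apply: le_Rintegral => //.
- by apply: cutoff_dist_integrable; exact: uM.
- by apply: integrable_realD => //; exact: cutoff_dist_integrable.
move=> z _; rewrite -mulrDr ler_wpM2l//.
rewrite (_ : _ - _ = (s z - h z) * s' z + h z * (s' z - h' z)); last by ring.
rewrite (le_trans (ler_normD _ _))// !normrM lerD//.
- by case: us' => _ /(_ z)/andP[? ?]; rewrite ler_piMr// ger0_norm.
- by case: uh => _ /(_ z)/andP[? ?]; rewrite ler_piMl// ger0_norm.
Qed.

(** Dominated convergence with majorant |V| reaches some [s_ n], and an approximation of that one
    reaches [s]. *)
Lemma approximable_cvg (s_ : nat -> space_time -> R) s : unit_valued s ->
  (forall n, approximable (s_ n)) -> (forall z, s_ n z @[n --> \oo] --> s z) ->
  approximable s.
Proof.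
move=> us sA cs; split=> // eta eta0; have e2 : 0 < eta / 2 by rewrite divr_gt0.
have u_ n : unit_valued (s_ n) by case: (sA n).
have cv : (\int[tx]_(z in Q) (`|V z| * `|s z - s_ n z|)%:E @[n --> \oo] -->
    \int[tx]_(z in Q) (0 : \bar R))%E.
  apply: (@dominated_cvg _ _ _ tx Q mQ _ _ (fun z => `|V z|%:E)) => //.
  - by move=> n; apply/measurable_EFinP/integrable_measurable/cutoff_dist_integrable.
  - move=> z zQ; rewrite -[X in _ --> X]/(EFin 0); apply: cvg_EFin.
      by apply: nearW.
    rewrite -(mulr0 `|V z|); apply: cvgMr.
    rewrite -(@normr0 _ R) -(subrr (s z)); apply: cvg_norm.
    by apply: cvgB; [exact: cvg_cst|exact: cs].
  - exact: integrable_norm.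
  - move=> n z _; rewrite /= lee_fin normrM !normr_id ler_piMr//.
    exact: unit_dist_le1.
rewrite integral0 in cv.
move/fine_cvgP : cv => [_ /cvgrPdist_le/(_ _ e2)[n _ /(_ n (leqnn n))]] /=.
rewrite sub0r normrN => small.
have {small} dn : cutoff_dist s (s_ n) <= eta / 2 := le_trans (ler_norm _) small.
have [h hh hs] := (sA n).2 _ e2; have uh := smooth_cutoff_unit hh.
exists h => //; rewrite (splitr eta); apply: le_trans (lerD dn hs).
rewrite /cutoff_dist -RintegralD//; try exact: cutoff_dist_integrable.
apply: le_Rintegral => //.
- exact: cutoff_dist_integrable.
- by apply: integrable_realD => //; exact: cutoff_dist_integrable.
move=> z _; rewrite -mulrDr ler_wpM2l//.
by rewrite (le_trans _ (ler_normD _ _))// subrKA.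
Qed.

Lemma approximable_integral_ge0 s :
  (forall h, product_cone h -> 0 <= \int[tx]_(z in Q) (V z * h z)) ->
  approximable s -> 0 <= \int[tx]_(z in Q) (V z * s z).
Proof.
move=> VP [us sP]; apply/ler_addgt0Pr => eta /sP[h hh hs].
have uh := smooth_cutoff_unit hh.
have Vs s' : unit_valued s' -> tx.-integrable Q (EFin \o (fun z => V z * s' z)).
  move=> [ms' s'01]; apply: (integrable_realM_bounded mQ Vi ms' (B := 1)) => z _.
  by have /andP[? ?] := s'01 z; rewrite ger0_norm.
apply: le_trans (VP _ hh.1) _.
rewrite addrC -lerBlDr -RintegralB//; try exact: Vs.
apply: le_trans hs; apply: le_Rintegral => //.
- by apply: integrable_realB => //; exact: Vs.
- exact: cutoff_dist_integrable.
by move=> z _; rewrite -mulrBr (le_trans (ler_norm _))// normrM distrC.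
Qed.

Lemma indic_unit E : measurable E -> unit_valued \1_E.
Proof.
move=> mE; split; first by apply: measurable_funTS; exact: measurable_indic.
by move=> z; rewrite indicE; case: (_ \in _); rewrite /= ?lexx ?ler01.
Qed.

Lemma approximable_coord_lt (c : space_time -> R) (x : R) : measurable_fun setT c ->
  (forall a b, smooth_cutoff (fun z => logistic (a * c z + b))) ->
  approximable \1_[set z | c z < x].
Proof.
move=> mc cP; have mE : measurable [set z | c z < x].
  rewrite (_ : mkset _ = c @^-1` `]-oo, x[%classic).
    by rewrite -[X in measurable X]setTI; exact: mc.
  by apply/seteqP; split=> z /=; rewrite in_itv.
apply: (@approximable_cvg (fun n z => logistic (logistic_slope n * c z + logistic_shift x n))).
- exact: indic_unit.
- by move=> n; exact/approximable_cutoff/cP.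
- move=> z; rewrite indicE (_ : (z \in _) = (c z < x)); first exact: cvg_logistic_step.
  by apply/idP/idP => [/set_mem|cz]//; exact: mem_set.
Qed.

Definition approximable_set E := measurable E /\ approximable \1_E.

(** Closure under products, complements and pointwise limits gives countable unions directly: their
    indicators are limits of 1 - prod_(i < n) (1 - 1_(F i)). *)
Lemma sigma_algebra_approximable : sigma_algebra setT approximable_set.
Proof.
have indicC1 E : \1_(~` E) = (fun z => 1 - \1_E z) :> (space_time -> R).
  by apply/funext => z; rewrite indicC indicE; case: (_ \in _); rewrite ?subrr ?subr0.
split.
- split=> //; rewrite -setCT indicC1; apply: approximableC.
  by rewrite indicT; exact/approximable_cutoff/smooth_cutoff1.
- move=> E [mE aE]; rewrite setTD; split; first exact: measurableC.
  by rewrite indicC1; exact: approximableC.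
- move=> F FP; have mF : measurable (\bigcup_n F n).
    by apply: bigcup_measurable => n _; case: (FP n).
  split=> //.
  apply: (@approximable_cvg (fun n z => 1 - \prod_(i < n) (1 - \1_(F i) z))).
  + exact: indic_unit.
  + move=> n; apply: approximableC; elim: n => [|n ih].
      by under eq_fun do rewrite big_ord0; exact/approximable_cutoff/smooth_cutoff1.
    under eq_fun do rewrite big_ord_recr; apply: approximableM => //.
    by apply: approximableC; case: (FP n).
  + move=> z; apply: cvg_near_cst; rewrite indicE.
    have [[k _ Fkz]|nF] := pselect ((\bigcup_n F n) z).
      exists k.+1 => // n /= kn; rewrite mem_set; last by exists k.
      rewrite (bigD1 (Ordinal kn))//= indicE mem_set//= subrr mul0r subr0//.
    exists 0%N => // n _ /=; rewrite memNset//= big1 ?subrr// => i _.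
    by rewrite indicE memNset ?subr0// => Fiz; apply: nF; exists i.
Qed.

Lemma approximable_coord (c : space_time -> R) (B : set R) : measurable_fun setT c ->
  (forall a b, smooth_cutoff (fun z => logistic (a * c z + b))) ->
  measurable B -> approximable_set (c @^-1` B).
Proof.
move=> mc cP mB; have := sigma_algebra_image c sigma_algebra_approximable.
move=> sa.
suff : measurable `<=` image_set_system setT c approximable_set.
  by move=> /(_ _ mB); rewrite /image_set_system/= setTI.
rewrite [X in X `<=` _](RGenInftyO.measurableE R); apply: smallest_sub => // _ [x ->].
rewrite /image_set_system /= setTI; split.
  by rewrite -[X in measurable X]setTI; apply: mc => //.
rewrite (_ : _ @^-1` _ = [set z | c z < x]); first exact: approximable_coord_lt.
by apply/seteqP; split=> z /=; rewrite in_itv.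
Qed.

Lemma measurable_approximable E : measurable E -> approximable \1_E.
Proof.
move=> mE; suff : approximable_set E by case.
have sa := sigma_algebra_approximable.
move: E mE; apply: smallest_sub => // E [[A mA <-]|[A mA <-]]; rewrite setTI.
  by apply: approximable_coord => //; exact: smooth_cutoff_time.
have := sigma_algebra_image (snd : space_time -> 'rV[R]_N) sa => sas.
suff : measurable `<=` image_set_system setT (snd : space_time -> 'rV[R]_N) approximable_set.
  by move=> /(_ _ mA); rewrite /image_set_system/= setTI.
apply: smallest_sub => // B; rewrite -bigcup_seq => -[i _ [D mD <-]].
rewrite /image_set_system /= !setTI.
rewrite -[X in approximable_set X]/((fun z : space_time => z.2 0 i) @^-1` D).
apply: approximable_coord => //; last exact: smooth_cutoff_space.
exact: (measurableT_comp (measurable_coord i) measurable_snd).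
Qed.

(** Testing against the indicator of the set where V is negative makes the integral of a nonpositive
    function nonnegative, so that function vanishes almost everywhere. *)
Lemma ae_ge0_of_product_cone :
  (forall h, product_cone h -> 0 <= \int[tx]_(z in Q) (V z * h z)) ->
  {ae tx, forall z, Q z -> 0 <= V z}.
Proof.
move=> VP; have mV := integrable_measurable Vi.
pose E : set space_time := Q `&` V @^-1` `]-oo, 0[%classic.
have mE : measurable E by exact: mV.
pose f z := V z * \1_E z.
have fE z : Q z -> `|f z| = - f z.
  move=> zQ; rewrite /f indicE; case: (pselect (E z)) => [[_ Vz]|nE].
    rewrite mem_set// mulr1 ltr0_norm//; by rewrite /= in_itv in Vz.
  by rewrite memNset// mulr0 normr0 oppr0.
have fi : tx.-integrable Q (EFin \o f).
  have [mu1 u01] := indic_unit mE.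
  apply: (integrable_realM_bounded mQ Vi mu1 (B := 1)) => z _.
  by have /andP[? ?] := u01 z; rewrite ger0_norm.
have f0 : (\int[tx]_(z in Q) `|(EFin \o f) z| = 0)%E.
  rewrite (_ : integral _ _ _ = \int[tx]_(z in Q) (- f z)%:E)%E; last first.
    by apply: eq_integral => z /set_mem zQ /=; rewrite fE.
  have nfi : tx.-integrable Q (EFin \o (fun z => - f z)).
    have := integrable_realZl mQ (- 1) fi.
    by apply: eq_integrable => // z _; rewrite /= mulN1r.
  rewrite integral_EFin_Rintegral//; congr EFin; apply/eqP; rewrite eq_le.
  rewrite [X in _ && X]Rintegral_ge0 ?andbT; last by move=> z zQ; rewrite -fE.
  under eq_Rintegral do rewrite -mulN1r.
  rewrite RintegralZl// mulN1r oppr_le0.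
  by apply: (approximable_integral_ge0 VP); exact: measurable_approximable.
have [_ /(_ _)] := ae_eq_integral_abs tx mQ (measurable_int _ fi).
have /(ae_eq_integral_abs tx mQ (measurable_int _ fi)) := f0.
move=> + _; apply: filterS => z /= fz zQ; have {fz} := fz zQ.
rewrite /f indicE => -[fz]; rewrite leNgt; apply/negP => Vz.
move: fz; rewrite mem_set; first by rewrite mulr1 => /eqP; rewrite lt_eqF.
by split=> //; rewrite /= in_itv.
Qed.

End approximation.
End ae_nonneg.

(** * The barrier below a weak solution *)

Section lower_bound.
Context {R : realType} {N : nat}.
Notation mu := (@lebesgue_rV R N).
Notation leb := (@lebesgue_measure R).
Notation tx := (@lebesgue_tx R N).
Notation Q := (@Qset R N).
Notation space_time := (measurableTypeR R * 'rV[R]_N)%type.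

Lemma Rintegral_Q_prod (T : R) (c : R -> R) (g : 'rV[R]_N -> R) : 0 < T ->
  {within `[0, T], continuous c} -> (forall t, 0 <= t <= T -> 0 <= c t) ->
  (forall x, 0 <= g x) -> mu.-integrable setT (EFin \o g) ->
  \int[tx]_(z in Q T) (c z.1 * g z.2) =
  (\int[leb]_(t in `[0, T]) c t) * \int[mu]_x g x.
Proof.
move=> T0 cc c0 g0 gi; have ci := within_continuous_integrable cc.
have oi : leb.-integrable `]0%R, T[ (EFin \o c).
  by apply: integrableS ci => //; exact: subset_itv_oo_cc.
have ooE : \int[leb]_(t in `]0, T[) c t = \int[leb]_(t in `[0, T]) c t.
  rewrite Rintegral_itv_bndo_bndc// Rintegral_itv_obnd_cbnd//.
  by apply: integrableS ci => //; exact: subset_itv_oc_cc.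
rewrite -ooE; apply: EFin_inj; rewrite EFinM -!integral_EFin_Rintegral//.
- apply: integral_Q_prod => //.
  + exact: within_continuous_measurable.
  + by move=> t /andP[t0 tT]; rewrite c0// !ltW.
  + exact: integrable_measurable gi.
- exact: measurable_Qset.
- have [B _ cB] := within_continuous_bounded cc.
  apply: (integrable_Q_prod T0 (B := B)) => //; first exact: within_continuous_measurable.
  by move=> t /andP[t0 tT]; apply: cB; rewrite !ltW.
Qed.

Lemma continuous_id_expRM (d : R) : continuous (fun t : R => t * expR (d * t)).
Proof.
move=> t; apply: cvgM; first exact: cvg_id.
apply: (continuous_comp (f := *%R d)); last exact: continuous_expR.
exact: mulrl_continuous.
Qed.

Definition barrier_profile alpha (z : space_time) : R :=
  z.1 * expR (- @decay_rate R N alpha * z.1) * gauss z.2.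

(** The coefficients are read off [weak_solution_estimate] after division by
    [absorb_factor beta 1 T]; the Gaussian in the profile comes from [gauss_mass g]. *)
Definition barrier alpha beta k T (z : space_time) : R :=
  k * (@gauss_const R N / absorb_factor beta 1 T) * barrier_profile alpha z
  - T `^ (1 + beta) / (1 + beta).

Lemma weak_solution_ge_barrier alpha beta p k T (u : R * 'rV[R]_N -> R) :
  0 < alpha < 1 -> - 1 < beta -> 0 < p <= 1 -> 0 < k -> weak_solution alpha beta p k u ->
  0 < T -> {ae tx, forall z, Q T z -> barrier alpha beta k T z <= u z}.
Proof.
move=> halpha hbeta hp hk hu T0; have mQ := @measurable_Qset R N T.
pose w : space_time -> R := barrier alpha beta k T.
(* The Gaussian factor makes V integrable despite the constant term of w, and turns any bounded
   factor G into the integrable density [gauss x * G x] that the estimate requires; being positive,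
   it does not change the sign. *)
pose V (z : space_time) : R := (u z - w z) * gauss z.2.
pose a : R := k * (@gauss_const R N / absorb_factor beta 1 T).
pose b : R := T `^ (1 + beta) / (1 + beta).
pose q (t : R) : R := t * expR (- @decay_rate R N alpha * t).
have cq : {within `[0, T], continuous q}.
  by apply: continuous_subspaceT; exact: continuous_id_expRM.
have mgauss := @measurable_gauss R N; have gi := @gauss_integrable R N _ halpha.
have gauss01 (x : 'rV[R]_N) : `|gauss x| <= 1 by rewrite ger0_norm ?gauss_le1// ltW// gauss_gt0.
have gauss_ge0 (x : 'rV[R]_N) : 0 <= gauss x by exact/ltW/gauss_gt0.
have ui : tx.-integrable (Q T) (EFin \o (u : space_time -> R)) by exact: (weak_L1 hu T0).
have ugi : tx.-integrable (Q T) (EFin \o (fun z : space_time => u z * gauss z.2)).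
  by apply: (integrable_realM_bounded mQ ui (B := 1)) => //; exact: measurable_Q_snd.
have prodi (c : R -> R) (g : 'rV[R]_N -> R) : {within `[0, T], continuous c} ->
    mu.-integrable setT (EFin \o g) ->
    tx.-integrable (Q T) (EFin \o (fun z : space_time => c z.1 * g z.2)).
  move=> cc gint; have [B _ cB] := within_continuous_bounded cc.
  apply: (integrable_Q_prod T0 (B := B)) => //; first exact: within_continuous_measurable.
  by move=> t /andP[t0 tT]; apply: cB; rewrite !ltW.
have wE (c : R -> R) (g : 'rV[R]_N -> R) z : w z * (c z.1 * g z.2) =
    a * ((q z.1 * c z.1) * (gauss z.2 * g z.2)) - b * (c z.1 * g z.2).
  by rewrite /w /barrier /barrier_profile -/a -/b /q; ring.
have c1 : {within `[0, T], continuous (fun=> 1 : R)}.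
  by apply: continuous_subspaceT => r; exact: cvg_cst.
have ggi (g : 'rV[R]_N -> R) : mu.-integrable setT (EFin \o g) ->
    mu.-integrable setT (EFin \o (fun x => gauss x * g x)).
  move=> gint; have := integrable_realM_bounded measurableT gint mgauss (fun x _ => gauss01 x).
  by apply: eq_integrable => // x _; rewrite /= mulrC.
have wgi (c : R -> R) (g : 'rV[R]_N -> R) : {within `[0, T], continuous c} ->
    mu.-integrable setT (EFin \o g) ->
    tx.-integrable (Q T) (EFin \o (fun z : space_time => w z * (c z.1 * g z.2))).
  move=> cc gint.
  have i1 := integrable_realZl mQ a (prodi _ _ (within_continuousM cq cc) (ggi _ gint)).
  have i2 := integrable_realZl mQ b (prodi _ _ cc gint).
  by apply: eq_integrable (integrable_realB mQ i1 i2) => // z _; rewrite /= wE.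
have Vi : tx.-integrable (Q T) (EFin \o V).
  have := integrable_realB mQ ugi (wgi _ _ c1 gi).
  apply: eq_integrable => // z _.
  by rewrite /= /V; congr EFin; move: (gauss z.2) (u z) (w z) => x y y'; ring.
have bounded h : product_cone h -> exists B, forall z, Q T z -> `|h z| <= B.
  elim=> [c G cc c0 [B [L [M [_ [_ GB _] _]]]] G0|h1 h2 _ [B1 P1] _ [B2 P2]].
    have [B' _ cB] := within_continuous_bounded (continuous_subspaceT cc : {within `[0, T], continuous c}).
    exists (B' * B) => z /andP[t0 tT]; rewrite normrM ler_pM// cB// !ltW//.
  by exists (B1 + B2) => z zQ; rewrite (le_trans (ler_normD _ _))// lerD ?P1 ?P2.
have Vh h : product_cone h -> tx.-integrable (Q T) (EFin \o (fun z => V z * h z)).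
  move=> ch; have [B hB] := bounded _ ch.
  by apply: (integrable_realM_bounded mQ Vi (B := B)) => //; exact: measurable_product_cone.
suff /(ae_ge0_of_product_cone Vi) : forall h, product_cone h ->
    0 <= \int[tx]_(z in Q T) (V z * h z).
  apply: (@filterS _ (almost_everywhere tx)) => z Vz zQ; have := Vz zQ.
  by rewrite /V pmulr_lge0 ?gauss_gt0// subr_ge0.
move=> h; elim=> [c G cc c0 CG G0|h1 h2 ch1 ih1 ch2 ih2]; last first.
  under eq_Rintegral do rewrite mulrDr.
  by rewrite RintegralD ?addr_ge0//; exact: Vh.
have ch := product_cone_prod cc c0 CG G0.
have {}cc : {within `[0, T], continuous c} by exact: continuous_subspaceT.
pose g (x : 'rV[R]_N) : R := gauss x * G x.
have g0 x : 0 <= g x by rewrite mulr_ge0.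
have Cg : C11 g by apply: C11M => //; exact: C11_gauss.
have gint : mu.-integrable setT (EFin \o g).
  have [B [L [M [_ [mG GB _] _]]]] := CG.
  by apply: (integrable_realM_bounded measurableT gi (B := B)).
have [Bg [Mg [Mg0 gd]]] := density_C11 Cg g0 gint.
have [Bc _ cB] := within_continuous_bounded cc.
have c0T t : 0 <= t <= T -> 0 <= c t by [].
have cBT t : 0 <= t <= T -> c t <= Bc by move=> tT; exact: le_trans (ler_norm _) (cB _ tT).
have est := weak_solution_estimate halpha hbeta hp hk hu T0 cc c0T cBT Mg0 gd.
have ucg : tx.-integrable (Q T) (EFin \o (fun z : space_time => u z * (c z.1 * g z.2))).
  have := integrable_realD mQ (Vh _ ch) (wgi _ _ cc gint).
  apply: eq_integrable => // z _.
  by rewrite /= /V /g; congr EFin; ring.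
have -> : \int[tx]_(z in Q T) (V z * (c z.1 * G z.2)) =
    \int[tx]_(z in Q T) (u z * (c z.1 * g z.2)) - \int[tx]_(z in Q T) (w z * (c z.1 * g z.2)).
  rewrite -RintegralB//; last exact: wgi.
  by apply: eq_Rintegral => z _; rewrite /V /g; ring.
have -> : \int[tx]_(z in Q T) (w z * (c z.1 * g z.2)) =
    a * ((\int[leb]_(t in `[0, T]) (q t * c t)) * gauss_mass g)
    - b * ((\int[leb]_(t in `[0, T]) c t) * \int[mu]_x g x).
  have i1 := prodi _ _ (within_continuousM cq cc) (ggi _ gint).
  have i2 := prodi _ _ cc gint.
  under eq_Rintegral do rewrite wE.
  rewrite RintegralB//; [|exact: integrable_realZl|exact: integrable_realZl].
  rewrite !RintegralZl//.
  rewrite (Rintegral_Q_prod T0 cc c0T g0 gint).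
  rewrite (Rintegral_Q_prod T0 (within_continuousM cq cc) _ _ (ggi _ gint)).
  - by congr (a * (_ * _) - _); apply: eq_Rintegral => x _; rewrite mulrC.
  - move=> t /andP[t0 tT]; rewrite mulr_ge0// mulr_ge0// expR_ge0.
  - by move=> x; rewrite mulr_ge0.
move: est; rewrite -/b /a; have H0 : 0 < absorb_factor beta 1 T.
  exact: lt_le_trans (absorb_factor_ge1 hbeta 1 T).
rewrite -(ler_pdivrMl _ _ H0) => est.
rewrite subr_ge0 lerBlDr; apply: le_trans (le_trans est _); rewrite le_eqVlt; apply/orP; left.
  by apply/eqP; ring.
by apply/eqP; ring.
Qed.

End lower_bound.

(** * Continuity of the barrier profile *)

Section compact_bounds.
Context {R : realType} {N : nat}.

Lemma continuous_gauss : continuous (@gauss R N).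
Proof.
have -> : @gauss R N = fun x => expR (- \sum_(i < N) x 0 i ^+ 2).
  by apply/funext => x; rewrite /gauss sqr_enorm.
have csum (s : seq 'I_N) : continuous (fun x : 'rV[R]_N => \sum_(i <- s) x 0 i ^+ 2).
  elim: s => [|i s ih].
    by under eq_fun do rewrite big_nil; exact: cst_continuous.
  under eq_fun do rewrite big_cons.
  move=> x; have ci : {for x, continuous (fun x : 'rV[R]_N => x 0 i)} by exact: coord_continuous.
  exact: (continuousD (continuousM ci ci) (ih x)).
move=> x; apply: (continuous_comp (f := fun x : 'rV[R]_N => - \sum_(i < N) x 0 i ^+ 2) (g := expR)).
  exact: (continuousN (csum _ x)).
exact: continuous_expR.
Qed.

Lemma continuous_barrier_profile (alpha : R) :
  continuous (@barrier_profile R N alpha : R * 'rV[R]_N -> R).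
Proof.
move=> z.
have c1 : {for z, continuous (fst : R * 'rV[R]_N -> R)} by exact: cvg_fst.
have c2 : {for z, continuous (snd : R * 'rV[R]_N -> 'rV[R]_N)} by exact: cvg_snd.
have ct := continuous_comp c1 (@continuous_id_expRM R (- @decay_rate R N alpha) z.1).
have cx := continuous_comp c2 (@continuous_gauss z.2).
exact: (continuousM ct cx).
Qed.

End compact_bounds.

Theorem proposition4p2 (R : realType) (N : nat) (alpha beta p : R)
    (u : R -> R * 'rV[R]_N -> R)
    (hN : (2 <= N)%N) (halpha : 0 < alpha < 1) (hbeta : -1 < beta)
    (hp : 0 < p <= 1)
    (hu : forall k : R, 0 < k -> weak_solution alpha beta p k (u k)) :
  cvg_pinfty_locally_uniformly Qinfty u.
Proof.
move=> K cK KQ A; have [->|/set0P K0] := eqVneq K set0.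
  by apply: nearW => k; apply: aeW => z.
have cfst : continuous (fst : R * 'rV[R]_N -> R) by move=> z; exact: cvg_fst.
have [zT zTK zTP] := compact_EVT_max K0 cK (continuous_subspaceT cfst).
have [zm zmK zmP] := compact_EVT_min K0 cK (continuous_subspaceT (@continuous_barrier_profile R N alpha)).
move: zTK zmK => /set_mem zTK /set_mem zmK.
(* The largest time in K plus 1 puts K inside the open slab Q_T; the minimum m is positive because K
   avoids time 0. *)
pose T : R := zT.1 + 1; pose m : R := barrier_profile alpha zm.
have T0 : 0 < T by rewrite addr_gt0//; exact: KQ zTK.
have m0 : 0 < m.
  by rewrite /m /barrier_profile !mulr_gt0 ?expR_gt0//; exact: KQ zmK.
pose c : R := @gauss_const R N / absorb_factor beta 1 T.
have c0 : 0 < c.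
  by rewrite divr_gt0 ?gauss_const_gt0// (lt_le_trans ltr01)// absorb_factor_ge1.
pose CT : R := T `^ (1 + beta) / (1 + beta).
near=> k.
have k0 : 0 < k by near: k; exact: nbhs_pinfty_gt.
have := weak_solution_ge_barrier halpha hbeta hp k0 (hu k k0) T0.
apply: (@filterS _ (almost_everywhere (@lebesgue_tx R N))) => z uz zK.
have zQ : Qset T z.
  apply/andP; split; first exact: KQ.
  by rewrite (@le_lt_trans _ _ zT.1) ?ltrDl// zTP// mem_set.
apply: le_trans (uz zQ); rewrite /barrier -/c -/CT lerBrDr.
have mz : m <= barrier_profile alpha z by rewrite zmP// mem_set.
apply: (@le_trans _ _ (k * (c * m))); last first.
  by rewrite -mulrA ler_wpM2l ?(ltW k0)// ler_wpM2l ?(ltW c0).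
rewrite -(ler_pdivrMr _ _ (mulr_gt0 c0 m0)).
by near: k; apply: nbhs_pinfty_ge; exact: num_real.
Unshelve. all: by end_near.
Qed.
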